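(* (Serre-Swan theorem for stratifolds.) Let $(S,\mathcal{C})$ be a stratifold. Then the global section functor $$\Gamma(S,-):\mathsf{VBb}_{(S,\mathcal{C})}\to \mathsf{Fgp}(\mathcal{C})$$ gives rise to an equivalence of categories, where $\mathsf{VBb}_{(S,\mathcal{C})}$ is the category of vector bundles of bounded rank over $(S,\mathcal{C})$ and $\mathsf{Fgp}(\mathcal{C})$ is the category of finitely generated projective $\mathcal{C}$-modules.
   Context: A differential space is a pair $(S,\mathcal{C})$ of a topological space $S$ and an $\mathbb{R}$-subalgebra $\mathcal{C}$ of the algebra $C^0(S)$ of continuous real-valued functions on $S$ which is locally detectable ($f\in\mathcal{C}$ if and only if for every $x\in S$ there are an open neighborhood $U$ of $x$ and $g\in\mathcal{C}$ with $f|_U=g|_U$) and $C^\infty$-closed (for all $n\ge 1$, $f_1,\dots,f_n\in\mathcal{C}$ and smooth $g:\mathbb{R}^n\to\mathbb{R}$, the function $x\mapsto g(f_1(x),\dots,f_n(x))$ is in $\mathcal{C}$). A morphism of differential spaces $f:(S,\mathcal{C})\to(S',\mathcal{C}')$ is a continuous map $f:S\to S'$ with $\varphi\circ f\in\mathcal{C}$ for all $\varphi\in\mathcal{C}'$. For a subspace $Y\subset S$, $\mathcal{C}_Y\subset C^0(Y)$ is the algebra of locally extendable functions: those $g$ such that each $x\in Y$ has an open neighborhood $V$ in $Y$ and $h\in\mathcal{C}$ with $g|_V=h|_V$; $(Y,\mathcal{C}_Y)$ is a differential space. For $x\in S$, $\mathcal{C}_x$ is the algebra of germs at $x$ of elements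 of $\mathcal{C}$ and $T_xS$ is the vector space of derivations of $\mathcal{C}_x$ (at $x$, i.e. into $\mathbb{R}$ via evaluation at $x$). A stratifold is a differential space $(S,\mathcal{C})$ such that: (1) $S$ is locally compact Hausdorff with countable basis; (2) the skeleta $sk_k(S)=\{x\in S\mid \dim T_xS\le k\}$ are closed in $S$; (3) for each $x\in S$ and open neighborhood $U$ of $x$ there is a non-negative $\rho\in\mathcal{C}$ with $\rho(x)\ne0$ and $\mathrm{supp}\,\rho\subset U$; (4) the strata $S^k:=sk_k(S)-sk_{k-1}(S)$ are $k$-dimensional smooth manifolds such that restriction along $S^k\hookrightarrow S$ induces an isomorphism $\mathcal{C}_x\to C^\infty(S^k)_x$ for each $x\in S^k$. All stratifolds are assumed finite-dimensional: $S=sk_n(S)$ for some $n\ge 0$. Open subsets $U$ of a stratifold, with $\mathcal{C}_U$, are stratifolds with strata $S^i\cap U$. A smooth manifold $M$ is the stratifold $(M,C^\infty(M))$. A local retraction near $x\in S^i$ is a morphism $r_x:(U,\mathcal{C}_U)\to(U\cap S^i,\mathcal{C}_{U\cap S^i})$, $U$ an open neighborhood of $x$ in $S$, with $r_x|_{U\cap S^i}=\mathrm{id}$. The product of stratifolds $S,S'$ is $(S\times S',\mathcal{C}_{S\times S'})$, where $\mathcal{C}_{S\times S'}$ consists of the functions $f:S\times S'\to\mathbb{R}$ which are smooth on every $S^i\times (S')^j$ and such that for each $(x,y)\in S^i\times(S')^j$ there are local retractions $r_x:U_x\to S^i\cap U_x$, $r_y:V_y\to (S')^j\cap V_y$ with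 $f|_{U_x\times V_y}=f\circ(r_x\times r_y)$. A vector bundle over a stratifold $(S,\mathcal{C})$ is a morphism of differential spaces $\pi:(E,\mathcal{C}_E)\to(S,\mathcal{C})$ such that (1) each $E_x=\pi^{-1}(x)$ is a real vector space; (2) there are an open cover $\{U_\alpha\}_{\alpha\in J}$ of $S$ and isomorphisms of differential spaces $\phi_\alpha:\pi^{-1}(U_\alpha)\to U_\alpha\times\mathbb{R}^{n_\alpha}$ (subspace structure on the left, product stratifold on the right); (3) $pr_1\circ\phi_\alpha=\pi$; (4) $pr_2\circ\phi_\alpha|_{E_x}:E_x\to\mathbb{R}^{n_\alpha}$ is a linear isomorphism for each $x\in U_\alpha$. It is bounded (of bounded rank) if $\{n_\alpha\}_{\alpha\in J}$ is bounded. A morphism of bundles $\varphi:E\to F$ over $S$ is a morphism of differential spaces with $\pi_F\circ\varphi=\pi_E$ which is linear on each fibre. For $U\subset S$ open, $\Gamma(U,E)$ is the set of morphisms of differential spaces $s:(U,\mathcal{C}_U)\to(E,\mathcal{C}_E)$ with $\pi\circ s=\mathrm{id}_U$ (identified with the inclusion $U\subset S$), a $\mathcal{C}_U$-module under pointwise operations; a bundle morphism $f$ induces $f_*(s)=f\circ s$. *)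

(* Defs.v *)
From HB Require Import structures.
From mathcomp Require Import all_boot all_order all_algebra generic_quotient.
From mathcomp Require Import all_classical reals topology normedtype derive.

Set Implicit Arguments.
Unset Strict Implicit.
Unset Printing Implicit Defensive.

Import Order.TTheory GRing.Theory Num.Theory.
Import numFieldNormedType.Exports.

Local Open Scope classical_set_scope.
Local Open Scope ring_scope.
Local Open Scope quotient_scope.

Record category := Category {
  ob :> Type;
  hom : ob -> ob -> Type;
  idm : forall a, hom a a;
  comp : forall a b c, hom b c -> hom a b -> hom a c;
  comp1m : forall a b (f : hom a b), comp (idm b) f = f;
  compm1 : forall a b (f : hom a b), comp f (idm a) = f;
  compmA : forall a b c d (h : hom c d) (g : hom b c) (f : hom a b),
    comp h (comp g f) = comp (comp h g) f }.

Arguments hom {c0} _ _ : rename.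
Arguments idm {c0} _ : rename.
Arguments comp {c0 a b c} _ _ : rename.

Record functor (C D : category) := Functor {
  fob :> C -> D;
  fmap : forall a b, hom a b -> hom (fob a) (fob b);
  fmap1 : forall a, fmap (idm a) = idm (fob a);
  fmapM : forall a b c (g : hom b c) (f : hom a b),
    fmap (comp g f) = comp (fmap g) (fmap f) }.

Arguments fmap {C D} f0 {a b} _ : rename.

Definition idF (C : category) : functor C C :=
  @Functor C C id (fun _ _ => id) (fun _ => erefl) (fun _ _ _ _ _ => erefl).

Section compF.
Variables (C D E : category) (G : functor D E) (F : functor C D).

Let compF1 a : fmap G (fmap F (idm a)) = idm (G (F a)).
Proof. by rewrite !fmap1. Qed.

Let compFM a b c (g : hom b c) (f : hom a b) :
  fmap G (fmap F (comp g f)) =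
  comp (fmap G (fmap F g)) (fmap G (fmap F f)).
Proof. by rewrite !fmapM. Qed.

Definition compF : functor C E :=
  @Functor C E (fun a => G (F a)) (fun a b f => fmap G (fmap F f)) compF1 compFM.

End compF.

Definition nat_isomorphic (C D : category) (F G : functor C D) : Prop :=
  exists (eta : forall a, hom (F a) (G a)) (theta : forall a, hom (G a) (F a)),
    [/\ forall a b (f : hom a b),
          comp (eta b) (fmap F f) = comp (fmap G f) (eta a),
        forall a, comp (theta a) (eta a) = idm (F a) &
        forall a, comp (eta a) (theta a) = idm (G a)].

Definition is_equivalence (C D : category) (F : functor C D) : Prop :=
  exists G : functor D C,
    nat_isomorphic (compF G F) (idF C) /\ nat_isomorphic (compF F G) (idF D).

Section fgp.
Variable A : pzRingType.

Definition finitely_generated (P : lmodType A) : Prop :=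
  exists (n : nat) (v : 'I_n -> P),
    forall p, exists c : 'I_n -> A, p = \sum_(i < n) c i *: v i.

Definition projective (P : lmodType A) : Prop :=
  forall (M N : lmodType A) (g : {linear M -> N}) (f : {linear P -> N}),
    (forall y, exists x, g x = y) ->
    exists h : {linear P -> M}, forall p, g (h p) = f p.

Definition is_fgp (P : lmodType A) : Prop :=
  finitely_generated P /\ projective P.

Lemma linear_ext (M N : lmodType A) (f g : {linear M -> N}) : f =1 g -> f = g.
Proof.
case: f g => [f [[fa] [fs]]] [g [[ga] [gs]]] /= fg.
have {}fg : f = g by apply/funext.
subst g.
by rewrite (Prop_irrelevance fa ga) (Prop_irrelevance fs gs).
Qed.

Definition fgp_ob : Type := {P : lmodType A | is_fgp P}.

Definition fgp_hom (P Q : fgp_ob) : Type := {linear sval P -> sval Q}.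

Definition fgp_id (P : fgp_ob) : fgp_hom P P :=
  [the {linear sval P -> sval P} of idfun].

Definition fgp_comp (P Q T : fgp_ob) (g : fgp_hom Q T) (f : fgp_hom P Q) :
  fgp_hom P T := [the {linear sval P -> sval T} of g \o f].

Definition Fgp : category.
Proof.
by refine (@Category fgp_ob fgp_hom fgp_id fgp_comp _ _ _) => *;
  exact: linear_ext.
Defined.

End fgp.

Section smooth.
Variables (R : realType) (n : nat).

(* Only meant for [U] open. *)
Fixpoint Ck (k : nat) (U : set 'rV[R]_n) (f : 'rV[R]_n -> R) : Prop :=
  (forall x, U x -> {for x, continuous f}) /\
  if k is k'.+1 then
    forall i : 'I_n,
      (forall x, U x -> derivable f x (delta_mx 0 i)) /\
      Ck k' U (fun x => 'D_(delta_mx 0 i) f x)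
  else True.

Definition smooth (U : set 'rV[R]_n) (f : 'rV[R]_n -> R) : Prop :=
  forall k, Ck k U f.

End smooth.

(* The data of a differential space, without its axioms.  The product and the
   subspaces are first built at this level, so that morphisms into and from
   them make sense before they are known to be differential spaces. *)
Record fspace (R : realType) := FSpace {
  fs_top :> topologicalType;
  fs_fun : set (fs_top -> R) }.

Section fspace_theory.
Variable R : realType.
Implicit Types X Y Z : fspace R.

Definition is_subalgebra (T : Type) (C : set (T -> R)) : Prop :=
  [/\ C 1, forall (a : R) f g, C f -> C g -> C (a *: f + g) &
      forall f g, C f -> C g -> C (f * g)].

Definition locally_detectable X : Prop :=
  forall f : X -> R, fs_fun f <->
    forall x, exists2 U : set X, open_nbhs x U &
      exists2 g, fs_fun g & forall y, U y -> f y = g y.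

Definition smoothly_closed X : Prop :=
  forall (n : nat) (f : 'I_n.+1 -> X -> R) (g : 'rV[R]_n.+1 -> R),
    (forall i, fs_fun (f i)) -> smooth setT g ->
    fs_fun (fun x => g (\row_i f i x)).

Definition is_differential_space X : Prop :=
  [/\ forall f : X -> R, fs_fun f -> continuous f, is_subalgebra (@fs_fun _ X),
      locally_detectable X & smoothly_closed X].

Definition is_morphism X Y (f : X -> Y) : Prop :=
  continuous f /\ forall phi, fs_fun phi -> fs_fun (phi \o f).

Definition is_isomorphism X Y (f : X -> Y) : Prop :=
  is_morphism f /\
  exists g : Y -> X, [/\ is_morphism g, cancel f g & cancel g f].

Lemma is_morphism_id X : is_morphism (@id X).
Proof. by split => // x. Qed.

Lemma is_morphism_comp X Y Z (g : Y -> Z) (f : X -> Y) :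
  is_morphism g -> is_morphism f -> is_morphism (g \o f).
Proof.
move=> [gc gm] [fc fm]; split; last by move=> phi /gm /fm.
by move=> x; apply: continuous_comp; [exact: fc|exact: gc].
Qed.

Definition subfspace X (Y : set X) : fspace R := @FSpace R (set_type Y)
  [set g : Y -> R | forall x : Y, exists2 V : set Y, open_nbhs x V &
     exists2 h : X -> R, fs_fun h & forall y, V y -> g y = h (val y)].

Definition euclidean (n : nat) : fspace R := @FSpace R 'rV[R]_n (smooth setT).

End fspace_theory.

Section germ.
Variables (R : realType) (T : topologicalType) (x : T).

Definition germ_eq (f g : T -> R) : bool := `[< \forall y \near x, f y = g y >].

Let germ_eq_refl : reflexive germ_eq.
Proof. by move=> f; apply/asboolP; near=> y. Unshelve. all: by end_near. Qed.

Let germ_eq_sym : symmetric germ_eq.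
Proof. by move=> f g; apply/asboolP/asboolP; apply: filterS => y ->. Qed.

Let germ_eq_trans : transitive germ_eq.
Proof.
move=> g f h /asboolP fg /asboolP gh; apply/asboolP.
by apply: filterS2 fg gh => y -> ->.
Qed.

Canonical germ_equiv := EquivRel germ_eq germ_eq_refl germ_eq_sym germ_eq_trans.

(* Germs at [x] of arbitrary real functions on [T]. *)
Definition germ : Type := {eq_quot germ_equiv}.

HB.instance Definition _ := Choice.on germ.

Definition germ_of (f : T -> R) : germ := \pi_({eq_quot germ_equiv}) f.

Definition germ_repr (u : germ) : T -> R :=
  repr (u : {eq_quot germ_equiv}).

Lemma germ_reprK : cancel germ_repr germ_of.
Proof. by move=> u; rewrite /germ_of /germ_repr reprK. Qed.

Lemma germ_ofE f g : germ_of f = germ_of g <-> \forall y \near x, f y = g y.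
Proof.
split; last by move=> fg; apply/eqmodP/asboolP.
by move=> /eqmodP/asboolP.
Qed.

Lemma germ_ofK f : \forall y \near x, germ_repr (germ_of f) y = f y.
Proof. by apply/germ_ofE; rewrite germ_reprK. Qed.

Definition germ_add (u v : germ) := germ_of (germ_repr u + germ_repr v).
Definition germ_opp (u : germ) := germ_of (- germ_repr u).
Definition germ_mul (u v : germ) := germ_of (germ_repr u * germ_repr v).
Definition germ_scale (a : R) (u : germ) := germ_of (a *: germ_repr u).

Lemma germ_addE f g : germ_add (germ_of f) (germ_of g) = germ_of (f + g).
Proof.
apply/germ_ofE; apply: filterS2 (germ_ofK f) (germ_ofK g) => y.
by rewrite !fctE => -> ->.
Qed.

Lemma germ_oppE f : germ_opp (germ_of f) = germ_of (- f).
Proof. by apply/germ_ofE; apply: filterS (germ_ofK f) => y; rewrite !fctE => ->. Qed.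

Lemma germ_mulE f g : germ_mul (germ_of f) (germ_of g) = germ_of (f * g).
Proof.
apply/germ_ofE; apply: filterS2 (germ_ofK f) (germ_ofK g) => y.
by rewrite !fctE => -> ->.
Qed.

Lemma germ_scaleE a f : germ_scale a (germ_of f) = germ_of (a *: f).
Proof. by apply/germ_ofE; apply: filterS (germ_ofK f) => y; rewrite !fctE => ->. Qed.

Lemma germP (u : germ) : exists f, u = germ_of f.
Proof. by exists (germ_repr u); rewrite germ_reprK. Qed.

Let germ_addA : associative germ_add.
Proof.
move=> u v w; have [f ->] := germP u; have [g ->] := germP v.
by have [h ->] := germP w; rewrite !germ_addE addrA.
Qed.

Let germ_addC : commutative germ_add.
Proof.
move=> u v; have [f ->] := germP u; have [g ->] := germP v.
by rewrite !germ_addE addrC.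
Qed.

Let germ_add0 : left_id (germ_of 0) germ_add.
Proof. by move=> u; have [f ->] := germP u; rewrite germ_addE add0r. Qed.

Let germ_addN : left_inverse (germ_of 0) germ_opp germ_add.
Proof.
by move=> u; have [f ->] := germP u; rewrite germ_oppE germ_addE addNr.
Qed.

HB.instance Definition _ :=
  GRing.isZmodule.Build germ germ_addA germ_addC germ_add0 germ_addN.

Lemma germ_ofD f g : germ_of (f + g) = germ_of f + germ_of g.
Proof. exact/esym/germ_addE. Qed.

Let germ_mulA : associative germ_mul.
Proof.
move=> u v w; have [f ->] := germP u; have [g ->] := germP v.
by have [h ->] := germP w; rewrite !germ_mulE mulrA.
Qed.

Let germ_mulC : commutative germ_mul.
Proof.
move=> u v; have [f ->] := germP u; have [g ->] := germP v.
by rewrite !germ_mulE mulrC.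
Qed.

Let germ_mul1 : left_id (germ_of 1) germ_mul.
Proof. by move=> u; have [f ->] := germP u; rewrite germ_mulE mul1r. Qed.

Let germ_mulDl : left_distributive germ_mul +%R.
Proof.
move=> u v w; have [f ->] := germP u; have [g ->] := germP v.
by have [h ->] := germP w; rewrite -germ_ofD !germ_mulE mulrDl germ_ofD.
Qed.

HB.instance Definition _ :=
  GRing.Zmodule_isComPzRing.Build germ germ_mulA germ_mulC germ_mul1 germ_mulDl.

Let germ_scaleA a b u : germ_scale a (germ_scale b u) = germ_scale (a * b) u.
Proof. by have [f ->] := germP u; rewrite !germ_scaleE scalerA. Qed.

Let germ_scale1 : left_id 1 germ_scale.
Proof. by move=> u; have [f ->] := germP u; rewrite germ_scaleE scale1r. Qed.

Let germ_scaleDr : right_distributive germ_scale +%R.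
Proof.
move=> a u v; have [f ->] := germP u; have [g ->] := germP v.
by rewrite -germ_ofD !germ_scaleE scalerDr germ_ofD.
Qed.

Let germ_scaleDl v : {morph germ_scale^~ v : a b / a + b}.
Proof.
move=> a b; have [f ->] := germP v.
by rewrite !germ_scaleE scalerDl germ_ofD.
Qed.

HB.instance Definition _ := GRing.Zmodule_isLmodule.Build R germ
  germ_scaleA germ_scale1 germ_scaleDr germ_scaleDl.

Definition germ_eval (u : germ) : R := germ_repr u x.

Definition germs (C : set (T -> R)) : set germ := [set germ_of f | f in C].

End germ.

Arguments germs {R T} x C _.

(* For [i] continuous at [x], this is composition of germs with [i]. *)
Definition germ_pull (R : realType) (T T' : topologicalType) (i : T -> T')
    (x : T) (u : germ R (i x)) : germ R x :=
  germ_of x (germ_repr u \o i).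

(* [A] is meant to be a linear subspace of [V]. *)
Definition dim_le (R : pzRingType) (V : lmodType R) (A : set V) (k : nat) : Prop :=
  exists2 b : 'I_k -> V, forall i, A (b i) &
    forall v, A v -> exists c : 'I_k -> R, v = \sum_(i < k) c i *: b i.

Section strata.
Variables (R : realType) (X : fspace R).

Definition germs_at (x : X) : set (germ R x) := germs x (@fs_fun R X).
Arguments germs_at x _ : clear implicits.

(* Derivations at [x] of the algebra of germs at [x]; sums and products are
   taken in [germ R x], of which the germs of elements of the structure algebra
   form a subalgebra when [X] is a differential space. *)
Definition tangent (x : X) : set (germs_at x -> R) := [set D |
  (forall (a : R) (u v w : germs_at x),
     val w = a *: val u + val v -> D w = a * D u + D v) /\
  (forall u v w : germs_at x,
     val w = val u * val v ->
     D w = germ_eval (val u) * D v + D u * germ_eval (val v))].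

Arguments tangent x _ : clear implicits.

Definition skeleton (k : nat) : set X := [set x | dim_le (tangent x) k].

Definition stratum (k : nat) : set X :=
  if k is k'.+1 then skeleton k `\` skeleton k' else skeleton 0.

End strata.

Arguments germs_at {R X} x _.
Arguments tangent {R X} x _.
Arguments skeleton {R} X k _.
Arguments stratum {R} X k _.

(* Only the restrictions of [chart_map] to [chart_dom] and of [chart_inv] to
   [chart_cod] are meaningful. *)
Record chart (R : realType) (M : topologicalType) (k : nat) := Chart {
  chart_dom : set M;
  chart_map : M -> 'rV[R]_k;
  chart_inv : 'rV[R]_k -> M }.

Section manifold.
Variables (R : realType) (M : topologicalType) (k : nat).
Implicit Types (c : chart R M k) (A : set (chart R M k)).

Definition chart_cod c : set 'rV[R]_k := chart_map c @` chart_dom c.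

Definition is_chart c : Prop :=
  [/\ open (chart_dom c), open (chart_cod c),
      forall x, chart_dom c x -> {for x, continuous (chart_map c)},
      forall z, chart_cod c z -> {for z, continuous (chart_inv c)} &
      forall x, chart_dom c x -> chart_inv c (chart_map c x) = x].

Definition smoothly_compatible c c' : Prop :=
  forall i : 'I_k, smooth (chart_map c @` (chart_dom c `&` chart_dom c'))
                          (fun z => chart_map c' (chart_inv c z) 0 i).

Definition is_atlas A : Prop :=
  [/\ forall c, A c -> is_chart c,
      forall x, exists2 c, A c & chart_dom c x &
      forall c c', A c -> A c' -> smoothly_compatible c c'].

Definition is_manifold A : Prop :=
  [/\ hausdorff_space M, @second_countable M & is_atlas A].

Definition smooth_fun A : set (M -> R) :=
  [set f : M -> R | forall c, A c -> smooth (chart_cod c) (f \o chart_inv c)].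

End manifold.

Section product_manifold.
Variables (R : realType) (M N : topologicalType) (k l : nat).

Definition prod_chart (c : chart R M k) (d : chart R N l) :
    chart R (M * N)%type (k + l) :=
  Chart (chart_dom c `*` chart_dom d)
        (fun p => row_mx (chart_map c p.1) (chart_map d p.2))
        (fun z => (chart_inv c (lsubmx z), chart_inv d (rsubmx z))).

Definition prod_atlas (A : set (chart R M k)) (B : set (chart R N l)) :
    set (chart R (M * N)%type (k + l)) :=
  [set e | exists c d, [/\ A c, B d & e = prod_chart c d]].

End product_manifold.

Section stratifold.
Variable R : realType.
Implicit Types X Y : fspace R.

(* The smooth structure on a stratum is determined by the condition on germs:
   any two such atlases have the same smooth functions. *)
Definition is_stratum_atlas X k (A : set (chart R (stratum X k) k)) : Prop :=
  is_manifold A /\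
  forall x : stratum X k,
    set_bij (germs_at (val x)) (germs x (smooth_fun A))
      (@germ_pull R _ X (fun y : stratum X k => val y) x).

Definition is_stratifold X : Prop :=
  [/\ [/\ locally_compact [set: X], hausdorff_space X & @second_countable X],
      forall k, closed (skeleton X k),
      forall (x : X) (U : set X), open_nbhs x U ->
        exists rho : X -> R, [/\ fs_fun rho, forall y, 0 <= rho y, rho x != 0 &
                                 closure [set y | rho y != 0] `<=` U],
      forall k, exists A, @is_stratum_atlas X k A &
      exists n, skeleton X n = setT].

Record local_retraction X (k : nat) (x : X) := LocalRetraction {
  lr_dom : set X;
  lr_map : subfspace lr_dom -> subfspace (lr_dom `&` stratum X k);
  lr_nbhs : open_nbhs x lr_dom;
  lr_morphism : is_morphism lr_map;
  lr_id : forall u, stratum X k (val u) -> val (lr_map u) = val u }.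

Arguments lr_map {X k x} _ _.

Definition prod_fspace X Y : fspace R := @FSpace R (X * Y)%type
  [set f : X * Y -> R |
    (forall k l, exists A B,
       [/\ @is_stratum_atlas X k A, @is_stratum_atlas Y l B &
           smooth_fun (prod_atlas A B) (fun p => f (val p.1, val p.2))]) /\
    (forall k l (x : X) (y : Y), stratum X k x -> stratum Y l y ->
       exists (r : local_retraction k x) (s : local_retraction l y),
         forall u v, f (val u, val v) = f (val (lr_map r u), val (lr_map s v)))].

End stratifold.

Record dspace (R : realType) := DSpace {
  ds_fspace :> fspace R;
  ds_axioms : is_differential_space ds_fspace }.

Record stratifold (R : realType) := Stratifold {
  st_dspace :> dspace R;
  st_axioms : is_stratifold st_dspace }.

Section structure_algebra.
Variables (R : realType) (X : dspace R).

Definition structure_fun : {pred X -> R} := mem (@fs_fun R X).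

Let structure_subring : GRing.subring_closed structure_fun.
Proof.
have [_ [C1 CD CM] _ _] := ds_axioms X.
split; first exact/mem_set.
  move=> f g /set_mem Cf /set_mem Cg; apply/mem_set.
  by rewrite addrC -scaleN1r; exact: CD.
by move=> f g /set_mem Cf /set_mem Cg; apply/mem_set; exact: CM.
Qed.

Definition algebra : Type := {f : X -> R | f \in structure_fun}.

HB.instance Definition _ := SubChoice.on algebra.
HB.instance Definition _ := GRing.SubChoice_isSubComPzRing.Build
  (X -> R) structure_fun algebra structure_subring.

End structure_algebra.

Definition fibre (E S : Type) (pi : E -> S) (x : S) : Type := {e : E | pi e = x}.

Lemma fibre_eq (E S : Type) (pi : E -> S) (x : S) (e e' : fibre pi x) :
  sval e = sval e' -> e = e'.
Proof. by case: e e' => [e ee] [e' ee'] /=; exact: eq_exist. Qed.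

Section trivialization.
Variables (R : realType) (S E : fspace R) (pi : E -> S).
Variable (fm : forall x, GRing.Lmodule R (fibre pi x)).

Definition fibre_lmod (x : S) : lmodType R := GRing.Lmodule.Pack (fm x).

Lemma fibre_in (U : set S) (x : S) (Ux : U x) (e : fibre pi x) :
  sval e \in pi @^-1` U.
Proof. by apply/mem_set; rewrite /preimage /= (svalP e). Qed.

Definition fibre_sub (U : set S) (x : S) (Ux : U x) (e : fibre pi x) :
  subfspace (pi @^-1` U) := exist _ (sval e) (fibre_in Ux e).

Definition is_trivialization (U : set S) (n : nat)
    (phi : subfspace (pi @^-1` U) -> prod_fspace (subfspace U) (euclidean R n)) :
    Prop :=
  [/\ is_isomorphism phi,
      forall e, val (phi e).1 = pi (val e) &
      forall (x : S) (Ux : U x),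
        let phix : fibre_lmod x -> 'rV[R]_n := fun e => (phi (fibre_sub Ux e)).2 in
        linear phix /\ bijective phix].

Definition trivial_cover (J : Type) (U : J -> set S) (n : J -> nat) : Prop :=
  [/\ forall a, open (U a), \bigcup_a U a = setT &
      forall a, exists phi, @is_trivialization (U a) (n a) phi].

End trivialization.

Record vbundle (R : realType) (S : fspace R) := VBundle {
  vb_total :> dspace R;
  vb_proj : vb_total -> S;
  vb_fibre : forall x, GRing.Lmodule R (fibre vb_proj x);
  vb_proj_morphism : is_morphism vb_proj;
  vb_trivial : exists (J : Type) U (n : J -> nat), trivial_cover vb_fibre U n }.

Arguments vb_fibre {R S} E x : rename.

Definition bounded_rank (R : realType) (S : fspace R) (E : vbundle S) : Prop :=
  exists (J : Type) U (n : J -> nat),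
    trivial_cover (vb_fibre E) U n /\ exists N, forall a, (n a <= N)%N.

Section bundle_category.
Variables (R : realType) (S : fspace R).
Implicit Types E F G : vbundle S.

Definition vfibre E (x : S) : lmodType R := fibre_lmod (vb_fibre E) x.

Definition fibre_map E F (f : E -> F)
    (fp : forall e, vb_proj (f e) = vb_proj e) (x : S) (e : vfibre E x) :
    vfibre F x :=
  exist _ (f (sval e)) (etrans (fp (sval e)) (svalP e)).

Record vb_hom E F := VBHom {
  vbh_map :> E -> F;
  vbh_morphism : is_morphism vbh_map;
  vbh_proj : forall e, vb_proj (vbh_map e) = vb_proj e;
  vbh_linear : forall x, linear (@fibre_map E F vbh_map vbh_proj x) }.

Arguments vbh_proj {E F} f e : rename.
Arguments vbh_linear {E F} f x : rename.

Lemma vb_hom_ext E F (f g : vb_hom E F) : f =1 g -> f = g.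
Proof.
case: f g => [f fm fp fl] [g gm gp gl] /= /funext fg.
subst g; rewrite (Prop_irrelevance fm gm).
by move: gl; rewrite (Prop_irrelevance gp fp) => gl; rewrite (Prop_irrelevance fl gl).
Qed.

Let vb_id_linear E x : linear (@fibre_map E E id (fun=> erefl) x).
Proof.
have idE (e : vfibre E x) : @fibre_map E E id (fun=> erefl) x e = e.
  exact: fibre_eq.
by move=> a u v; rewrite !idE.
Qed.

Definition vb_id E : vb_hom E E :=
  @VBHom E E id (is_morphism_id E) (fun=> erefl) (@vb_id_linear E).

Section comp.
Variables (E F G : vbundle S) (g : vb_hom F G) (f : vb_hom E F).

Let gf_proj e : vb_proj (g (f e)) = vb_proj e.
Proof. by rewrite !vbh_proj. Qed.

Let gf_linear x : linear (@fibre_map E G (g \o f) gf_proj x).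
Proof.
have gfE (e : vfibre E x) : @fibre_map E G (g \o f) gf_proj x e =
    fibre_map (vbh_proj g) (fibre_map (vbh_proj f) e).
  exact: fibre_eq.
by move=> a u v; rewrite !gfE !vbh_linear.
Qed.

Definition vb_comp : vb_hom E G :=
  @VBHom E G (g \o f)
    (is_morphism_comp (vbh_morphism g) (vbh_morphism f)) gf_proj gf_linear.

End comp.

Definition vbb_ob : Type := {E : vbundle S | bounded_rank E}.

Definition VBb : category.
Proof.
by refine (@Category vbb_ob (fun E F : vbb_ob => vb_hom (sval E) (sval F))
  (fun E : vbb_ob => vb_id (sval E))
  (fun (E F G : vbb_ob) g f => vb_comp g f) _ _ _) => *;
  exact: vb_hom_ext.
Defined.

End bundle_category.

Section sections.
Variables (R : realType) (S : dspace R) (E : vbundle S).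

Definition is_section (s : S -> E) : Prop :=
  is_morphism s /\ forall x, vb_proj (s x) = x.

Definition gsection : Type := {s : S -> E | is_section s}.

Definition sec_at (s : gsection) (x : S) : vfibre E x :=
  exist _ (sval s x) ((svalP s).2 x).

Lemma gsection_ext (s t : gsection) : (forall x, sec_at s x = sec_at t x) -> s = t.
Proof.
case: s t => [s hs] [t ht] st; apply: eq_exist; apply/funext => x.
by have /(congr1 sval) := st x.
Qed.

Definition sections_closed : Prop :=
  [/\ is_section (fun x => sval (0 : vfibre E x)),
      forall s t : gsection,
        is_section (fun x => sval (sec_at s x + sec_at t x)) &
      forall (a : algebra S) (s : gsection),
        is_section (fun x => sval (val a x *: sec_at s x))].

End sections.

(* The module of global sections, given that they are stable under the pointwise
   operations. *)
Definition Gamma (R : realType) (S : dspace R) (E : vbundle S)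
  (_ : sections_closed E) : Type := gsection E.

Section section_module.
Variables (R : realType) (S : dspace R) (E : vbundle S).
Variable closedE : sections_closed E.

Local Notation M := (Gamma closedE).

Let closed0 := let: And3 h _ _ := closedE in h.
Let closedD := let: And3 _ h _ := closedE in h.
Let closedZ := let: And3 _ _ h := closedE in h.

Definition sec0 : M := exist _ _ closed0.
Definition sec_add (s t : M) : M := exist _ _ (closedD s t).
Definition sec_scale (a : algebra S) (s : M) : M :=
  exist _ _ (closedZ a s).
Definition sec_opp (s : M) : M := sec_scale (- 1) s.

Lemma sec0E x : sec_at sec0 x = 0.
Proof. exact: fibre_eq. Qed.

Lemma sec_addE s t x : sec_at (sec_add s t) x = sec_at s x + sec_at t x.
Proof. exact: fibre_eq. Qed.

Lemma sec_scaleE a s x : sec_at (sec_scale a s) x = val a x *: sec_at s x.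
Proof. exact: fibre_eq. Qed.

Lemma sec_oppE s x : sec_at (sec_opp s) x = - sec_at s x.
Proof. by rewrite sec_scaleE -scaleN1r rmorphN rmorph1. Qed.

HB.instance Definition _ := gen_eqMixin M.
HB.instance Definition _ := gen_choiceMixin M.

Let sec_addA : associative sec_add.
Proof. by move=> s t u; apply: gsection_ext => x; rewrite !sec_addE addrA. Qed.

Let sec_addC : commutative sec_add.
Proof. by move=> s t; apply: gsection_ext => x; rewrite !sec_addE addrC. Qed.

Let sec_add0 : left_id sec0 sec_add.
Proof. by move=> s; apply: gsection_ext => x; rewrite sec_addE sec0E add0r. Qed.

Let sec_addN : left_inverse sec0 sec_opp sec_add.
Proof.
by move=> s; apply: gsection_ext => x; rewrite sec_addE sec0E sec_oppE addNr.
Qed.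

HB.instance Definition _ :=
  GRing.isZmodule.Build M sec_addA sec_addC sec_add0 sec_addN.

Let sec_scaleA a b s : sec_scale a (sec_scale b s) = sec_scale (a * b) s.
Proof. by apply: gsection_ext => x; rewrite !sec_scaleE scalerA. Qed.

Let sec_scale1 : left_id 1 sec_scale.
Proof. by move=> s; apply: gsection_ext => x; rewrite sec_scaleE scale1r. Qed.

Let sec_scaleDr : right_distributive sec_scale +%R.
Proof.
move=> a s t; apply: gsection_ext => x.
by rewrite sec_scaleE !sec_addE !sec_scaleE scalerDr.
Qed.

Let sec_scaleDl s : {morph sec_scale^~ s : a b / a + b}.
Proof.
move=> a b; apply: gsection_ext => x.
by rewrite sec_addE !sec_scaleE scalerDl.
Qed.

HB.instance Definition _ := GRing.Zmodule_isLmodule.Build (algebra S) M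
  sec_scaleA sec_scale1 sec_scaleDr sec_scaleDl.

End section_module.

Section global_section_functor.
Variables (R : realType) (S : dspace R).

Section push.
Variables (E F : vbundle S) (cE : sections_closed E) (cF : sections_closed F).
Variable f : vb_hom E F.

Let push_section (s : Gamma cE) : is_section (f \o sval s).
Proof.
split; first exact: is_morphism_comp (vbh_morphism f) (svalP s).1.
by move=> x; rewrite /= vbh_proj (svalP s).2.
Qed.

Definition push (s : Gamma cE) : Gamma cF := exist _ _ (push_section s).

Let pushE s x : sec_at (push s) x = fibre_map (vbh_proj f) (sec_at s x).
Proof. exact: fibre_eq. Qed.

Let push_linear : linear push.
Proof.
move=> a s t; apply: gsection_ext => x.
rewrite pushE [in LHS]sec_addE [in LHS]sec_scaleE vbh_linear.
by rewrite [RHS]sec_addE sec_scaleE !pushE.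
Qed.

HB.instance Definition _ :=
  GRing.isLinear.Build (algebra S) (Gamma cE) (Gamma cF) *:%R push push_linear.

Definition push_lin : {linear Gamma cE -> Gamma cF} := push.

End push.

(* Stability of sections under the operations and the fact that they form a
   finitely generated projective module are proofs the functor depends on. *)
Variable closed_sections : forall E : VBb S, sections_closed (sval E).
Variable fgp_sections : forall E : VBb S, is_fgp (Gamma (closed_sections E)).

Definition global_sections : functor (VBb S) (Fgp (algebra S)).
Proof.
refine (@Functor (VBb S) (Fgp (algebra S))
  (fun E => exist _ (Gamma (closed_sections E) : lmodType (algebra S)) (fgp_sections E))
  (fun E F f => push_lin (closed_sections E) (closed_sections F) f) _ _).
- by move=> E; apply: linear_ext => s; apply: gsection_ext => x; apply: fibre_eq.
- by move=> E F G g f; apply: linear_ext => s; apply: gsection_ext => x;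
     apply: fibre_eq.
Defined.

End global_section_functor.

(* Main.v *)
From HB Require Import structures.
Require Import Defs.
From mathcomp Require Import all_boot all_order all_algebra generic_quotient.
From mathcomp Require Import all_classical all_reals all_analysis.
From mathcomp Require Import measurable_realfun.
From mathcomp Require Import ring lra.

Set Implicit Arguments.
Unset Strict Implicit.
Unset Printing Implicit Defensive.
Import Order.TTheory GRing.Theory Num.Theory.
Import numFieldNormedType.Exports.
Local Open Scope classical_set_scope.
Local Open Scope ring_scope.

(** Write [A] for the structure algebra of [S]. A full, faithful and essentially surjective functor
    is an equivalence ([fully_faithful_essentially_surjective]), so the work lies in relating
    bundles to modules in both directions.

    The central notion is a finite [frame] of a bundle [E]: global sections [b i] and structure
    functions [q i] on [E], linear on fibres, such that every vector [e] over [x] equals the sum of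
    the [q i e] times [b i x]. This presents [E] as a direct summand of a trivial bundle. On
    sections it is a dual basis, so the module of sections is finitely generated projective
    ([frame_fgp]). Since the [b i] span every fibre, a bundle map is determined by its effect on
    sections ([push_inj]), and a module map [Phi] is induced by sending [e] to the sum of the
    [q i e] times [Phi (b i) x] ([push_surj]). Conversely, a finitely generated projective module is
    the image of an idempotent matrix over [A] ([fgp_idempotent]); the images of its evaluations at
    the points of [S] form a vector bundle ([idem_ltriv]), whose sections give the module back
    ([fgp_sections_bundle]).

    The hard point is the existence of a frame ([bounded_rank_frame]). A trivializing cover may be
    infinite; it has to be regrouped into finitely many colours such that the members of one colour
    are disjoint and can be treated as a single trivializing set. Take countably many bump functions
    [rho j] subordinate to the cover and, for each colour [i], levels [c i j]. In colour [i] the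
    [j]-th set is where [rho j] exceeds its level while all earlier [rho l] stay below theirs
    ([level_cover]). A point missed by colour [i] lies on one of the level sets of that colour. If
    [S] has dimension [d], then for generic levels no point lies on level sets of all [d + 1]
    colours ([thin_levels], [thin_setT]). The dimension argument is measure-theoretic: an
    [m]-dimensional chart ball has vanishing [m + 1]-dimensional content, Eilenberg's inequality
    ([null_content_slice]) lowers the dimension by one on almost every level set, and a set of
    vanishing [0]-dimensional content is empty. The bound on the ranks then makes the number of
    sections in the frame finite.

    To work with local trivializations at all, the product stratifold [U * R^n] must be made
    explicit: its functions are exactly the local smooth functions of finitely many structure
    functions of [U] and of the coordinates of [R^n] ([prod_fspaceE]). This needs the strata of
    [R^n], hence its tangent spaces, which Hadamard's lemma computes, and the existence of local
    retractions, obtained by extending chart coordinates off a stratum. *)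

(** * The mean value theorem in several variables *)

Section between.
Variable R : realType.

Definition between (a b c : R) := (Num.min a b <= c) && (c <= Num.max a b).

Lemma between_dist (a b c : R) : between a b c -> `|c - a| <= `|b - a|.
Proof. by rewrite /between; case: (leP a b) => ab /andP[]; case: (lerP a c); case: (lerP a b); lra. Qed.

Lemma betweenl (a b : R) : between a b a.
Proof. by rewrite /between ge_min le_max lexx. Qed.

Lemma betweenr (a b : R) : between a b b.
Proof. by rewrite /between ge_min le_max lexx !orbT. Qed.

Lemma between_dist_center (a b c z : R) :
  between a b c -> `|c - z| <= Num.max `|a - z| `|b - z|.
Proof.
set M := Num.max _ _ => cab.
have Ma : `|a - z| <= M by rewrite le_max lexx.
have Mb : `|b - z| <= M by rewrite le_max lexx orbT.
move: Ma Mb cab; rewrite /between !ler_norml.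
by case: (leP a b) => ab /andP[? ?] /andP[? ?] /andP[? ?]; lra.
Qed.

Lemma MVT_between (f df : R -> R) (a b : R) :
  (forall c, between a b c -> is_derive c 1 f (df c)) ->
  exists2 c, between a b c & f b - f a = (b - a) * df c.
Proof.
wlog ab : a b / a <= b => [hw|].
  case: (leP a b) => ab; first exact: hw.
  move=> h; have [c|c cba E] := hw b a (ltW ab).
  - by rewrite /between minC maxC; exact: h.
  - by exists c; [move: cba; rewrite /between minC maxC | rewrite -opprB E; ring].
rewrite /between min_l // max_r // => fd.
have [c|x|c] := @MVT_segment _ f df a b ab.
- by rewrite in_itv /= => /andP[? ?]; apply: fd; rewrite !ltW.
- apply: derivable_within_continuous => c; rewrite in_itv /= => /fd h.
  exact: ex_derive.
- by rewrite in_itv /= => cab E; exists c => //; rewrite E mulrC.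
Qed.

End between.

Section partial_derivatives.
Variables (R : realType) (n : nat).
Implicit Types (f g : 'rV[R]_n -> R) (x y z : 'rV[R]_n).

Local Notation e_ i := (delta_mx 0 i : 'rV[R]_n).

Lemma is_derive_line f x v (t : R) : derivable f (x + t *: v) v ->
  is_derive t 1 (fun s => f (x + s *: v)) ('D_v f (x + t *: v)).
Proof.
move=> fd.
have E (h : R) : h^-1 *: (f (x + (h *: 1 + t) *: v) - f (x + t *: v)) =
    h^-1 *: (f (h *: v + (x + t *: v)) - f (x + t *: v)).
  by rewrite [h *: 1]mulr1 scalerDl addrCA.
apply: DeriveDef; first by rewrite /derivable; under eq_fun do rewrite /= E.
by rewrite /derive; under eq_fun do rewrite /= E.
Qed.

Definition box x y : set 'rV[R]_n := [set z | forall i, between (x 0 i) (y 0 i) (z 0 i)].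

(* The increment is split along the polygonal path changing one coordinate at a
   time. *)
Lemma box_mvt f x y :
  (forall z i, box x y z -> derivable f z (e_ i)) ->
  exists2 xi : 'I_n -> 'rV[R]_n, forall i, box x y (xi i) &
    f y - f x = \sum_i (y 0 i - x 0 i) * 'D_(e_ i) f (xi i).
Proof.
move=> fd; pose h k : 'rV[R]_n := \row_j if (j < k)%N then y 0 j else x 0 j.
have step (i : 'I_n) : exists2 z, box x y z &
    f (h i.+1) - f (h i) = (y 0 i - x 0 i) * 'D_(e_ i) f z.
  pose p (t : R) := h i + (t - x 0 i) *: e_ i.
  have pE t j : p t 0 j = if j == i then t else if (j < i)%N then y 0 j else x 0 j.
    rewrite !mxE /=; case: eqP => [->|_].
      by rewrite ltnn mulr1 addrC subrK.
    by rewrite mulr0 addr0.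
  have pbox t : between (x 0 i) (y 0 i) t -> box x y (p t).
    move=> tb j; rewrite pE; case: eqP => [->//|_].
    by case: ifP => _; [exact: betweenr|exact: betweenl].
  have [t tb|t /pbox tb E] := @MVT_between R (f \o p) (fun t => 'D_(e_ i) f (p t)) (x 0 i) (y 0 i).
    have /(is_derive_line (x := h i - x 0 i *: e_ i)) : derivable f
        (h i - x 0 i *: e_ i + t *: e_ i) (e_ i).
      by rewrite -addrA [- _ + _]addrC -scalerBl; apply: fd; exact: pbox.
    rewrite /p; under eq_fun do rewrite -addrA [- _ + _]addrC -scalerBl.
    by rewrite -addrA [- _ + _]addrC -scalerBl.
  exists (p t) => //; rewrite -E; congr (f _ - f _); apply/rowP => j; rewrite pE mxE.
    rewrite ltnS leq_eqVlt; case: (eqVneq j i) => [->|ji]; first by rewrite eqxx.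
    by rewrite (_ : (j == i :> nat) = false) //; apply/negbTE.
  by case: eqP => [->|//]; rewrite ltnn.
have [xi xiP] := choice (fun i => (exists2P _ _).1 (step i)).
exists xi; first by move=> i; case: (xiP i).
under eq_bigr do rewrite -(xiP _).2.
rewrite -(big_mkord xpredT (fun i => f (h i.+1) - f (h i))) telescope_sumr //.
by congr (f _ - f _); apply/rowP => j; rewrite mxE ?ltn_ord.
Qed.

Lemma box_norm x y z : box x y z -> `|z - x| <= `|y - x|.
Proof.
move=> bz; rewrite {1}/Num.norm /= mx_normrE; apply: bigmax_le => // -[i j] _ /=.
rewrite !ord1 !mxE (le_trans (between_dist (bz j))) //.
rewrite {2}/Num.norm /= mx_normrE (le_trans _ (le_bigmax _ _ (0, j))) //.
by rewrite !mxE.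
Qed.

Lemma le_coord_norm x i : `|x 0 i| <= `|x|.
Proof.
rewrite {2}/Num.norm /= mx_normrE (le_trans _ (le_bigmax _ _ (0, i))) //.
Qed.

Lemma norm_row_le x (r : R) : 0 <= r -> (forall i, `|x 0 i| <= r) -> `|x| <= r.
Proof.
move=> r0 xr; rewrite /Num.norm /= mx_normrE; apply: bigmax_le => // -[i j] _ /=.
by rewrite ord1.
Qed.

End partial_derivatives.

(** * Differentiability, the chain rule, and functions of class [Ck] *)

Section smooth_calculus.
Variables (R : realType).

Local Notation e_ i := (delta_mx 0 i : 'rV[R]_(_)).

Lemma continuous_row (T : topologicalType) n (M : T -> 'rV[R]_n) (x : T) :
  (forall i, {for x, continuous (fun t => M t 0 i)}) -> {for x, continuous M}.
Proof.
move=> Mc A [P nP PA]; apply: filterS (PA) _.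
apply: (filter_forall (f := fun i t => forall j, P i j (M t i j))) => i.
by apply: filter_forall => j; rewrite ord1 in nP *; apply: Mc; have := nP 0 j.
Qed.

Section differentiability.
Variable n : nat.
Implicit Types (f g : 'rV[R]_n -> R) (x y z : 'rV[R]_n).

(** By [box_mvt] the increment is a sum of terms [h i] times a partial derivative at an intermediate
    point no further from [x] than [h] is long; continuity of the partial derivatives at [x] makes
    the error small against the norm of [h]. *)
Lemma C1_differentiable f x :
  (forall i, \forall z \near x, derivable f z (e_ i)) ->
  (forall i, {for x, continuous ('D_(e_ i) f)}) -> differentiable f x.
Proof.
move=> fd fc.
pose df (h : 'rV[R]_n) : R := \sum_i h 0 i * 'D_(e_ i) f x.
have dfl : linear df.
  move=> a u v; rewrite /df scaler_sumr -big_split; apply: eq_bigr => i _ /=.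
  by rewrite !mxE mulrDl scalerAl.
pose dfM := GRing.isLinear.Build _ _ _ _ df dfl.
pose dfL : {linear 'rV[R]_n -> R} := HB.pack df dfM.
have dfc : continuous dfL.
  move=> y; apply: differentiable_continuous.
  rewrite (_ : (dfL : _ -> _) = \sum_(i < n) (fun h : 'rV[R]_n => h 0 i * 'D_(e_ i) f x));
    last by apply/funext => h; rewrite fct_sumE.
  apply: differentiable_sum => i.
  by apply: differentiableM => //; exact: differentiable_coord.
have E : (f : 'rV[R]_n -> R^o) \o shift x = cst (f x) + (dfL : 'rV[R]_n -> R^o) +o_ (0 : 'rV[R]_n) id.
  apply/eqaddoP => _/posnumP[e].
  (* The [n] coordinate errors add up to at most [e]; dividing by [n.+1] also covers [n = 0]. *)
  have e1 : 0 < e%:num / n.+1%:R by rewrite divr_gt0.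
  have hn : \forall z \near x, forall i, derivable f z (e_ i) /\
     `|'D_(e_ i) f x - 'D_(e_ i) f z| < e%:num / n.+1%:R.
    apply: (@filter_forall _ _ (fun i z => derivable f z (e_ i) /\
      `|'D_(e_ i) f x - 'D_(e_ i) f z| < e%:num / n.+1%:R) (nbhs x)) => i.
    apply: filterI; first exact: fd.
    by move/cvgrPdist_lt : (fc i) => /(_ _ e1).
  have {hn}[d /= d0 hd] := (nbhs_ballP _ _).1 hn.
  have nd : \forall h \near (0 : 'rV[R]_n), `|h| < d.
    by apply/nbhs_ballP; exists d => // z; rewrite -ball_normE /= sub0r normrN.
  near=> h.
  have hd0 : `|h| < d by near: h; exact: nd.
  have hbox z : box x (h + x) z -> forall i, derivable f z (e_ i) /\
     `|'D_(e_ i) f x - 'D_(e_ i) f z| < e%:num / n.+1%:R.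
    move=> /box_norm; rewrite addrK => zx; apply: hd.
    by rewrite -ball_normE /= distrC (le_lt_trans zx).
  have [|xi xib E] := @box_mvt R n f x (h + x); first by move=> z i /hbox/(_ i)[].
  change (`|f (h + x) - (f x + df h)| <= e%:num * `|h|).
  rewrite opprD addrA E /df -sumrB (le_trans (ler_norm_sum _ _ _)) //.
  apply: (@le_trans _ _ (\sum_(i < n) `|h| * (e%:num / n.+1%:R))).
    apply: ler_sum => i _; rewrite mxE addrK -mulrBr normrM.
    by rewrite ler_pM // ?le_coord_norm // distrC ltW // (hbox _ (xib i) i).2.
  rewrite sumr_const card_ord -mulrnAr mulrC ler_wpM2r // -mulr_natr -mulrA.
  rewrite ler_piMr // mulrC ler_pdivrMr ?ltr0n // mul1r ler_nat //.
apply/diff_locallyP; rewrite (diff_unique dfc E); split => //.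
Unshelve. all: by end_near. Qed.

(** The inner functions are only derivable along [v], so everything is restricted to the line
    through [x] with direction [v], where derivability is differentiability and the chain rule for
    differentials applies. *)
Lemma derive_comp m (f : 'I_m -> 'rV[R]_n -> R) (g : 'rV[R]_m -> R) x v :
  differentiable g (\row_i f i x) -> (forall i, derivable (f i) x v) ->
  is_derive x v (fun z => g (\row_i f i z))
    (\sum_i 'D_v (f i) x * 'D_(e_ i) g (\row_i f i x)).
Proof.
move=> gd fd; pose M z : 'rV[R]_m := \row_i f i z.
have Md : derivable M x v.
  by apply/derivable_mxP => i j; under eq_fun do rewrite mxE; exact: fd.
pose p (t : R) := M (t *: v + x).
have pd : is_derive (0 : R) 1 p ('D_v M x).
  have E (h : R) : h^-1 *: (p (h *: 1 + 0) - p 0) = h^-1 *: (M (h *: v + x) - M x).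
    by rewrite /p [h *: 1]mulr1 addr0 scale0r add0r.
  apply: DeriveDef; first by rewrite /derivable; under eq_fun do rewrite /= E.
  by rewrite /derive; under eq_fun do rewrite /= E.
have p0 : p 0 = M x by rewrite /p scale0r add0r.
have pD : differentiable p 0 by apply/derivable1_diffP; exact: ex_derive.
have gD : differentiable g (p 0) by rewrite p0.
have gpd : differentiable (g \o p) 0 by exact: differentiable_comp.
have E (h : R) : h^-1 *: (g (p (h *: 1 + 0)) - g (p 0)) =
   h^-1 *: (g (M (h *: v + x)) - g (M x)).
  by rewrite /p [h *: 1]mulr1 addr0 scale0r add0r.
have := diff_derivable (v := 1 : R) gpd; rewrite /derivable.
under eq_fun do rewrite /= E; move=> h1.
apply: DeriveDef => //.
transitivity ('D_1 (g \o p) 0).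
  by rewrite /derive; under [in RHS]eq_fun do rewrite /= E.
rewrite (deriveE _ gpd) diff_comp //= -(deriveE _ pD) derive_val p0.
rewrite [X in 'd g _ X](row_sum_delta ('D_v M x)) linear_sum; apply: eq_bigr => i _.
rewrite linearZ /= -deriveE //; congr (_ * _).
by rewrite derive_mx // mxE; congr ('D_v _ _); apply/funext => z; rewrite mxE.
Qed.

End differentiability.
End smooth_calculus.

Lemma near_eq_continuous (T U : topologicalType) (f g : T -> U) (x : T) :
  (\forall y \near x, f y = g y) -> {for x, continuous g} -> {for x, continuous f}.
Proof.
move=> fg gc; suff : f @ x --> f x by [].
rewrite (nbhs_singleton fg); apply: cvg_trans gc; apply: near_eq_cvg.
by apply: filterS fg => y ->.
Qed.

Section Ck_theory.
Variable R : realType.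

Local Notation e_ i := (delta_mx 0 i : 'rV[R]_(_)).

Lemma continuous_row_fun (T : topologicalType) n (f : 'I_n -> T -> R) (x : T) :
  (forall i, {for x, continuous (f i)}) -> {for x, continuous (fun t => \row_i f i t)}.
Proof.
move=> fc; apply: continuous_row => i; apply: near_eq_continuous (fc i).
by apply: nearW => y; rewrite mxE.
Qed.

Lemma Ck_continuous n k (U : set 'rV[R]_n) f x :
  Ck k U f -> U x -> {for x, continuous f}.
Proof. by case: k => [|k] [fc _] /fc. Qed.

Lemma Ck_sub n k (U V : set 'rV[R]_n) f : U `<=` V -> Ck k V f -> Ck k U f.
Proof.
elim: k f => [|k IH] f UV [fc fd]; first by split => // x /UV/fc.
split=> [x /UV/fc //|i].
by have [fdi fk] := fd i; split; [move=> x /UV/fdi|exact: IH].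
Qed.

Lemma CkW n k (U : set 'rV[R]_n) f : Ck k.+1 U f -> Ck k U f.
Proof.
elim: k f => [|k IH] f [fc fd]; split => // i.
by have [fdi fk] := fd i; split => //; exact: IH.
Qed.

(** Here [U] need not be open: continuity and partial derivatives at a point of [U] depend only on
    the germ there, and the partial derivatives of [f] and [g] agree on all of [V]. *)
Lemma Ck_locally n k (U : set 'rV[R]_n) f :
  (forall x, U x -> exists V g, [/\ open V, V x, Ck k V g & forall y, V y -> f y = g y]) ->
  Ck k U f.
Proof.
elim: k U f => [|k IH] U f fP.
  split => // x /fP[V [g [oV Vx [gc _] fg]]].
  apply: near_eq_continuous (gc _ Vx).
  by apply: filterS (open_nbhs_nbhs (conj oV Vx)) => y /fg.
split.
  move=> x /fP[V [g [oV Vx [gc _] fg]]].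
  apply: near_eq_continuous (gc _ Vx).
  by apply: filterS (open_nbhs_nbhs (conj oV Vx)) => y /fg.
move=> i; split.
  move=> x /fP[V [g [oV Vx [_ gd] fg]]].
  apply: near_eq_derivable ((gd i).1 _ Vx).
  by apply: filterS (open_nbhs_nbhs (conj oV Vx)) => y /fg.
apply: IH => x /fP[V [g [oV Vx [_ gd] fg]]].
exists V, ('D_(e_ i) g); split => //; first exact: (gd i).2.
move=> y Vy; apply: near_eq_derive.
by apply: filterS (open_nbhs_nbhs (conj oV Vy)) => z /fg.
Qed.

Lemma eq_Ck n k (U : set 'rV[R]_n) f g : open U -> (forall x, U x -> f x = g x) ->
  Ck k U g -> Ck k U f.
Proof. by move=> oU fg gk; apply: Ck_locally => x Ux; exists U, g. Qed.

Lemma Ck_differentiable n (U : set 'rV[R]_n) f x : open U -> Ck 1 U f -> U x ->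
  differentiable f x.
Proof.
move=> oU [fc fd] Ux; apply: C1_differentiable => i.
  by apply: filterS (open_nbhs_nbhs (conj oU Ux)) => z /(fd i).1.
exact: (fd i).2.1.
Qed.

Lemma Ck_cst n k (U : set 'rV[R]_n) (c : R) : Ck k U (fun=> c).
Proof.
have cc x : {for x, continuous ((fun=> c) : 'rV[R]_n -> R)} by exact: cst_continuous.
elim: k c cc => [|k IH] c cc; split => // i; split; first by move=> x _; exact: derivable_cst.
rewrite (_ : 'D_(e_ i) _ = fun=> 0); first by apply: IH => x; exact: cst_continuous.
by apply/funext => x; exact: derive_cst.
Qed.

Lemma is_derive_coord n (j : 'I_n) (x v : 'rV[R]_n) :
  is_derive x v (fun z : 'rV[R]_n => z 0 j) (v 0 j).
Proof.
apply: DeriveDef.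
  by apply: diff_derivable; exact: differentiable_coord.
have := @derive_mx R _ 1 n id x v (@derivable_id _ _ x v).
by move/(congr1 (fun M : 'rV_n => M 0 j)); rewrite derive_id mxE.
Qed.

Lemma Ck_coord n k (U : set 'rV[R]_n) (j : 'I_n) : Ck k U (fun z => z 0 j).
Proof.
have cc x : {for x, continuous (fun z : 'rV[R]_n => z 0 j)}.
  exact: differentiable_continuous (differentiable_coord _ _ _).
case: k => [|k]; split => // i; split.
  by move=> x _; have [] := is_derive_coord j x (e_ i).
rewrite (_ : 'D_(e_ i) _ = fun=> (e_ i) 0 j); first exact: Ck_cst.
by apply/funext => x; have [_ ->] := is_derive_coord j x (e_ i).
Qed.

Lemma CkD n k (U : set 'rV[R]_n) f g : open U -> Ck k U f -> Ck k U g ->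
  Ck k U (fun x => f x + g x).
Proof.
move=> oU; elim: k f g => [|k IH] f g fk gk.
  by split => // x Ux; exact: cvgD (Ck_continuous fk Ux) (Ck_continuous gk Ux).
split; first by move=> x Ux; exact: cvgD (Ck_continuous fk Ux) (Ck_continuous gk Ux).
move: fk gk => [_ fd] [_ gd] i; have [fi fk] := fd i; have [gi gk] := gd i.
split; first by move=> x Ux; apply: derivableD; [exact: fi|exact: gi].
apply: (eq_Ck oU) (IH _ _ fk gk) => x Ux.
by apply: deriveD; [exact: fi|exact: gi].
Qed.

Lemma CkM n k (U : set 'rV[R]_n) f g : open U -> Ck k U f -> Ck k U g ->
  Ck k U (fun x => f x * g x).
Proof.
move=> oU; elim: k f g => [|k IH] f g fk gk.
  by split => // x Ux; exact: cvgM (Ck_continuous fk Ux) (Ck_continuous gk Ux).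
split; first by move=> x Ux; exact: cvgM (Ck_continuous fk Ux) (Ck_continuous gk Ux).
have [fW gW] := (CkW fk, CkW gk).
move: fk gk => [_ fd] [_ gd] i; have [fi fk] := fd i; have [gi gk] := gd i.
split; first by move=> x Ux; apply: derivableM; [exact: fi|exact: gi].
apply: (eq_Ck oU) (CkD oU (IH _ _ fW gk) (IH _ _ gW fk)) => x Ux.
by apply: deriveM; [exact: fi|exact: gi].
Qed.

Lemma Ck_sum n k (U : set 'rV[R]_n) m (f : 'I_m -> 'rV[R]_n -> R) : open U ->
  (forall i, Ck k U (f i)) -> Ck k U (fun x => \sum_i f i x).
Proof.
move=> oU; elim: m f => [|m IH] f fk.
  by apply: (eq_Ck oU) (@Ck_cst _ _ _ 0) => x _; rewrite big_ord0.
apply: (eq_Ck oU) (CkD oU (IH _ (fun i => fk (widen_ord (leqnSn m) i))) (fk ord_max)) => x _.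
by rewrite big_ord_recr.
Qed.

(** Induction on [k]: the chain rule writes a partial derivative as a sum of products of partial
    derivatives of the [f j] with composites of the partial derivatives of [g], to which the
    induction hypothesis applies. *)
Lemma Ck_comp n m k (U : set 'rV[R]_n) (V : set 'rV[R]_m) f g : open U -> open V ->
  (forall i : 'I_m, Ck k U (f i)) -> Ck k V g -> (forall x, U x -> V (\row_i f i x)) ->
  Ck k U (fun x => g (\row_i f i x)).
Proof.
move=> oU oV; elim: k f g => [|k IH] f g fk gk UV.
  split => // x Ux; apply: (continuous_comp (f := fun x => \row_i f i x)).
    by apply: continuous_row_fun => i; exact: Ck_continuous (fk i) Ux.
  exact: Ck_continuous gk (UV _ Ux).
have g1 : Ck 1 V g.
  by elim: {IH fk UV} k gk => // k IH /CkW/IH.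
have D x v : U x -> is_derive x v (fun z => g (\row_i f i z))
    (\sum_i 'D_v (f i) x * 'D_(e_ i) g (\row_i f i x)) \/ forall i, v <> e_ i.
  move=> Ux; have [[i ->]|nv] := pselect (exists i, v = e_ i); [left|right].
    apply: derive_comp => [|j]; first exact: Ck_differentiable oV g1 (UV _ Ux).
    by have [_ /(_ i)[+ _]] := fk j; exact.
  by move=> i E; apply: nv; exists i.
have {}D x i : U x -> is_derive x (e_ i) (fun z => g (\row_i f i z))
    (\sum_j 'D_(e_ i) (f j) x * 'D_(e_ j) g (\row_i f i x)).
  by move=> /(D x (e_ i))[//|/(_ i)].
split.
  move=> x Ux; apply: (continuous_comp (f := fun x => \row_i f i x)).
    by apply: continuous_row_fun => i; exact: Ck_continuous (fk i) Ux.
  exact: Ck_continuous gk (UV _ Ux).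
move=> i; split; first by move=> x /(D x i)[].
apply: (eq_Ck oU (g := fun x => \sum_j 'D_(e_ i) (f j) x * 'D_(e_ j) g (\row_i f i x))).
  by move=> x /(D x i)[].
apply: (Ck_sum (f := fun j x => 'D_(e_ i) (f j) x * 'D_(e_ j) g (\row_i f i x)) oU) => j; apply: CkM => //.
  by have [_ /(_ i)[]] := fk j.
apply: (IH f ('D_(e_ j) g)) => // [l|]; first exact: CkW.
by have [_ /(_ j)[]] := gk.
Qed.

End Ck_theory.

Section smooth_theory.
Variable R : realType.

Lemma smooth_continuous n (U : set 'rV[R]_n) f x :
  smooth U f -> U x -> {for x, continuous f}.
Proof. by move=> /(_ 0); exact: Ck_continuous. Qed.

Lemma smooth_sub n (U V : set 'rV[R]_n) f : U `<=` V -> smooth V f -> smooth U f.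
Proof. by move=> UV fs k; exact: Ck_sub (fs k). Qed.

Lemma smooth_locally n (U : set 'rV[R]_n) f :
  (forall x, U x -> exists V g, [/\ open V, V x, smooth V g & forall y, V y -> f y = g y]) ->
  smooth U f.
Proof.
move=> fP k; apply: Ck_locally => x /fP[V [g [oV Vx gs fg]]].
by exists V, g; split => //; exact: gs.
Qed.

Lemma eq_smooth n (U : set 'rV[R]_n) f g : open U -> (forall x, U x -> f x = g x) ->
  smooth U g -> smooth U f.
Proof. by move=> oU fg gk k; exact: eq_Ck (gk k). Qed.

Lemma smooth_cst n (U : set 'rV[R]_n) (c : R) : smooth U (fun=> c).
Proof. by move=> k; exact: Ck_cst. Qed.

Lemma smooth_coord n (U : set 'rV[R]_n) (j : 'I_n) : smooth U (fun z => z 0 j).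
Proof. by move=> k; exact: Ck_coord. Qed.

Lemma smoothD n (U : set 'rV[R]_n) f g : open U -> smooth U f -> smooth U g ->
  smooth U (fun x => f x + g x).
Proof. by move=> oU fs gs k; exact: CkD. Qed.

Lemma smoothM n (U : set 'rV[R]_n) f g : open U -> smooth U f -> smooth U g ->
  smooth U (fun x => f x * g x).
Proof. by move=> oU fs gs k; exact: CkM. Qed.

Lemma smooth_comp n m (U : set 'rV[R]_n) (V : set 'rV[R]_m) f g : open U -> open V ->
  (forall i : 'I_m, smooth U (f i)) -> smooth V g -> (forall x, U x -> V (\row_i f i x)) ->
  smooth U (fun x => g (\row_i f i x)).
Proof. by move=> oU oV fs gs UV k; exact: (Ck_comp oU oV (fun i => fs i k) (gs k) UV). Qed.

Lemma smooth_sum n (U : set 'rV[R]_n) m (f : 'I_m -> 'rV[R]_n -> R) : open U ->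
  (forall i, smooth U (f i)) -> smooth U (fun x => \sum_i f i x).
Proof. by move=> oU fs k; exact: (Ck_sum oU (fun i => fs i k)). Qed.

(** Functions of one variable are read on row vectors of length one, so that [smooth_comp] also
    covers them. *)
Definition smooth1 (W : set R) (h : R -> R) := smooth [set z : 'rV[R]_1 | W (z 0 0)] (fun z => h (z 0 0)).

Lemma smooth1_comp n (U : set 'rV[R]_n) (W : set R) f h : open U -> open W ->
  smooth1 W h -> smooth U f -> (forall x, U x -> W (f x)) -> smooth U (fun x => h (f x)).
Proof.
move=> oU oW hs fs UW.
have oV : open [set z : 'rV[R]_1 | W (z 0 0)].
  by apply: open_comp oW => z _; exact: coord_continuous.
rewrite (_ : (fun x => h (f x)) = fun x => (fun z : 'rV[R]_1 => h (z 0 0)) (\row_(i < 1) f x)).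
  by apply: (smooth_comp (f := fun _ => f) (g := fun z : 'rV[R]_1 => h (z 0 0)) oU oV) => // x Ux /=; rewrite mxE; exact: UW.
by apply/funext => x; rewrite mxE.
Qed.

(** Serves for families closed under differentiation: the induction on the order runs over the whole
    family at once, because the derivative of a member is another member. *)
Lemma smooth1_coind (W : set R) (F : set (R -> R)) : open W ->
  (forall h t, F h -> W t -> derivable h t 1) ->
  (forall h, F h -> exists2 h', F h' & forall t, W t -> 'D_1 h t = h' t) ->
  forall h, F h -> smooth1 W h.
Proof.
move=> oW Fd Fc h Fh k; elim: k h Fh => [|k IH] h Fh.
  split => // x Wx; apply: (continuous_comp (f := fun z : 'rV[R]_1 => z 0 0)).
    exact: coord_continuous.
  by apply: differentiable_continuous; apply/derivable1_diffP; exact: Fd.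
have oV : open [set z : 'rV[R]_1 | W (z 0 0)].
  by apply: open_comp oW => z _; exact: coord_continuous.
have D (x : 'rV[R]_1) (i : 'I_1) : W (x 0 0) -> is_derive x (delta_mx 0 i : 'rV[R]_1) (fun z : 'rV[R]_1 => h (z 0 0))
    ('D_1 h (x 0 0)).
  move=> Wx; have E (s : R) : h ((s *: (delta_mx 0 i : 'rV[R]_1) + x) 0 0) = h (s *: 1 + x 0 0).
    by rewrite !mxE !ord1 /= [s *: 1]mulr1 mulr1.
  apply: DeriveDef; last by rewrite /derive; under eq_fun do rewrite /= E.
  by have := Fd _ _ Fh Wx; rewrite /derivable; under [in X in _ -> X]eq_fun do rewrite /= E.
split.
  move=> x Wx; apply: (continuous_comp (f := fun z : 'rV[R]_1 => z 0 0)).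
    exact: coord_continuous.
  by apply: differentiable_continuous; apply/derivable1_diffP; exact: Fd.
move=> i; split; first by move=> x /(D x i)[].
have [h' Fh' hh'] := Fc _ Fh.
apply: (eq_Ck oV) (IH _ Fh') => x Wx.
by rewrite -hh' //; have [] := D x i Wx.
Qed.

Lemma smooth1_inv : smooth1 [set t : R | t != 0] GRing.inv.
Proof.
(* The multiples of negative powers are stable under differentiation. *)
pose F := [set h : R -> R | exists (a : R) k, h = fun t => a * t^-1 ^+ k.+1].
have D (a : R) (k : nat) (t : R) : t != 0 -> is_derive t 1 (fun t => a * t^-1 ^+ k.+1 : R)
    (a * - k.+1%:R * t^-1 ^+ k.+2).
  move=> t0; have iV : is_derive t 1 (fun t : R => t^-1) (- t ^- 2).
    apply: DeriveDef; first exact: derivableV.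
    by have := @deriveV _ _ id t 1 t0 (@derivable_id _ _ _ _); rewrite derive_id /= => ->; rewrite [LHS]mulr1.
  have -> : (fun t : R => a * t^-1 ^+ k.+1) = a \*: ((fun t : R => t^-1) ^+ k.+1).
    by apply/funext => s; rewrite /= fctE.
  apply: is_derive_eq (is_deriveZ a (is_deriveX k.+1 iV)) _.
  by rewrite /GRing.scale /= -exprVn !exprS expr0 mulr1; ring.
apply: (@smooth1_coind _ F); last by exists 1, 0%N; apply/funext => t; rewrite mul1r expr1.
- exact: open_neq.
- by move=> _ t [a [k ->]] /(D a k)[].
move=> _ [a [k ->]]; exists (fun t => a * - k.+1%:R * t^-1 ^+ k.+2); first by exists (a * - k.+1%:R), k.+1.
by move=> t /(D a k)[].
Qed.

End smooth_theory.

(** * Flat functions, bumps and cutoffs *)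

Section flat.
Variable R : realType.

(** All functions [p(1/t) exp(-1/t)], extended by zero, are taken together because they are stable
    under differentiation; [p = 1] is the classical flat function. *)
Definition flatp (p : {poly R}) (t : R) : R :=
  if 0 < t then p.[t^-1] * expR (- t^-1) else 0.

(** Each monomial [s^i exp(-s)] is at most [i!], by the [i]-th term of the exponential series. *)
Lemma horner_expRN_bounded (p : {poly R}) :
  exists2 C : R, 0 <= C & forall s, 0 < s -> `|p.[s] * expR (- s)| <= C.
Proof.
exists (\sum_(i < size p) `|p`_i| * i`!%:R) => [|s s0].
  by apply: sumr_ge0 => i _; rewrite mulr_ge0.
rewrite horner_coef mulr_suml (le_trans (ler_norm_sum _ _ _)) //.
apply: ler_sum => i _; rewrite !normrM -mulrA ler_wpM2l //.
rewrite normrX (ger0_norm (ltW s0)) ger0_norm ?expR_ge0 // expRN.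
rewrite ler_pdivrMr ?expR_gt0 //; case: (i : nat) => [|k].
  by rewrite expr0 mul1r -expR0 ler_expR ltW.
rewrite mulrC -ler_pdivrMr ?ltr0n ?fact_gt0 // (le_trans _ (expR_ge1Dxn k (ltW s0))) //.
by rewrite lerDr.
Qed.

(** Away from zero this is the chain rule. At zero the difference quotient is [h] times the value at
    [1/h] of the polynomial ['X^2 * p] times [exp(-1/h)], and the latter factor is bounded. *)
Lemma is_derive_flatp (p : {poly R}) (t : R) :
  is_derive t 1 (flatp p) (flatp ('X^2 * (p - p^`())) t).
Proof.
have [t0|t0|->] := ltgtP t 0.
- apply: (@near_eq_is_derive _ _ _ (fun=> 0)).
    by near=> s; rewrite /flatp ltNge ltW //; near: s; exact: lt_nbhsl.
  by rewrite /flatp ltNge ltW //; apply: DeriveDef; [exact: derivable_cst|exact: derive_cst].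
- have tn : t != 0 by rewrite gt_eqF.
  have iV : is_derive t 1 (fun t : R => t^-1) (- t ^- 2).
    by apply: is_derive_eq (is_deriveV (f := id) tn (is_derive_id _ _)) _; rewrite /= [LHS]mulr1.
  have ip := @is_derive1_comp _ (horner p) _ t _ _ (is_derive_poly _ _) iV.
  have ie : is_derive t 1 (expR \o (fun t : R => - t^-1)) (expR (- t^-1) * - - t ^- 2).
    by apply: is_derive1_comp; exact: is_deriveN.
  have ipe := is_deriveM ip ie.
  apply: near_eq_is_derive (is_derive_eq ipe _).
    by near=> s; rewrite /flatp ifT //; near: s; exact: lt_nbhsr.
  rewrite /flatp t0 hornerM hornerXn hornerD hornerN exprVn /GRing.scale /=; ring.
have flat0 q : flatp q 0 = 0 by rewrite /flatp ltxx.
have [C C0 Cb] := horner_expRN_bounded ('X^2 * p).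
have D : (fun h : R => h^-1 *: (flatp p (h *: 1 + 0) - flatp p 0)) @ 0^' --> (0 : R).
  apply/cvgrPdist_le => e e0; near=> h.
  have h0 : h != 0 by near: h; exact: nbhs_dnbhs_neq.
  rewrite flat0 subr0 addr0 [h *: 1]mulr1 sub0r normrN /flatp.
  case: ifPn => [hp|_]; last by rewrite scaler0 normr0 ltW.
  have := Cb h^-1; rewrite invr_gt0 => /(_ hp).
  rewrite hornerM hornerXn -mulrA normrM => Cb1.
  rewrite /GRing.scale /= normrM.
  have hC : `|h| * C <= e.
    have : `|h| < e / (C + 1) by near: h; apply: dnbhs0_lt; rewrite divr_gt0 // ltr_wpDl.
    rewrite ltr_pdivlMr ?ltr_wpDl // => /ltW; apply: le_trans.
    by rewrite ler_wpM2l // lerDl.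
  apply: le_trans hC; rewrite -ler_pdivrMl ?normr_gt0 // mulrA.
  by rewrite -normfV -normrM -expr2.
rewrite flat0; apply: DeriveDef; first by apply/cvg_ex; exists 0.
exact: cvg_lim D.
Unshelve. all: by end_near.
Qed.

Definition flat (t : R) : R := flatp 1 t.

Lemma flat_gt0 t : (0 < flat t) = (0 < t).
Proof. by rewrite /flat /flatp; case: ifP => //; rewrite hornerC mul1r expR_gt0. Qed.

Lemma flat_ge0 t : 0 <= flat t.
Proof. by rewrite /flat /flatp; case: ifP => // _; rewrite hornerC mul1r expR_ge0. Qed.

Lemma flat_eq0 t : t <= 0 -> flat t = 0.
Proof. by rewrite /flat /flatp ltNge => ->. Qed.

Lemma smooth1_flat : smooth1 setT flat.
Proof.
apply: (@smooth1_coind R setT [set h | exists p, h = flatp p]); last by exists 1.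
- exact: openT.
- by move=> _ t [p ->] _; have [] := is_derive_flatp p t.
move=> _ [p ->]; exists (flatp ('X^2 * (p - p^`()))); first by exists ('X^2 * (p - p^`())).
by move=> t _; have [] := is_derive_flatp p t.
Qed.

End flat.

Section cutoff.
Variable R : realType.

Lemma smooth_flat n (U : set 'rV[R]_n) f : open U -> smooth U f ->
  smooth U (fun x => flat (f x)).
Proof. by move=> oU fs; exact: (smooth1_comp oU openT (@smooth1_flat R) fs). Qed.

Lemma smoothV n (U : set 'rV[R]_n) f : open U -> smooth U f -> (forall x, U x -> f x != 0) ->
  smooth U (fun x => (f x)^-1).
Proof. by move=> oU fs f0; apply: (smooth1_comp oU _ (@smooth1_inv R) fs) f0; exact: open_neq. Qed.

Lemma smoothN n (U : set 'rV[R]_n) f : open U -> smooth U f -> smooth U (fun x => - f x).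
Proof.
move=> oU fs; apply: (eq_smooth oU (g := fun x => -1 * f x)) => [x _|].
  by rewrite mulN1r.
by apply: smoothM => //; exact: smooth_cst.
Qed.

Lemma smoothB n (U : set 'rV[R]_n) f g : open U -> smooth U f -> smooth U g ->
  smooth U (fun x => f x - g x).
Proof. by move=> oU fs gs; apply: smoothD => //; exact: smoothN. Qed.

(** The smooth transition from 0 on the negative half-line to 1 beyond 1; the denominator is
    positive since [t] or [1 - t] is. *)
Definition step (t : R) : R := flat t / (flat t + flat (1 - t)).

Lemma step_den (t : R) : flat t + flat (1 - t) != 0.
Proof.
rewrite gt_eqF //; have [t0|t0] := ltP 0 t.
  by rewrite ltr_pwDl ?flat_gt0 ?flat_ge0.
by rewrite ltr_wpDl ?flat_gt0 ?flat_ge0 // subr_gt0 (le_lt_trans t0).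
Qed.

Lemma step_eq0 (t : R) : t <= 0 -> step t = 0.
Proof. by move=> t0; rewrite /step flat_eq0 // mul0r. Qed.

Lemma step_eq1 (t : R) : 1 <= t -> step t = 1.
Proof.
move=> t1; have := step_den t; rewrite /step (@flat_eq0 _ (1 - t)) ?subr_le0 // addr0.
by move=> /divff.
Qed.

Lemma smooth_step n (U : set 'rV[R]_n) f : open U -> smooth U f ->
  smooth U (fun x => step (f x)).
Proof.
move=> oU fs; apply: smoothM => //; first exact: smooth_flat.
apply: smoothV => // [|x _]; last exact: step_den.
apply: smoothD => //; first exact: smooth_flat.
by apply: smooth_flat => //; apply: smoothB => //; exact: smooth_cst.
Qed.

Lemma closed_ball_norm n (p : 'rV[R]_n) (r : R) : closed [set z | `|z - p| <= r].
Proof.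
apply: (@preimage_closed _ _ (fun z : 'rV[R]_n => `|z - p|) [set t | t <= r]); last exact: closed_le.
move=> z _; apply: (@continuous_comp _ _ _ (fun z : 'rV[R]_n => z - p) (fun y : 'rV[R]_n => `|y|));
  last exact: norm_continuous.
by apply: (@cvgB _ _ _ (nbhs z) _ id (cst p)); [exact: cvg_id|exact: cvg_cst].
Qed.

Lemma compact_ball_norm n (p : 'rV[R]_n) (r : R) : compact [set z | `|z - p| <= r].
Proof.
apply: bounded_closed_compact (@closed_ball_norm _ _ _).
exists (`|p| + r); split; first exact: num_real.
move=> M /ltW pM z /= zp; apply: le_trans pM.
by rewrite -[z](subrK p) (le_trans (ler_normD _ _)) // addrC lerD2l.
Qed.

Lemma exists_bump n (V : set 'rV[R]_n) p : open V -> V p ->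
  exists chi K, [/\ compact K, K `<=` V, smooth setT chi, forall z, ~ K z -> chi z = 0 &
    \forall z \near p, chi z = 1].
Proof.
move=> oV Vp; have /nbhs_ballP[e /= e0 eV] : nbhs p V by exact: open_nbhs_nbhs.
pose r := e / 2; have r0 : 0 < r by rewrite divr_gt0.
pose q (z : 'rV[R]_n) := \sum_i (z 0 i - p 0 i) * (z 0 i - p 0 i).
have qs : smooth setT q.
  apply: (smooth_sum (f := fun i (z : 'rV[R]_n) => (z 0 i - p 0 i) * (z 0 i - p 0 i)) openT) => i.
  by apply: smoothM; try exact: openT; apply: smoothB; try exact: openT;
    try exact: smooth_coord; exact: smooth_cst.
(* The argument of [step] is at most 0 once [q] reaches [r ^+ 2] and at least 1 once [q] is below
   half of it. The norm is the sup norm, so outside the closed ball a single coordinate already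
   makes [q] reach [r ^+ 2]. *)
exists (fun z => step (2 - 2 / r ^+ 2 * q z)), [set z | `|z - p| <= r]; split.
- exact: compact_ball_norm.
- move=> z /= zr; apply: eV; rewrite -ball_normE /= distrC (le_lt_trans zr) //.
  by rewrite /r ltr_pdivrMr // ltr_pMr // ltr1n.
- apply: smooth_step; first exact: openT.
  apply: smoothB; try exact: openT; try exact: smooth_cst.
  by apply: smoothM => //; try exact: openT; exact: smooth_cst.
- move=> z zr; apply: step_eq0.
  have [i zi] : exists i, r < `|z 0 i - p 0 i|.
    apply: contrapT => h; apply: zr => /=; apply: norm_row_le (ltW r0) _ => i.
    by rewrite !mxE leNgt; apply/negP => zi; apply: h; exists i.
  have qi : r ^+ 2 <= (z 0 i - p 0 i) * (z 0 i - p 0 i).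
    by rewrite -expr2 -[X in _ <= X]real_normK ?num_real // lerXn2r ?nnegrE // ltW.
  have qr : r ^+ 2 <= q z.
    rewrite (le_trans qi) // /q (bigD1 i) //= lerDl sumr_ge0 // => j _.
    by rewrite -expr2 sqr_ge0.
  rewrite subr_le0 mulrAC ler_pdivlMr ?exprn_gt0 //.
  by rewrite ler_wpM2l.
have qc : {for p, continuous q} := smooth_continuous qs I.
have q0 : q p = 0 by rewrite /q big1 // => i _; rewrite subrr mul0r.
have qn : nbhs (q p) [set t | t < r ^+ 2 / 2].
  by rewrite q0; apply: lt_nbhsl; rewrite divr_gt0 ?exprn_gt0.
apply: (@filterS _ (nbhs p) _ (fun z => q z < r ^+ 2 / 2)); last exact: (qc _ qn).
move=> z /ltW qz; apply: step_eq1.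
rewrite lerBrDr -lerBrDl mulrAC ler_pdivrMr ?exprn_gt0 //; lra.
Qed.

(** Multiplication by a bump function makes a local function global without changing its germ at
    [p]; off the closed set [K] the product vanishes, whatever [g] is there. *)
Lemma smooth_cutoff n (V : set 'rV[R]_n) p g : open V -> V p -> smooth V g ->
  exists G K, [/\ compact K, K `<=` V, smooth setT G, forall z, ~ K z -> G z = 0 &
    \forall z \near p, G z = g z].
Proof.
move=> oV Vp gs; have [chi [K [cK KV chis chi0 chi1]]] := exists_bump oV Vp.
exists (fun z => chi z * g z), K; split => //; last 2 first.
- by move=> z /chi0 ->; rewrite mul0r.
- by apply: filterS chi1 => z ->; rewrite mul1r.
have clK : closed K by apply: compact_closed => //; exact: norm_hausdorff.
apply: smooth_locally => z _; have [Kz|nKz] := pselect (K z).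
  exists V, (fun z => chi z * g z); split => //; first exact: KV.
  by apply: smoothM => //; exact: smooth_sub chis.
exists (~` K), (fun=> 0); split => //; first exact: closed_openC.
  exact: smooth_cst.
by move=> y /chi0 ->; rewrite mul0r.
Qed.

(** The partial derivatives are bounded on the compact ball, and for the sup norm the box spanned by
    two points of a ball stays inside it, so [box_mvt] applies. *)
Lemma smooth_lipschitz n (V : set 'rV[R]_n) p r f : open V -> smooth V f ->
  [set z | `|z - p| <= r] `<=` V ->
  exists2 L, 0 <= L & forall x y, `|x - p| <= r -> `|y - p| <= r -> `|f y - f x| <= L * `|y - x|.
Proof.
move=> oV fs BV.
have r0 x : `|x - p| <= r -> 0 <= r by apply: le_trans.
have Lb (i : 'I_n) : exists2 M, 0 <= M & forall z, `|z - p| <= r -> `|'D_(delta_mx 0 i) f z| <= M.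
  have /compact_bounded[M [_ Mb]] : compact ('D_(delta_mx 0 i) f @` [set z | `|z - p| <= r]).
    apply: continuous_compact (@compact_ball_norm _ _ _).
    apply: continuous_in_subspaceT => z /set_mem /BV Vz.
    have [_ /(_ i)[_ [+ _]]] := fs 1; exact.
  exists (Num.max 0 M + 1) => [|z zr]; first by rewrite addr_ge0 // le_max lexx.
  apply: Mb; last by exists z.
  by rewrite (@le_lt_trans _ _ (Num.max 0 M)) ?le_max ?lexx ?orbT // ltrDl.
have [M MP] := choice (fun i => (exists2P _ _).1 (Lb i)).
exists (\sum_i M i) => [|x y xr yr]; first by apply: sumr_ge0 => i _; case: (MP i).
have bb z : box x y z -> `|z - p| <= r.
  move=> bz; apply: norm_row_le (r0 _ xr) _ => i; rewrite !mxE.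
  rewrite (le_trans (between_dist_center _ (bz i))) // ge_max.
  have := le_coord_norm (x - p) i; have := le_coord_norm (y - p) i; rewrite !mxE.
  by move=> /le_trans -> // /le_trans ->.
have [|xi xib ->] := @box_mvt R n f x y.
  move=> z i /bb/BV Vz; have [_ /(_ i)[+ _]] := fs 1; exact.
rewrite (le_trans (ler_norm_sum _ _ _)) // mulr_suml; apply: ler_sum => i _.
rewrite normrM mulrC ler_pM //.
  by case: (MP i) => _; apply; exact: bb.
by have := le_coord_norm (y - x) i; rewrite !mxE.
Qed.

End cutoff.

Lemma continuous_sum_ord (R : realType) (T : topologicalType) m (h : 'I_m -> T -> R) (x : T) :
  (forall i, {for x, continuous (h i)}) -> {for x, continuous (fun t => \sum_i h i t)}.
Proof.
elim: m h => [|m IH] h hc.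
  by apply: near_eq_continuous (@cst_continuous _ _ 0 x); apply: nearW => y; rewrite big_ord0.
apply: (@near_eq_continuous _ _ _ (fun t =>
    \sum_(i < m) h (widen_ord (leqnSn m) i) t + h ord_max t)).
  by apply: nearW => y; rewrite big_ord_recr.
exact: cvgD (IH _ (fun i => hc (widen_ord (leqnSn m) i))) (hc ord_max).
Qed.

(** * Hadamard's lemma *)

Section hadamard.
Variables (R : realType) (n : nat) (p : 'rV[R]_n).
Implicit Types (F : 'rV[R]_n -> R) (x : 'rV[R]_n).

Local Notation e_ i := (delta_mx 0 i : 'rV[R]_n).
Local Notation mu := (@lebesgue_measure R).
Local Notation I01 := (`[0, 1]%classic : set (measurableTypeR R)).

Definition ray x (t : R) : 'rV[R]_n := p + t *: (x - p).

(** The weight [t ^+ k] makes the family stable under differentiation: a partial derivative of the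
    mean of [F] is the mean of the partial derivative with [k] raised by one. For [k = 0] and [F] a
    partial derivative, these are the coefficients in Hadamard's lemma. *)
Definition ray_mean k F x : R := \int[mu]_(t in I01) (t ^+ k * F (ray x t)).

Lemma smooth_differentiable F x : smooth setT F -> differentiable F x.
Proof. by move=> /(_ 1) F1; exact: Ck_differentiable openT F1 I. Qed.

Lemma smooth_derive F i : smooth setT F -> smooth setT ('D_(e_ i) F).
Proof. by move=> Fs k; have [_ /(_ i)[]] := Fs k.+1. Qed.

Lemma continuous_ray x : continuous (ray x).
Proof.
move=> t; apply: (@cvgD _ _ _ (nbhs t) _ (cst p) (fun t => t *: (x - p))); first exact: cvg_cst.
exact: scalel_continuous.
Qed.

Lemma continuous_integrable01 (h : R -> R) : continuous h ->
  mu.-integrable I01 (EFin \o h).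
Proof.
move=> hc; apply: continuous_compact_integrable; first exact: segment_compact.
exact: continuous_subspaceT.
Qed.

Lemma continuous_ray_mean k F x : smooth setT F ->
  continuous (fun t : R => t ^+ k * F (ray x t)).
Proof.
move=> Fs t; apply: cvgM; first exact: exprn_continuous.
by apply: continuous_comp; [exact: continuous_ray|exact: (smooth_continuous Fs)].
Qed.

Lemma ray_dist x t : t \in `[0, 1] -> `|ray x t - p| <= `|x - p|.
Proof.
rewrite in_itv /= => /andP[t0 t1]; rewrite /ray [p + _]addrC addrK normrZ ger0_norm //.
by rewrite ler_piMl.
Qed.

Lemma mu01 : fine (mu I01) = 1.
Proof. by rewrite lebesgue_measure_itv /= lte01 oppr0 /= addr0. Qed.

Lemma Rintegral01_bound (h : R -> R) (M : R) : continuous h ->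
  (forall t, t \in `[0, 1] -> `|h t| <= M) -> `|\int[mu]_(t in I01) h t| <= M.
Proof.
move=> hc hM; have ih := continuous_integrable01 hc.
apply: le_trans (le_normr_Rintegral _ ih) _ => //.
have -> : M = \int[mu]_(_ in I01) M by rewrite (@Rintegral_cst _ _ R mu) // mu01 mulr1.
apply: (@le_Rintegral _ _ R mu) => //.
- by apply: (continuous_integrable01 (h := fun t : R => `|h t|)) => t; apply: cvg_norm; exact: hc.
- by apply: (continuous_integrable01 (h := cst M)) => t; exact: cvg_cst.
Qed.

Lemma ray_mean_continuous k F x : smooth setT F -> ray_mean k F @ x --> ray_mean k F x.
Proof.
move=> Fs; have [L L0 LP] := @smooth_lipschitz R n setT p (`|x - p| + 1) F openT Fs (fun _ _ => I).
have iF y := continuous_integrable01 (continuous_ray_mean (k := k) (x := y) Fs).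
apply/(@pseudometric_normed_Zmodule.cvgrPdist_le _ _ _ (nbhs x) _) => e e0.
(* The bound 1 keeps [y] in the ball where [F] is [L]-Lipschitz; [L + 1] avoids a division by
   zero. *)
have n1 : \forall y \near x, `|x - y| < Num.min 1 (e / (L + 1)).
  apply/nbhs_ballP; exists (Num.min 1 (e / (L + 1))) => /=.
    by rewrite lt_min ltr01 divr_gt0 // ltr_wpDl.
  by move=> y; rewrite -ball_normE.
near=> y; have : `|x - y| < Num.min 1 (e / (L + 1)) by near: y; exact: n1.
rewrite lt_min => /andP[/ltW xy1]; rewrite ltr_pdivlMr ?ltr_wpDl // => /ltW xye.
have yp : `|y - p| <= `|x - p| + 1.
  by rewrite -(subrKA x) (le_trans (ler_normD _ _)) // addrC lerD2l distrC.
rewrite /ray_mean -RintegralB //; try exact: iF.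
apply: le_trans xye; apply: Rintegral01_bound.
  by move=> t; apply: cvgB; exact: continuous_ray_mean.
move=> t tI; rewrite -mulrBr normrM.
have := tI; rewrite in_itv /= => /andP[t0 t1].
rewrite -[leRHS]mul1r ler_pM //; first by rewrite ger0_norm ?exprn_ge0 // exprn_ile1.
rewrite (le_trans (LP (ray y t) (ray x t) _ _)) ?(le_trans (ray_dist _ tI)) //.
  by rewrite lerDl.
rewrite /ray [p + _]addrC addrKA -scalerBr opprB addrA subrK normrZ ger0_norm //.
apply: (@le_trans _ _ (L * `|x - y|)); last by rewrite mulrC ler_wpM2l // lerDl.
by rewrite ler_wpM2l // ler_piMl.
Unshelve. all: by end_near. Qed.

(** Differentiation under the integral sign. For parameters in []-1, 1[] the integrand's derivative
    is dominated by a constant bounding the partial derivative of [F] on a ball of radius one more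
    than the distance from [x] to [p]. *)
Lemma is_derive_ray_mean k F x i : smooth setT F ->
  is_derive x (e_ i) (ray_mean k F) (ray_mean k.+1 ('D_(e_ i) F) x).
Proof.
move=> Fs; have Fd y : differentiable F y by exact: smooth_differentiable.
have dFs := smooth_derive i Fs.
pose f (s t : R) := t ^+ k * F (ray (s *: e_ i + x) t).
have fd (s t : R) : is_derive s 1 (f ^~ t) (t ^+ k.+1 * 'D_(e_ i) F (ray (s *: e_ i + x) t)).
  have rE (u : R) : ray (u *: e_ i + x) t = ray x t + u *: (t *: e_ i).
    by rewrite /ray -[_ + x - p]addrA scalerDr !scalerA [u * t]mulrC -addrA [_ + t * u *: _]addrC.
  have d1 : derivable F (ray x t + s *: (t *: e_ i)) (t *: e_ i) by exact: diff_derivable.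
  have d2 := is_derive_line d1.
  have -> : f ^~ t = (t ^+ k) \*: (fun u => F (ray x t + u *: (t *: e_ i))).
    by apply/funext => u; rewrite /f rE.
  apply: is_derive_eq (is_deriveZ (t ^+ k) d2) _.
  by rewrite deriveE // linearZ /= -deriveE // rE /GRing.scale /= mulrA -exprSr.
have [M M0 MP] : exists2 M, 0 <= M & forall z, `|z - p| <= `|x - p| + 1 -> `|'D_(e_ i) F z| <= M.
  have /compact_bounded[M [_ Mb]] :
      compact ('D_(e_ i) F @` [set z | `|z - p| <= `|x - p| + 1]).
    apply: continuous_compact (@compact_ball_norm _ _ _ _).
    by apply: continuous_subspaceT => z; exact: (smooth_continuous dFs).
  exists (Num.max 0 M + 1) => [|z zr]; first by rewrite addr_ge0 // le_max lexx.
  apply: Mb; last by exists z.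
  by rewrite (@le_lt_trans _ _ (Num.max 0 M)) ?le_max ?lexx ?orbT // ltrDl.
have I0 : `]-1, 1[%classic (0 : R) by rewrite /= in_itv /= ltrN10 ltr01.
have fi (s : R) : `]-1, 1[%classic s -> mu.-integrable I01 (EFin \o f s).
  by move=> _; apply: continuous_integrable01; exact: continuous_ray_mean.
have fd1 (s t : R) : `]-1, 1[%classic s -> I01 t -> derivable (f ^~ t) s 1.
  by move=> _ _; have [] := fd s t.
have Mi : mu.-integrable I01 (EFin \o cst M).
  by apply: continuous_integrable01 => t; exact: cvg_cst.
have fM (s t : R) : `]-1, 1[%classic s -> I01 t -> `|partial1of2 f s t| <= cst M t.
  rewrite /= in_itv /= => /andP[s1 s2] tI.
  rewrite partial1of2E; have [_ ->] := fd s t; rewrite normrM.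
  have := tI; rewrite /= in_itv /= => /andP[t0 t1].
  rewrite -[M]mul1r ler_pM //; first by rewrite ger0_norm ?exprn_ge0 // exprn_ile1.
  apply: MP; rewrite (le_trans (ray_dist _ tI)) // -addrA addrC (le_trans (ler_normD _ _)) //.
  rewrite lerD2l normrZ -[leRHS]mulr1 ler_pM //; first by rewrite ler_norml !ltW.
  apply: norm_row_le => // j; rewrite mxE /=.
  by case: (_ == _); rewrite ?normr1 ?normr0.
have E1 := differentiation_under_integral _ I0 fi fd1 _ Mi fM.
have E2 := derivable_under_integral _ I0 fi fd1 _ Mi fM.
apply: DeriveDef; first by apply/derivable1P; exact: E2.
transitivity ('D_1 (fun s : R => ray_mean k F (s *: e_ i + x)) 0).
  have E (s : R) : s^-1 *: (ray_mean k F ((s *: 1 + 0) *: e_ i + x) - ray_mean k F (0 *: e_ i + x)) =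
     s^-1 *: (ray_mean k F (s *: e_ i + x) - ray_mean k F x).
    by rewrite [s *: 1]mulr1 addr0 scale0r add0r.
  by rewrite /derive; under [in RHS]eq_fun do rewrite /= E.
rewrite -derive1E E1 //; congr fine; apply: eq_integral => t _; congr (_%:E).
by rewrite partial1of2E; have [_ ->] := fd 0 t; rewrite scale0r add0r.
Qed.

Lemma smooth_ray_mean k F : smooth setT F -> smooth setT (ray_mean k F).
Proof.
move=> Fs m; elim: m k F Fs => [|m IH] k F Fs; first by split => // x _; exact: ray_mean_continuous.
split => [x _|i]; first exact: ray_mean_continuous.
split => [x _|]; first by have [] := is_derive_ray_mean k x i Fs.
have -> : 'D_(e_ i) (ray_mean k F) = ray_mean k.+1 ('D_(e_ i) F).
  by apply/funext => x; have [_ ->] := is_derive_ray_mean k x i Fs.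
by apply: IH; exact: smooth_derive.
Qed.

Lemma Rintegral01_sum m (c : 'I_m -> R) (h : 'I_m -> R -> R) :
  (forall i, continuous (h i)) ->
  \int[mu]_(t in I01) (\sum_i c i * h i t) = \sum_i c i * \int[mu]_(t in I01) h i t.
Proof.
elim: m c h => [|m IH] c h hc.
  have -> : (fun t => \sum_(i < 0) c i * h i t) = fun=> 0 by apply/funext => t; rewrite big_ord0.
  rewrite big_ord0.
  by rewrite (@Rintegral_cst _ _ R mu) // mul0r.
rewrite big_ord_recr /= -IH //.
have -> : (fun t => \sum_(i < m.+1) c i * h i t) = (fun t =>
    \sum_(i < m) c (widen_ord (leqnSn m) i) * h (widen_ord (leqnSn m) i) t + c ord_max * h ord_max t).
  by apply/funext => t; rewrite big_ord_recr.
have hi i := continuous_integrable01 (hc i).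
rewrite (@RintegralD _ _ R mu) //; last 2 first.
- apply: (continuous_integrable01 (h := fun t => \sum_i c (widen_ord (leqnSn m) i) * h (widen_ord (leqnSn m) i) t)) => t.
  apply: (continuous_sum_ord (h := fun i t => c (widen_ord (leqnSn m) i) * h (widen_ord (leqnSn m) i) t)) => i.
  by apply: cvgM; [exact: cvg_cst|exact: hc].
- apply: (continuous_integrable01 (h := fun t => c ord_max * h ord_max t)) => t.
  by apply: cvgM; [exact: cvg_cst|exact: hc].
by rewrite (@RintegralZl _ _ R mu).
Qed.

(** The fundamental theorem of calculus along the segment from [p] to [x], with the directional
    derivative expanded into partial derivatives. *)
Lemma hadamard F x : smooth setT F ->
  F x = F p + \sum_i (x 0 i - p 0 i) * ray_mean 0 ('D_(e_ i) F) x.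
Proof.
move=> Fs; pose h (t : R) := F (ray x t); pose dh (t : R) := 'D_(x - p) F (ray x t).
have hd (t : R) : is_derive t 1 h (dh t).
  apply: (@is_derive_line R n F p (x - p) t).
  by apply: diff_derivable; exact: smooth_differentiable.
have dhE : dh = fun t => \sum_i (x 0 i - p 0 i) * 'D_(e_ i) F (ray x t).
  apply/funext => t; rewrite /dh deriveE; last exact: smooth_differentiable.
  rewrite [X in 'd F _ X](row_sum_delta (x - p)) linear_sum; apply: eq_bigr => i _.
  by rewrite linearZ /= -deriveE ?mxE //; exact: smooth_differentiable.
have dhi i : continuous (fun t : R => t ^+ 0 * 'D_(e_ i) F (ray x t)).
  exact: (continuous_ray_mean (k := 0) (x := x) (smooth_derive i Fs)).
have dhc : continuous dh.
  rewrite dhE => t.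
  apply: (continuous_sum_ord (h := fun i t => (x 0 i - p 0 i) * 'D_(e_ i) F (ray x t))) => i.
  apply: cvgM; first exact: cvg_cst.
  apply: (@continuous_comp _ _ _ (ray x) ('D_(e_ i) F)); first exact: continuous_ray.
  exact: (smooth_continuous (smooth_derive i Fs)).
have hc : continuous h.
  by move=> t; apply: differentiable_continuous; apply/derivable1_diffP; have [] := hd t.
have := @continuous_FTC2 R dh h 0 1 ltr01 (continuous_subspaceT dhc).
have -> : h 1 = F x by rewrite /h /ray scale1r addrC subrK.
have -> : h 0 = F p by rewrite /h /ray scale0r addr0.
move=> E; have {}E : \int[mu]_(t in I01) dh t = F x - F p.
  rewrite /Rintegral E //; last by move=> t _; rewrite derive1E; have [] := hd t.
  split; first by move=> t _; have [] := hd t.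
    by apply: cvg_at_right_filter; exact: hc.
  by apply: cvg_at_left_filter; exact: hc.
rewrite -[LHS](subrK (F p)) -E addrC; congr (_ + _).
rewrite -(Rintegral01_sum _ dhi); apply: eq_Rintegral => t _; rewrite dhE.
by apply: eq_bigr => i _; rewrite expr0 mul1r.
Qed.

Lemma ray_mean_center F : smooth setT F -> ray_mean 0 F p = F p.
Proof.
move=> Fs; transitivity (\int[mu]_(t in I01) F p); last first.
  by rewrite (@Rintegral_cst _ _ R mu) // mu01 mulr1.
by apply: eq_Rintegral => t _; rewrite /ray subrr scaler0 addr0 expr0 mul1r.
Qed.

End hadamard.

(** * Neighbourhoods in subspaces *)

Lemma nbhs_open_sub (T : topologicalType) (x : T) (P : set T) : nbhs x P ->
  exists V, [/\ open V, V x & V `<=` P].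
Proof. by rewrite nbhsE => -[V [oV Vx] VP]; exists V. Qed.

Lemma continuous_near (T S : topologicalType) (f : T -> S) (x : T) (P : S -> Prop) :
  {for x, continuous f} -> (\forall y \near f x, P y) -> \forall y \near x, P (f y).
Proof. by move=> fc Pf; exact: (fc _ Pf). Qed.

Lemma nbhs_is_open (T : topologicalType) (A : set T) : (forall x, A x -> nbhs x A) -> open A.
Proof. by rewrite openE => nA x /nA. Qed.

Lemma near_all (T : topologicalType) (x : T) (P : T -> Prop) : (forall y, P y) ->
  \forall y \near x, P y.
Proof. exact: nearW. Qed.

Section set_type_topology.
Variables (T : topologicalType) (A : set T).

Lemma val_continuous : continuous (fun a : A => val a).
Proof. exact: (@initial_continuous A T set_val). Qed.

Lemma nbhs_set_typeP (a : A) (B : set A) :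
  nbhs a B <-> exists2 C, nbhs (val a) C & forall b : A, C (val b) -> B b.
Proof.
split; last by move=> [C nC CB]; apply: filterS CB _; exact: val_continuous.
rewrite nbhsE /= => -[V [[W oW WV] Va] VB].
exists W => [|b Wb]; first by exists W => //; split => //; rewrite -WV in Va.
by apply: VB; rewrite -WV.
Qed.

Lemma nbhs_set_type_open (a : A) (B : set A) : open A -> nbhs a B ->
  nbhs (val a) [set val b | b in B].
Proof.
move=> oA /nbhs_set_typeP[C nC CB].
have nA : nbhs (val a) A by apply: open_nbhs_nbhs; split => //; exact: set_mem (valP a).
apply: filterS (filterI nC nA) => t [Ct At].
by exists (exist _ t (mem_set At)) => //; exact: CB.
Qed.

Lemma near_set_type (a : A) (P : T -> Prop) : (\forall t \near val a, P t) ->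
  \forall b \near a, P (val b).
Proof. exact: val_continuous. Qed.

Lemma continuous_set_type (S : topologicalType) (f : S -> A) (s : S) :
  {for s, continuous (fun s => val (f s))} -> {for s, continuous f}.
Proof.
move=> fc B /nbhs_set_typeP[C nC CB]; apply: (@filterS _ (nbhs s) _ (fun t => C (val (f t)))); last exact: (fc _ nC).
by move=> t; exact: CB.
Qed.

Lemma hausdorff_set_type : hausdorff_space T -> hausdorff_space A.
Proof.
move=> hT a b ab; apply: val_inj; apply: hT => B C nB nC.
have [x [Bx Cx]] := ab _ _ (val_continuous nB) (val_continuous nC).
by exists (val x).
Qed.

End set_type_topology.

Lemma second_countable_embedding (T S : topologicalType) (f : S -> T) :
  (forall (s : S) (B : set S), nbhs s B -> exists2 C, nbhs (f s) C & forall t, C (f t) -> B t) ->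
  continuous f -> @second_countable T -> @second_countable S.
Proof.
move=> fP fc [B cB [oB bB]].
exists [set f @^-1` U | U in B]; first exact: sub_countable (card_image_le _ _) cB.
split; first by move=> _ [U BU <-]; apply: open_comp (oB _ BU) => s _; exact: fc.
move=> s V /fP[C nC CV]; have [U [BU Us] UC] := bB _ _ nC.
by exists (f @^-1` U) => [|t /UC/CV//]; split => //; exists U.
Qed.

(** * Structure algebras: local membership, generators, subspaces *)

Section fs_near.
Variables (R : realType) (X : fspace R).
Implicit Types (f g : X -> R) (x : X).

(** By local detectability ([fs_nearP]) membership in the structure algebra is this condition at all
    points. Being local, it is also stable under operations that only make sense near a point, such
    as inversion. *)
Definition fs_near x f : Prop :=
  exists2 h, @fs_fun R X h & \forall y \near x, f y = h y.

Lemma eq_fs_near x f g : (\forall y \near x, f y = g y) -> fs_near x g -> fs_near x f.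
Proof.
by move=> fg [h Ch gh]; exists h => //; apply: filterS2 fg gh => y -> ->.
Qed.

Lemma fs_fun_near x f : fs_fun f -> fs_near x f.
Proof. by move=> Cf; exists f => //; exact: nearW. Qed.

Hypothesis dX : is_differential_space X.

Lemma fs_nearP f : (forall x, fs_near x f) -> fs_fun f.
Proof.
move=> fP; have [_ _ /(_ f)[_ loc] _] := dX; apply: loc => x.
have [h Ch fh] := fP x; have : nbhs x (fun y => f y = h y) := fh.
rewrite nbhsE /= => -[U oU Uh].
by exists U => //; exists h.
Qed.

Lemma fs_near_continuous x f : fs_near x f -> {for x, continuous f}.
Proof.
move=> [h Ch fh]; apply: near_eq_continuous fh _.
by have [hc _ _ _] := dX; exact: hc.
Qed.

Lemma fs_fun_cst (c : R) : @fs_fun R X (fun=> c).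
Proof.
have [_ [C1 CD _] _ _] := dX; have := CD (c - 1) 1 1 C1 C1.
by congr fs_fun; apply/funext => x; rewrite !fctE [_ *: _]mulr1 subrK.
Qed.

Lemma fs_fun_smooth n (f : 'I_n -> X -> R) (g : 'rV[R]_n -> R) : (forall i, fs_fun (f i)) ->
  smooth setT g -> fs_fun (fun x => g (\row_i f i x)).
Proof.
case: n f g => [|n] f g Cf gs; last by have [_ _ _] := dX; exact.
have -> : (fun x => g (\row_i f i x)) = fun=> g 0.
  by apply/funext => x; congr g; apply/rowP => -[].
exact: fs_fun_cst.
Qed.

(** The closure axiom speaks of [g] smooth on the whole of [R^n]; a cutoff replaces a local [g] by a
    global one with the same germ at the point in question. *)
Lemma fs_near_smooth n (W : set 'rV[R]_n) (f : 'I_n -> X -> R) (g : 'rV[R]_n -> R) x : open W ->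
  smooth W g -> (forall i, fs_near x (f i)) -> W (\row_i f i x) ->
  fs_near x (fun y => g (\row_i f i y)).
Proof.
move=> oW gs fx Wx; have [G [K [_ _ Gs _ Gg]]] := smooth_cutoff oW Wx gs.
have [h hP] := choice (fun i => (exists2P _ _).1 (fx i)).
exists (fun y => G (\row_i h i y)).
  by apply: fs_fun_smooth => // i; case: (hP i).
have fh : \forall y \near x, forall i, f i y = h i y.
  by apply: (@filter_forall _ _ (fun i y => f i y = h i y) (nbhs x)) => i; case: (hP i).
have fc : {for x, continuous (fun y => \row_i f i y)}.
  by apply: continuous_row_fun => i; exact: fs_near_continuous.
apply: filterS2 fh (fc _ Gg) => y fhy /= <-; congr G; apply/rowP => i; rewrite !mxE.
by rewrite fhy.
Qed.

Lemma fs_near_cst x (c : R) : fs_near x (fun=> c).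
Proof. by apply: fs_fun_near; exact: fs_fun_cst. Qed.

Let f2 f g (i : 'I_2) := if i == ord0 then f else g.

Lemma fs_nearD x f g : fs_near x f -> fs_near x g -> fs_near x (fun y => f y + g y).
Proof.
move=> fx gx.
apply: (eq_fs_near (g := fun y => (fun z : 'rV[R]_2 => z 0 ord0 + z 0 ord_max) (\row_i f2 f g i y))).
  by apply: nearW => y /=; rewrite !mxE.
apply: (@fs_near_smooth 2 setT (f2 f g) (fun z => z 0 ord0 + z 0 ord_max)) => //; first exact: openT.
  by apply: smoothD; [exact: openT|exact: smooth_coord|exact: smooth_coord].
by move=> i; rewrite /f2; case: ifP.
Qed.

Lemma fs_nearM x f g : fs_near x f -> fs_near x g -> fs_near x (fun y => f y * g y).
Proof.
move=> fx gx.
apply: (eq_fs_near (g := fun y => (fun z : 'rV[R]_2 => z 0 ord0 * z 0 ord_max) (\row_i f2 f g i y))).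
  by apply: nearW => y /=; rewrite !mxE.
apply: (@fs_near_smooth 2 setT (f2 f g) (fun z => z 0 ord0 * z 0 ord_max)) => //; first exact: openT.
  by apply: smoothM; [exact: openT|exact: smooth_coord|exact: smooth_coord].
by move=> i; rewrite /f2; case: ifP.
Qed.

Lemma fs_near_smooth1 (W : set R) h x f : open W -> smooth1 W h -> fs_near x f -> W (f x) ->
  fs_near x (fun y => h (f y)).
Proof.
move=> oW hs fx Wx.
have oV : open [set z : 'rV[R]_1 | W (z 0 0)].
  by apply: open_comp oW => z _; exact: coord_continuous.
apply: (eq_fs_near (g := fun y => (fun z : 'rV[R]_1 => h (z 0 0)) (\row_(i < 1) f y))).
  by apply: nearW => y /=; rewrite mxE.
by apply: (@fs_near_smooth 1 _ (fun=> f) (fun z => h (z 0 0))) oV hs _ _ => //=; rewrite mxE.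
Qed.

Lemma fs_nearV x f : fs_near x f -> f x != 0 -> fs_near x (fun y => (f y)^-1).
Proof. by move=> fx; apply: fs_near_smooth1 (@smooth1_inv R) fx; exact: open_neq. Qed.

Lemma fs_near_flat x f : fs_near x f -> fs_near x (fun y => flat (f y)).
Proof. by move=> fx; apply: fs_near_smooth1 openT (@smooth1_flat R) fx I. Qed.

Lemma fs_nearN x f : fs_near x f -> fs_near x (fun y => - f y).
Proof.
move=> fx; apply: (eq_fs_near (g := fun y => -1 * f y)).
  by apply: nearW => y; rewrite mulN1r.
by apply: fs_nearM => //; exact: fs_near_cst.
Qed.

Lemma fs_nearB x f g : fs_near x f -> fs_near x g -> fs_near x (fun y => f y - g y).
Proof. by move=> fx gx; apply: fs_nearD => //; exact: fs_nearN. Qed.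

Lemma fs_near_sum x (I : Type) (r : seq I) (P : pred I) (F : I -> X -> R) :
  (forall i, P i -> fs_near x (F i)) -> fs_near x (fun y => \sum_(i <- r | P i) F i y).
Proof.
move=> Fx; elim: r => [|i r IH].
  by apply: eq_fs_near (fs_near_cst x 0); apply: nearW => y; rewrite big_nil.
case Pi : (P i); last first.
  by apply: eq_fs_near IH; apply: nearW => y; rewrite big_cons Pi.
apply: eq_fs_near (fs_nearD (Fx _ Pi) IH).
by apply: nearW => y; rewrite big_cons Pi.
Qed.

Lemma fs_near_prod x (I : Type) (r : seq I) (P : pred I) (F : I -> X -> R) :
  (forall i, P i -> fs_near x (F i)) -> fs_near x (fun y => \prod_(i <- r | P i) F i y).
Proof.
move=> Fx; elim: r => [|i r IH].
  by apply: eq_fs_near (fs_near_cst x 1); apply: nearW => y; rewrite big_nil.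
case Pi : (P i); last first.
  by apply: eq_fs_near IH; apply: nearW => y; rewrite big_cons Pi.
apply: eq_fs_near (fs_nearM (Fx _ Pi) IH).
by apply: nearW => y; rewrite big_cons Pi.
Qed.

End fs_near.

Section smooth_generation.
Variables (R : realType) (T : topologicalType) (G : set (T -> R)).

(** The differential structure generated by [G]: functions which near each point are smooth in
    finitely many generators. *)
Definition smgen : set (T -> R) := [set f | forall x : T, exists m (phi : 'I_m -> T -> R) g,
  [/\ forall i, G (phi i), smooth setT g & \forall y \near x, f y = g (\row_i phi i y)]].

Definition gen_fspace : fspace R := @FSpace R T smgen.

Lemma smgen_sub : G `<=` smgen.
Proof.
move=> f Gf x; exists 1, (fun=> f), (fun z => z 0 0); split => //; first exact: smooth_coord.
by apply: nearW => y; rewrite mxE.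
Qed.

Hypothesis Gc : forall f, G f -> continuous f.

Lemma gen_ds : is_differential_space gen_fspace.
Proof.
have sc n (f : 'I_n -> T -> R) (g : 'rV[R]_n -> R) : (forall i, smgen (f i)) ->
    smooth setT g -> smgen (fun x => g (\row_i f i x)).
  move=> fG gs x.
  have [m mP] := choice (fun i => fG i x).
  have [phi phiP] := @fin_all_exists _ (fun i => 'I_(m i) -> T -> R) _ mP.
  have [h hP] := @fin_all_exists _ (fun i => 'rV[R]_(m i) -> R) _ phiP.
  (* Near [x] every [f i] has its own finite list of generators; the lists are concatenated by
     indexing over the dependent sum. *)
  pose J := {i : 'I_n & 'I_(m i)}.
  pose ix i (j : 'I_(m i)) : 'I_#|{: J}| := enum_rank (Tagged (fun i => 'I_(m i)) j : J).
  exists #|{: J}|, (fun k => phi (tag (enum_val k)) (tagged (enum_val k))).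
  exists (fun z => g (\row_i h i (\row_j z 0 (ix i j)))); split.
  - by move=> k; case: (hP (tag (enum_val k))).
  - apply: (smooth_comp (f := fun i z => h i (\row_j z 0 (ix i j))) (V := setT)) => //; try exact: openT.
    move=> i; have [_ hs _] := hP i.
    apply: (smooth_comp (f := fun j z => z 0 (ix i j)) (V := setT)) => //; try exact: openT.
    by move=> j; exact: smooth_coord.
  have : \forall y \near x, forall i, f i y = h i (\row_j phi i j y).
    apply: (@filter_forall _ _ (fun i y => f i y = h i (\row_j phi i j y)) (nbhs x)) => i.
    by case: (hP i).
  apply: filterS => y fy; congr g; apply/rowP => i; rewrite !mxE fy; congr (h i).
  by apply/rowP => j; rewrite !mxE /ix enum_rankK.
split.
- move=> f fG x; have [m [phi [g [phiG gs fg]]]] := fG x.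
  apply: near_eq_continuous fg _.
  apply: (@continuous_comp _ _ _ (fun y => \row_i phi i y) g); last exact: (smooth_continuous gs).
  by apply: continuous_row_fun => i; exact: Gc.
- have s2 (f1 f2 : T -> R) (g : 'rV[R]_2 -> R) : smgen f1 -> smgen f2 -> smooth setT g ->
      smgen (fun x => g (\row_(i < 2) if i == ord0 then f1 x else f2 x)).
    move=> G1 G2 gs.
    apply: (sc 2 (fun (i : 'I_2) x => if i == ord0 then f1 x else f2 x) g _ gs).
    by move=> i; case: (i == ord0).
  split.
  + by apply: (sc 0 (fun _ _ => 0) (fun=> 1) _ (smooth_cst _ _)); case.
  + move=> a f g Gf Gg; have := s2 f g (fun z => a * z 0 ord0 + z 0 ord_max) Gf Gg.
    have -> : a *: f + g = fun x => (fun z : 'rV[R]_2 => a * z 0 ord0 + z 0 ord_max)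
       (\row_i (if i == ord0 then f x else g x)).
      by apply/funext => x; rewrite !mxE.
    apply; apply: smoothD; try exact: openT; last exact: smooth_coord.
    by apply: smoothM; [exact: openT|exact: smooth_cst|exact: smooth_coord].
  + move=> f g Gf Gg; have := s2 f g (fun z => z 0 ord0 * z 0 ord_max) Gf Gg.
    have -> : f * g = fun x => (fun z : 'rV[R]_2 => z 0 ord0 * z 0 ord_max)
       (\row_i (if i == ord0 then f x else g x)).
      by apply/funext => x; rewrite !mxE.
    by apply; apply: smoothM; [exact: openT|exact: smooth_coord|exact: smooth_coord].
- move=> f; split; first by move=> Gf x; exists setT; [exact: open_nbhsT|exists f].
  move=> fP x; have [U oU [g gG fg]] := fP x.
  have [m [phi [h [phiG hs gh]]]] := gG x; exists m, phi, h; split => //.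
  by apply: filterS2 gh (open_nbhs_nbhs oU) => y <- /fg.
- by move=> n f g; exact: sc.
Qed.

(** The universal property of the generated structure: maps into it are tested on generators. *)
Lemma gen_fs_near (X : fspace R) (f : X -> T) x F : is_differential_space X ->
  {for x, continuous f} -> (forall phi, G phi -> fs_near x (phi \o f)) ->
  smgen F -> fs_near x (F \o f).
Proof.
move=> dX fc fG GF; have [m [phi [g [phiG gs Fg]]]] := GF (f x).
apply: (eq_fs_near (g := fun y => g (\row_i (phi i \o f) y))).
  exact: (fc _ Fg).
by apply: (fs_near_smooth dX openT gs) => // i; exact: fG.
Qed.

End smooth_generation.

Section morphisms.
Variable R : realType.
Implicit Types X Y Z : fspace R.

Lemma is_morphism_near X Y (f : X -> Y) : is_differential_space X ->
  (forall x, {for x, continuous f}) ->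
  (forall x phi, fs_fun phi -> fs_near x (phi \o f)) -> is_morphism f.
Proof. by move=> dX fc fn; split => // phi Cphi; apply: fs_nearP => // x; exact: fn. Qed.

Lemma morphism_near X Y (f : X -> Y) x phi : is_morphism f -> fs_near (f x) phi ->
  fs_near x (phi \o f).
Proof.
move=> [fc fm] [h Ch ph]; exists (h \o f); first exact: fm.
exact: (fc x _ ph).
Qed.

End morphisms.

Section subspaces.
Variables (R : realType) (X : fspace R) (Y : set X).
Hypothesis dX : is_differential_space X.

Lemma subfspace_funP (g : subfspace Y -> R) : fs_fun g <->
  forall y : Y, exists2 h : X -> R, fs_fun h & \forall z \near y, g z = h (val z).
Proof.
split=> gP y; have [] := gP y.
  move=> V oV [h Ch gh]; exists h => //.
  by apply: filterS (open_nbhs_nbhs oV) => z /gh.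
move=> h Ch gh; have : nbhs y (fun z => g z = h (val z)) := gh.
by rewrite nbhsE /= => -[V oV VP]; exists V => //; exists h.
Qed.

(** With this presentation the axioms for a subspace are an instance of [gen_ds]. *)
Lemma subfspace_gen :
  subfspace Y = gen_fspace [set (fun y : Y => h (val y)) | h in @fs_fun R X].
Proof.
congr FSpace; apply/seteqP; split => g.
  move=> /subfspace_funP gP y; have [h Ch gh] := gP y.
  exists 1, (fun=> fun y => h (val y)), (fun z => z 0 0); split => //.
  - by move=> _; exists h.
  - exact: smooth_coord.
  by apply: filterS gh => z ->; rewrite mxE.
move=> gG; apply/subfspace_funP => y; have [m [phi [F [phiG Fs gF]]]] := gG y.
have [h hP] := choice (fun i => (exists2P _ _).1 (phiG i)).
exists (fun x => F (\row_i h i x)).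
  by apply: (fs_fun_smooth dX) => // i; case: (hP i).
apply: filterS gF => z ->; congr F; apply/rowP => i; rewrite !mxE.
by case: (hP i) => _ <-.
Qed.

Lemma subfspace_ds : is_differential_space (subfspace Y).
Proof.
rewrite subfspace_gen; apply: gen_ds => _ [h Ch <-] y.
apply: (@continuous_comp _ _ _ (fun y : Y => val y) h); first exact: val_continuous.
by have [hc _ _ _] := dX; exact: hc.
Qed.

Lemma subfspace_val_morphism : is_morphism (fun y : subfspace Y => val y).
Proof.
split; first exact: val_continuous.
by move=> phi Cphi; apply/subfspace_funP => y; exists phi => //; near=> z.
Unshelve. all: by end_near. Qed.

Lemma subfspace_nearP (y : subfspace Y) (g : subfspace Y -> R) :
  fs_near y g <-> exists2 h : X -> R, fs_fun h & \forall z \near y, g z = h (val z).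
Proof.
split=> [[k /subfspace_funP/(_ y)[h Ch kh] gk]|[h Ch gh]].
  by exists h => //; apply: filterS2 gk kh => z -> ->.
by exists (fun z => h (val z)) => //; apply: subfspace_val_morphism.2.
Qed.

Lemma morphism_subfspace (Z : fspace R) (f : Z -> subfspace Y) : is_differential_space Z ->
  is_morphism (fun z => val (f z) : X) -> is_morphism f.
Proof.
move=> dZ fm; have fc z : {for z, continuous f} by apply: continuous_set_type; exact: fm.1.
apply: is_morphism_near => // z phi /subfspace_funP/(_ (f z))[h Ch ph].
apply: (eq_fs_near (g := h \o (fun z => val (f z)))); first exact: (fc z _ ph).
by apply: fs_fun_near; exact: fm.2.
Qed.

Hypothesis oY : open Y.

Lemma near_open_subfspace (y : Y) (P : X -> Prop) :
  (\forall z \near y, P (val z)) -> \forall x \near val y, P x.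
Proof.
by move=> /(nbhs_set_type_open oY); apply: filterS => x [z Pz <-].
Qed.

Lemma fs_near_open_subfspace (y : subfspace Y) (F : X -> R) :
  fs_near y (fun z => F (val z)) <-> fs_near (val y) F.
Proof.
split; last by move=> /(morphism_near subfspace_val_morphism).
move=> /subfspace_nearP[h Ch Fh]; exists h => //.
exact: (near_open_subfspace (P := fun x => F x = h x)) Fh.
Qed.

End subspaces.

(** * Germs, tangent spaces, and strata of open subspaces *)

Section germ_representatives.
Variables (R : realType) (X : fspace R) (x : X).

Lemma germ_rep_exists (u : germs_at x) : exists h, @fs_fun R X h /\ germ_of x h = val u.
Proof. by have [h Ch hu] := set_mem (valP u); exists h. Qed.

Definition germ_rep (u : germs_at x) : X -> R := sval (cid (germ_rep_exists u)).

Lemma germ_rep_fun u : @fs_fun R X (germ_rep u).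
Proof. exact: (svalP (cid (germ_rep_exists u))).1. Qed.

Lemma germ_repE u : germ_of x (germ_rep u) = val u.
Proof. exact: (svalP (cid (germ_rep_exists u))).2. Qed.

Definition to_germ (h : X -> R) (Ch : @fs_fun R X h) : germs_at x :=
  exist _ (germ_of x h) (mem_set (ex_intro2 _ _ h Ch erefl)).

Lemma val_to_germ (h : X -> R) (Ch : @fs_fun R X h) : val (to_germ Ch) = germ_of x h.
Proof. by []. Qed.

Lemma germ_rep_near u h : val u = germ_of x h <-> \forall y \near x, germ_rep u y = h y.
Proof. by rewrite -germ_ofE germ_repE. Qed.

Lemma germ_evalE (h : X -> R) : germ_eval (germ_of x h) = h x.
Proof. exact: (nbhs_singleton (germ_ofK x h)). Qed.

Lemma germ_eval_rep u : germ_eval (val u) = germ_rep u x.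
Proof. by rewrite -germ_repE germ_evalE. Qed.

Lemma germ_of_lin (a : R) (f g : X -> R) :
  a *: germ_of x f + germ_of x g = germ_of x (fun y => a * f y + g y).
Proof. by rewrite [a *: germ_of x f]germ_scaleE -germ_ofD. Qed.

Lemma germ_of_mul (f g : X -> R) : germ_of x f * germ_of x g = germ_of x (fun y => f y * g y).
Proof. exact: germ_mulE. Qed.

Lemma val_lin_germ (a : R) (u v w : germs_at x) : val w = a *: val u + val v <->
  \forall y \near x, germ_rep w y = a * germ_rep u y + germ_rep v y.
Proof. by rewrite -(germ_repE u) -(germ_repE v) germ_of_lin germ_rep_near. Qed.

Lemma val_mul_germ (u v w : germs_at x) : val w = val u * val v <->
  \forall y \near x, germ_rep w y = germ_rep u y * germ_rep v y.
Proof. by rewrite -(germ_repE u) -(germ_repE v) germ_of_mul germ_rep_near. Qed.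

End germ_representatives.

Arguments to_germ {R X} x {h} Ch.

Section tangent_transfer.
Variables (R : realType).

(** The type [germs_at x] carries no algebra structure of its own, so homomorphisms are described
    relationally through [val], in the same form as derivations in [tangent]. *)
Definition germ_hom (X Y : fspace R) (x : X) (y : Y) (t : germs_at x -> germs_at y) : Prop :=
  [/\ forall (a : R) u v w, val w = a *: val u + val v -> val (t w) = a *: val (t u) + val (t v),
      forall u v w, val w = val u * val v -> val (t w) = val (t u) * val (t v) &
      forall u, germ_eval (val (t u)) = germ_eval (val u)].

Lemma tangent_pull (X Y : fspace R) (x : X) (y : Y) (t : germs_at x -> germs_at y) D :
  germ_hom t -> tangent y D -> tangent x (D \o t).
Proof.
move=> [tl tm te] [Dl Dm]; split => [a u v w /tl/Dl//|u v w /tm/Dm].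
by rewrite !te.
Qed.

(** A derivation [D] at [y] is [D \o t] followed back along [t'], so a spanning family at [x] pulls
    back along [t'] to a spanning family at [y]. *)
Lemma dim_le_transfer (X Y : fspace R) (x : X) (y : Y) (t : germs_at x -> germs_at y) t' k :
  germ_hom t -> germ_hom t' -> cancel t' t -> dim_le (tangent x) k -> dim_le (tangent y) k.
Proof.
move=> th t'h tK [b bT bS]; exists (fun i => b i \o t'); first by move=> i; exact: tangent_pull.
move=> D /(tangent_pull th)/bS[c Dc]; exists c; apply/funext => v.
have := congr1 (@^~ (t' v)) Dc; rewrite /= tK => ->.
by rewrite !fct_sumE.
Qed.

End tangent_transfer.

Lemma dim_le_mono (R : pzRingType) (V : lmodType R) (A : set V) k l : A 0 ->
  (k <= l)%N -> dim_le A k -> dim_le A l.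
Proof.
move=> A0 /subnKC <-; elim: (l - k)%N => [|m IH]; first by rewrite addn0.
move=> /IH[b bA bS]; rewrite addnS.
exists (fun i => if unlift ord_max i is Some j then b j else 0).
  by move=> i; case: unliftP.
move=> v /bS[c ->]; exists (fun i => if unlift ord_max i is Some j then c j else 0).
rewrite big_ord_recr /= unlift_none scaler0 addr0; apply: eq_bigr => i _.
have -> : widen_ord (leqnSn (k + m)) i = lift ord_max i by apply: val_inj; rewrite /= /bump leqNgt ltn_ord.
by rewrite liftK.
Qed.

Lemma tangent0 (R : realType) (X : fspace R) (x : X) : tangent x 0.
Proof.
have z0 (u : germs_at x) : (0 : germs_at x -> R) u = 0 by [].
by split=> *; rewrite !z0 mulr0 ?mul0r addr0.
Qed.

Lemma skeleton_mono (R : realType) (X : fspace R) k l : (k <= l)%N ->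
  skeleton X k `<=` skeleton X l.
Proof. by move=> kl x; apply: dim_le_mono kl; exact: tangent0. Qed.

Lemma in_stratum (R : realType) (X : fspace R) (x : X) n : skeleton X n x ->
  exists2 k, (k <= n)%N & stratum X k x.
Proof.
elim: n => [|n IH] xn; first by exists 0%N.
have [/IH[k kn xk]|nx] := pselect (skeleton X n x); last by exists n.+1.
by exists k => //; exact: leqW.
Qed.

Section open_subspace_strata.
Variables (R : realType) (X : fspace R) (U : set X).
Hypotheses (dX : is_differential_space X) (oU : open U).

Let res (y : subfspace U) (u : germs_at (val y)) : germs_at y :=
  to_germ y ((@subfspace_val_morphism R X U).2 _ (germ_rep_fun u)).

Let ext_exists (y : subfspace U) (v : germs_at y) :
  exists u : germs_at (val y), val v = germ_of y (fun z => germ_rep u (val z)).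
Proof.
have /subfspace_funP/(_ y)[h Ch hv] := germ_rep_fun v.
exists (to_germ _ Ch); apply/germ_rep_near.
have hr : \forall x \near val y, germ_rep (to_germ (val y) Ch) x = h x by apply/germ_rep_near.
by apply: filterS2 hv (near_set_type hr) => z -> ->.
Qed.

Let ext (y : subfspace U) (v : germs_at y) : germs_at (val y) := sval (cid (ext_exists v)).

Let resE y u : val (@res y u) = germ_of y (fun z => germ_rep u (val z)).
Proof. by []. Qed.

Let extE y (v : germs_at y) : val v = germ_of y (fun z => germ_rep (ext v) (val z)).
Proof. exact: (svalP (cid (ext_exists v))). Qed.

Let res_hom y : germ_hom (@res y).
Proof.
split => [a u v w /val_lin_germ uvw|u v w /val_mul_germ uvw|u].
- by rewrite !resE germ_of_lin; apply/germ_ofE; exact: near_set_type uvw.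
- by rewrite !resE germ_of_mul; apply/germ_ofE; exact: near_set_type uvw.
- by rewrite resE germ_evalE germ_eval_rep.
Qed.

Let ext_hom y : germ_hom (@ext y).
Proof.
split => [a u v w|u v w|u].
- rewrite !extE germ_of_lin => /germ_ofE uvw; apply/val_lin_germ.
  exact: (near_open_subfspace oU (P := fun x => germ_rep (ext w) x = a * germ_rep (ext u) x + germ_rep (ext v) x)) uvw.
- rewrite !extE germ_of_mul => /germ_ofE uvw; apply/val_mul_germ.
  exact: (near_open_subfspace oU (P := fun x => germ_rep (ext w) x = germ_rep (ext u) x * germ_rep (ext v) x)) uvw.
- by rewrite extE germ_evalE germ_eval_rep.
Qed.

(** Restriction and extension of germs are mutually inverse when [U] is open, so tangent spaces in
    [U] and in [X] have the same dimension. *)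
Lemma skeleton_open_subfspace k : skeleton (subfspace U) k = val @^-1` skeleton X k.
Proof.
apply/seteqP; split => y.
  apply: (dim_le_transfer (@ext_hom y) (@res_hom y)) => u.
  apply: val_inj; rewrite -(germ_repE u) -(germ_repE (ext _)); apply/germ_ofE.
  apply: (near_open_subfspace oU (P := fun x => germ_rep (ext (res u)) x = germ_rep u x)).
  by apply/germ_ofE; rewrite -extE resE.
apply: (dim_le_transfer (@res_hom y) (@ext_hom y)) => v.
by apply: val_inj; rewrite resE -extE.
Qed.

Lemma stratum_open_subfspace k : stratum (subfspace U) k = val @^-1` stratum X k.
Proof. by case: k => [|k] /=; rewrite !skeleton_open_subfspace. Qed.

End open_subspace_strata.

(** * The strata of Euclidean space *)

Section euclidean_tangent.
Variables (R : realType) (n : nat).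
Implicit Type p : euclidean R n.

Local Notation e_ i := (delta_mx 0 i : 'rV[R]_n).

Lemma euclidean_ds : is_differential_space (euclidean R n).
Proof.
suff -> : euclidean R n = gen_fspace (smooth (R := R) (n := n) setT).
  by apply: gen_ds => f fs x; exact: smooth_continuous fs I.
congr FSpace; apply/seteqP; split; first exact: smgen_sub.
move=> f fG; apply: smooth_locally => x _.
have [m [phi [g [phis gs fg]]]] := fG x.
have : nbhs x (fun y => f y = g (\row_i phi i y)) := fg.
rewrite nbhsE /= => -[V [oV Vx] VP]; exists V, (fun y => g (\row_i phi i y)); split => //.
apply: (smooth_comp (f := phi) oV openT) => // i.
exact: smooth_sub (phis i).
Qed.

Definition partial_germ p (i : 'I_n) (u : germs_at p) : R := 'D_(e_ i) (germ_rep u) p.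

Lemma partial_germE p i (h : 'rV[R]_n -> R) (hs : smooth setT h) :
  partial_germ i (to_germ p hs) = 'D_(e_ i) h p.
Proof. by apply: near_eq_derive; exact: ((germ_rep_near (to_germ p hs) h).1 erefl). Qed.

Lemma smooth_derivable (h : 'rV[R]_n -> R) (x v : 'rV[R]_n) : smooth setT h -> derivable h x v.
Proof. by move=> hs; apply: diff_derivable; exact: smooth_differentiable. Qed.

Lemma tangent_partial p i : tangent p (@partial_germ p i).
Proof.
have rd (u : germs_at p) v : derivable (germ_rep u) (p : 'rV[R]_n) v.
  by apply: smooth_derivable; exact: (germ_rep_fun u).
split => [a u v w /val_lin_germ uvw|u v w /val_mul_germ uvw]; rewrite /partial_germ.
  rewrite (near_eq_derive _ uvw).
  have d1 : derivable (a \*: (germ_rep u : 'rV[R]_n -> R)) (p : 'rV[R]_n) (e_ i) by exact: derivableZ (rd u _).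
  transitivity ('D_(e_ i) (a \*: (germ_rep u : 'rV[R]_n -> R)) p + 'D_(e_ i) (germ_rep v) p).
    exact: deriveD d1 (rd v _).
  by rewrite (deriveZ a (rd u (e_ i))).
rewrite (near_eq_derive _ uvw) !germ_eval_rep.
transitivity (germ_rep u p *: 'D_(e_ i) (germ_rep v) p + germ_rep v p *: 'D_(e_ i) (germ_rep u) p).
  exact: deriveM (rd u _) (rd v _).
by rewrite /GRing.scale /=; congr (_ + _); exact: mulrC.
Qed.

(** The partial derivatives span all derivations: a derivation kills constants, and in Hadamard's
    expansion of [f] at [p] the Leibniz rule leaves the sum of its values on [y i - p i] times the
    partial derivatives of [f] at [p]. *)
Lemma euclidean_skeleton_full p : skeleton (euclidean R n) n p.
Proof.
exists (@partial_germ p); first exact: tangent_partial.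
move=> D [Dl Dm].
have Dnear (u v : germs_at p) : val u = val v -> D u = D v by move=> /val_inj ->.
have cs (c : R) : smooth [set: 'rV[R]_n] (fun=> c) by exact: smooth_cst.
have D0 : D (to_germ p (cs 0)) = 0.
  have := Dl (-1) (to_germ p (cs 0)) (to_germ p (cs 0)) (to_germ p (cs 0)).
  rewrite mulN1r addNr; apply; rewrite !val_to_germ germ_of_lin; congr germ_of.
  by apply/funext => y; rewrite mulr0 addr0.
have D1 : D (to_germ p (cs 1)) = 0.
  have := Dm (to_germ p (cs 1)) (to_germ p (cs 1)) (to_germ p (cs 1)).
  rewrite !val_to_germ !germ_evalE mul1r mulr1 => h.
  have : D (to_germ p (cs 1)) = D (to_germ p (cs 1)) + D (to_germ p (cs 1)).
    by apply: h; rewrite germ_of_mul; congr germ_of; apply/funext => y; rewrite mulr1.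
  by move/eqP; rewrite -subr_eq0 opprD addrA subrr sub0r oppr_eq0 => /eqP.
have Dc c : D (to_germ p (cs c)) = 0.
  rewrite (Dl c (to_germ p (cs 1)) (to_germ p (cs 0))); first by rewrite D1 D0 mulr0 addr0.
  by rewrite !val_to_germ germ_of_lin; congr germ_of; apply/funext => y; rewrite mulr1 addr0.
have ys i : smooth [set: 'rV[R]_n] (fun y => y 0 i - p 0 i).
  by apply: smoothB; [exact: openT|exact: smooth_coord|exact: smooth_cst].
exists (fun i => D (to_germ p (ys i))); apply/funext => u.
set f := germ_rep u; have fs : smooth setT f := germ_rep_fun u.
pose g i := ray_mean p 0 ('D_(e_ i) f).
have gs i : smooth setT (g i) by apply: smooth_ray_mean; exact: smooth_derive.
have gp i : g i p = 'D_(e_ i) f p by apply: ray_mean_center; exact: smooth_derive.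
(* The definition of [tangent] gives linearity for one sum at a time; finite sums follow by
   induction. *)
have Ds m (h : 'I_m -> 'rV[R]_n -> R) (hs : forall i, smooth setT (h i)) (k : 'rV[R]_n -> R) (ks : smooth setT k) :
    (forall y, k y = \sum_i h i y) -> D (to_germ p ks) = \sum_i D (to_germ p (hs i)).
  elim: m h hs k ks => [|m IH] h hs k ks kE.
    rewrite big_ord0 -[RHS](Dc 0); apply: Dnear; congr germ_of.
    by apply/funext => y; rewrite kE big_ord0.
  have k's : smooth [set: 'rV[R]_n] (fun y => \sum_(i < m) h (widen_ord (leqnSn m) i) y).
    by apply: (smooth_sum (f := fun i => h (widen_ord (leqnSn m) i))) => //; exact: openT.
  rewrite big_ord_recr /= -(IH _ (fun i => hs (widen_ord (leqnSn m) i)) _ k's) //.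
  rewrite (Dl 1 (to_germ p k's) (to_germ p (hs ord_max))) ?mul1r //.
  rewrite !val_to_germ germ_of_lin; congr germ_of; apply/funext => y.
  by rewrite kE big_ord_recr /= mul1r.
have hs i : smooth setT (fun y => (y 0 i - p 0 i) * g i y).
  by apply: smoothM; [exact: openT|exact: ys|exact: gs].
have qs : smooth setT (fun y => \sum_i (y 0 i - p 0 i) * g i y).
  by apply: (smooth_sum (f := fun i y => (y 0 i - p 0 i) * g i y)) => //; exact: openT.
have -> : D u = \sum_i D (to_germ p (hs i)).
  rewrite -(Ds _ _ hs _ qs) // (Dl 1 (to_germ p qs) (to_germ p (cs (f p))) u).
    by rewrite Dc addr0 mul1r.
  rewrite !val_to_germ germ_of_lin -germ_repE; congr germ_of; apply/funext => y.
  by rewrite mul1r addrC; exact: hadamard.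
rewrite fct_sumE; apply: eq_bigr => i _.
rewrite (Dm (to_germ p (ys i)) (to_germ p (gs i))) ?val_to_germ ?germ_of_mul // !germ_evalE subrr mul0r add0r.
by rewrite gp.
Qed.

(** The partial derivatives applied to the coordinate functions form the identity matrix of size
    [n]; [k] spanning derivations would factor it through dimension [k]. *)
Lemma euclidean_skeleton_empty p k : (k < n)%N -> ~ skeleton (euclidean R n) k p.
Proof.
move=> kn [b _ bS].
have [c cP] := choice (fun i => bS _ (@tangent_partial p i)).
have ys j : smooth [set: 'rV[R]_n] (fun y => y 0 j) by exact: smooth_coord.
pose M : 'M[R]_(n, k) := \matrix_(i, l) c i l.
pose N : 'M[R]_(k, n) := \matrix_(l, j) b l (to_germ p (ys j)).
have MN : M *m N = 1%:M.
  apply/matrixP => i j; rewrite !mxE.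
  have := congr1 (@^~ (to_germ p (ys j))) (cP i); rewrite partial_germE.
  have [_ ->] := is_derive_coord j p (e_ i).
  by rewrite mxE /= eq_sym fct_sumE => ->; apply: eq_bigr => l _; rewrite !mxE.
have : (\rank (1%:M : 'M[R]_n) <= k)%N.
  by rewrite -MN (leq_trans (mxrankM_maxl _ _)) // rank_leq_col.
by rewrite mxrank1 leqNgt kn.
Qed.

Lemma euclidean_stratum k : stratum (euclidean R n) k = if k == n then setT else set0.
Proof.
apply/seteqP; split => p.
  case: (ltngtP k n) => // kn.
    by case: k kn => [|k] kn /= => [/(euclidean_skeleton_empty kn)//|[/(euclidean_skeleton_empty kn)//]].
  case: k kn => // k kn /= [_ []].
  exact: skeleton_mono (euclidean_skeleton_full p).
case: eqP => // kn _.
have full j : j = n -> skeleton (euclidean R n) j p.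
  by move=> ->; exact: euclidean_skeleton_full.
case: k kn => [|k] kn /=; first exact: full.
by split; [exact: full|apply: euclidean_skeleton_empty; rewrite -kn].
Qed.

End euclidean_tangent.

(** * Charts, and atlases of strata *)

Section charts.
Variables (R : realType) (M : topologicalType) (k : nat).
Implicit Types (c : chart R M k) (A : set (chart R M k)) (x : M).

Lemma chart_mapK c x : is_chart c -> chart_dom c x -> chart_inv c (chart_map c x) = x.
Proof. by case=> _ _ _ _; apply. Qed.

Lemma chart_codP c x : chart_dom c x -> chart_cod c (chart_map c x).
Proof. by move=> cx; exists x. Qed.

Lemma chart_invP c z : is_chart c -> chart_cod c z ->
  chart_dom c (chart_inv c z) /\ chart_map c (chart_inv c z) = z.
Proof. by move=> cc [x cx <-]; rewrite chart_mapK. Qed.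

Lemma chart_dom_nbhs c x : is_chart c -> chart_dom c x -> nbhs x (chart_dom c).
Proof. by case=> od _ _ _ _ cx; apply: open_nbhs_nbhs. Qed.

Lemma chart_cod_nbhs c x : is_chart c -> chart_dom c x -> nbhs (chart_map c x) (chart_cod c).
Proof. by case=> _ oc _ _ _ cx; apply: open_nbhs_nbhs; split => //; exact: chart_codP. Qed.

Lemma chart_inv_near c x (P : set M) : is_chart c -> chart_dom c x -> nbhs x P ->
  \forall z \near chart_map c x, P (chart_inv c z).
Proof.
move=> cc cx nP; have [_ _ _ ic _] := cc.
by apply: (ic _ (chart_codP cx)); rewrite chart_mapK.
Qed.

(** The pointwise form of [smooth_fun]; by [smooth_at_change] it does not depend on the chart of the
    atlas. *)
Definition smooth_at c x (F : M -> R) : Prop := exists W : set 'rV[R]_k,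
  [/\ open W, W (chart_map c x), W `<=` chart_cod c & smooth W (F \o chart_inv c)].

Lemma smooth_at_near c x (F F' : M -> R) : is_chart c -> chart_dom c x ->
  (\forall y \near x, F y = F' y) -> smooth_at c x F' -> smooth_at c x F.
Proof.
move=> cc cx FF' [W [oW Wx Wc Fs]].
have nW : nbhs (chart_map c x) W by exact: open_nbhs_nbhs.
have [V [oV Vx VP]] := nbhs_open_sub (filterI nW (chart_inv_near cc cx FF')).
exists V; split => //.
  by move=> z /VP[/Wc].
apply: (eq_smooth oV _ (smooth_sub _ Fs)) => z /VP[] //.
Qed.

Lemma smooth_fun_at A c x F : is_atlas A -> A c -> chart_dom c x -> smooth_fun A F ->
  smooth_at c x F.
Proof.
move=> [Ac _ _] cA cx Fs; exists (chart_cod c); split => //.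
- by have [_ oc _ _ _] := Ac _ cA.
- exact: chart_codP.
- exact: Fs.
Qed.

Lemma smooth_at_change A c c' x F : is_atlas A -> A c -> A c' -> chart_dom c x ->
  chart_dom c' x -> smooth_at c x F -> smooth_at c' x F.
Proof.
move=> [Ac _ At] cA c'A cx c'x [W [oW Wx Wc Fs]].
have [cc cc'] := (Ac _ cA, Ac _ c'A).
have nW : nbhs x (fun y => W (chart_map c y)).
  have [_ _ cn _ _] := cc; apply: (cn _ cx W); exact: open_nbhs_nbhs.
have [V [oV Vx VP]] := nbhs_open_sub (filterI (chart_cod_nbhs cc' c'x)
  (chart_inv_near cc' c'x (filterI (chart_dom_nbhs cc cx) nW))).
exists V; split => //; first by move=> z /VP[].
have E z : V z -> (F \o chart_inv c') z = (F \o chart_inv c) (\row_i chart_map c (chart_inv c' z) 0 i).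
  move=> /VP[_ [cz _]] /=; rewrite -[in LHS](chart_mapK cc cz); congr (F (chart_inv c _)).
  by apply/rowP => i; rewrite mxE.
apply: (eq_smooth oV E).
apply: (smooth_comp (f := fun i z => chart_map c (chart_inv c' z) 0 i) oV oW) => //.
- move=> i; apply: smooth_sub (At c' c c'A cA i) => z /VP[c'z [cz _]].
  exists (chart_inv c' z); last by case: (chart_invP cc' c'z).
  by split => //; case: (chart_invP cc' c'z).
- move=> z /VP[_ [_ Wz]]; rewrite (_ : \row_i _ = chart_map c (chart_inv c' z)) //.
  by apply/rowP => i; rewrite mxE.
Qed.

Lemma smooth_fun_locally A F : is_atlas A ->
  (forall x, exists c, [/\ A c, chart_dom c x & smooth_at c x F]) -> smooth_fun A F.
Proof.
move=> aA FP c cA; have [Ac _ _] := aA; apply: smooth_locally => z cz.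
have [cx cxz] := chart_invP (Ac _ cA) cz.
have [c' [c'A c'x F'x]] := FP (chart_inv c z).
have [W [oW Wx _ Fs]] := smooth_at_change aA c'A cA c'x cx F'x.
by exists W, (F \o chart_inv c); split => //; rewrite -cxz.
Qed.

(** Cut [g] off inside the chart and extend by zero. The preimage of the compact support is compact,
    hence closed because the manifold is Hausdorff, so the extension vanishes near every point
    outside the chart. *)
Lemma chart_extend A c x (W : set 'rV[R]_k) g : is_manifold A -> A c -> chart_dom c x ->
  open W -> W (chart_map c x) -> smooth W g ->
  exists2 F, smooth_fun A F & \forall y \near x, F y = g (chart_map c y).
Proof.
move=> [hM _ aA] cA cx oW Wx gs; have [Ac Acov _] := aA.
have cc := Ac _ cA; have [od oc cn ic cK] := cc.
have oWc : open (W `&` chart_cod c) by exact: openI.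
have [||G [K [cK' KW Gs G0 Gg]]] := @smooth_cutoff R k _ (chart_map c x) g oWc _ (smooth_sub _ gs).
- by split => //; exact: chart_codP.
- by move=> z [].
pose F y := if `[< chart_dom c y >] then G (chart_map c y) else 0.
have FE y : chart_dom c y -> F y = G (chart_map c y) by move=> cy; rewrite /F asboolT.
exists F; last first.
  apply: filterS2 (chart_dom_nbhs cc cx) (cn _ cx _ Gg) => y cy Gy.
  by rewrite FE.
apply: smooth_fun_locally => // y; have [cy|ncy] := pselect (chart_dom c y).
  exists c; split => //; exists (chart_cod c); split => //; first exact: chart_codP.
  apply: (eq_smooth oc (g := G)); last exact: smooth_sub Gs.
  by move=> z /(chart_invP cc)[cz zE] /=; rewrite FE // zE.
have [c' c'A c'y] := Acov y; exists c'; split => //.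
have cI : closed (chart_inv c @` K).
  apply: compact_closed => //; apply: continuous_compact => //.
  by apply: continuous_in_subspaceT => z /set_mem/KW[_ /ic].
apply: (smooth_at_near (F' := fun=> 0)); [exact: Ac|by []| |]; last first.
  have [_ oc' _ _ _] := Ac _ c'A; exists (chart_cod c'); split => //.
    exact: chart_codP.
  exact: smooth_cst.
have : nbhs y (~` (chart_inv c @` K)).
  apply: open_nbhs_nbhs; split; first exact: closed_openC.
  by move=> [z /KW[_ /(chart_invP cc)[cz _]] zy]; apply: ncy; rewrite -zy.
apply: filterS => t nt; rewrite /F; case: asboolP => // ct.
by apply: G0 => Kt; apply: nt; exists (chart_map c t) => //; exact: cK.
Qed.

End charts.

Section stratum_atlas.
Variables (R : realType) (X : fspace R) (k : nat).
Local Notation T := (stratum X k).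
Implicit Type A : set (chart R T k).

Lemma germ_pull_of (x : T) (h : X -> R) :
  germ_pull (i := fun y : T => val y) (germ_of (val x) h) = germ_of x (fun y => h (val y)).
Proof. by apply/germ_ofE; exact: (near_set_type (germ_ofK (val x) h)). Qed.

(** Frees the germ condition from quotients: the last three clauses say that restriction of germs
    lands in smooth germs, is injective, and is surjective. *)
Lemma stratum_atlasP A : is_stratum_atlas A <-> [/\ is_manifold A,
  forall (x : T) phi, @fs_fun R X phi ->
    exists2 F, smooth_fun A F & \forall y \near x, phi (val y) = F y,
  forall (x : T) phi psi, @fs_fun R X phi -> @fs_fun R X psi ->
    (\forall y \near x, phi (val y) = psi (val y)) -> \forall y \near val x, phi y = psi y &
  forall (x : T) F, smooth_fun A F ->
    exists2 phi, @fs_fun R X phi & \forall y \near x, phi (val y) = F y].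
Proof.
split=> [[mA gA]|[mA G1 G2 G3]]; split => //.
- move=> x phi Cphi; have [gm _ _] := gA x.
  have [|F Fs] := gm (germ_of (val x) phi); first by exists phi.
  by rewrite germ_pull_of => /esym/germ_ofE; exists F.
- move=> x phi psi Cphi Cpsi pp; have [_ gi _] := gA x.
  apply/germ_ofE; apply: gi; try by apply/mem_set; [exists phi|exists psi].
  + by apply/mem_set; exists phi.
  + by apply/mem_set; exists psi.
  by rewrite !germ_pull_of; apply/germ_ofE.
- move=> x F Fs; have [_ _ gs] := gA x.
  have [|_ [phi Cphi <-]] := gs (germ_of x F); first by exists F.
  by rewrite germ_pull_of => /germ_ofE; exists phi.
move=> x; split.
- move=> _ [phi Cphi <-]; have [F Fs pF] := G1 x _ Cphi.
  by exists F => //; rewrite germ_pull_of; apply/germ_ofE; apply: filterS pF.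
- move=> u v /set_mem[phi Cphi <-] /set_mem[psi Cpsi <-].
  by rewrite !germ_pull_of => /germ_ofE pp; apply/germ_ofE; exact: G2 pp.
- move=> _ [F Fs <-]; have [phi Cphi pF] := G3 x _ Fs.
  by exists (germ_of (val x) phi); [exists phi|rewrite germ_pull_of; apply/germ_ofE].
Qed.

End stratum_atlas.

Section pullback_atlas.
Variables (R : realType) (N M : topologicalType) (k : nat) (iota : N -> M).
Hypotheses (iota_c : continuous iota) (iota_inj : injective iota)
  (iota_emb : forall t (B : set N), nbhs t B -> exists2 C, nbhs (iota t) C & forall s, C (iota s) -> B s)
  (iota_open : forall t (B : set N), nbhs t B -> nbhs (iota t) (iota @` B)).
Variable A : set (chart R M k).

(** The restriction of an atlas along an open embedding. The inverse of a chart is a total function,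
    of which only the values on the codomain can be prescribed. *)
Definition pullback_atlas : set (chart R N k) := [set e | exists c, [/\ A c,
  chart_dom e = iota @^-1` chart_dom c, chart_map e = chart_map c \o iota &
  forall z, chart_cod e z -> iota (chart_inv e z) = chart_inv c z]].

Hypothesis mA : is_manifold A.

Lemma pullback_atlas_cover (t : N) : exists e c, [/\ A c, pullback_atlas e,
  chart_dom c (iota t), chart_dom e = iota @^-1` chart_dom c & chart_map e = chart_map c \o iota].
Proof.
have [_ _ [Ac Acov _]] := mA; have [c cA ct] := Acov (iota t).
pose D := iota @^-1` chart_dom c.
(* Outside the image of the chart the inverse takes the default value [t]. *)
have inv z : exists s, (exists2 u, D u & chart_map c (iota u) = z) -> iota s = chart_inv c z.
  have [[u Du <-]|nz] := pselect (exists2 u, D u & chart_map c (iota u) = z).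
    by exists u => _; rewrite chart_mapK //; exact: Ac.
  by exists t => /nz.
have [i iP] := choice inv.
pose e := Chart D (chart_map c \o iota) i.
have eP z : chart_cod e z -> iota (chart_inv e z) = chart_inv c z.
  by move=> [u Du <-]; apply: iP; exists u.
by exists e, c; split => //; exists c.
Qed.

Lemma pullback_is_manifold : is_manifold pullback_atlas.
Proof.
have [hM scM [Ac Acov At]] := mA.
have eI e : pullback_atlas e -> exists c, [/\ A c, is_chart c,
    forall t, chart_dom e t <-> chart_dom c (iota t),
    forall t, chart_map e t = chart_map c (iota t) &
    forall z, chart_cod e z -> iota (chart_inv e z) = chart_inv c z].
  by move=> [c [cA -> -> cI]]; exists c; split => //; exact: Ac.
have chP e : pullback_atlas e -> is_chart e.
  move=> eA; have [c [cA cc ed em ei]] := eI _ eA; have [od oc cn ic cK] := cc.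
  have emK t : chart_dom e t -> chart_inv e (chart_map e t) = t.
    move=> et; apply: iota_inj; rewrite ei; last by exists t.
    by rewrite em cK //; apply/ed.
  have enb t : chart_dom e t -> nbhs t (chart_dom e).
    move=> /ed ct; apply: filterS (continuous_near (@iota_c t) (chart_dom_nbhs cc ct)) => s cs.
    exact/ed.
  have codn z : chart_cod e z -> nbhs z (chart_cod e).
    move=> [t et <-]; have ct := (ed t).1 et; rewrite em.
    apply: filterS2 (chart_cod_nbhs cc ct) (chart_inv_near cc ct (iota_open (enb _ et))).
    move=> w cz [s es sz]; exists s => //; rewrite em sz.
    by case: (chart_invP cc cz).
  split => //.
  - exact: nbhs_is_open.
  - move=> t et; have -> : chart_map e = chart_map c \o iota by apply/funext => s; exact: em.
    by apply: continuous_comp; [exact: iota_c|apply: cn; exact/ed].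
  - move=> z ez B nB; have [C nC CB] := iota_emb nB.
    have [t et tz] := ez; have ct := (ed t).1 et.
    have zE : z = chart_map c (iota t) by rewrite -tz em.
    have {}nC : nbhs (iota t) C by rewrite ei // zE chart_mapK in nC.
    have nz : nbhs z (fun z => C (chart_inv c z)) by rewrite zE; exact: chart_inv_near.
    by apply: filterS2 (codn _ ez) nz => z' ez' Cz'; apply: CB; rewrite ei.
split.
- move=> s t st; apply: iota_inj; apply: hM => B C nB nC.
  have [x [Bx Cx]] := st _ _ (iota_c nB) (iota_c nC).
  by exists (iota x).
- exact: second_countable_embedding iota_emb iota_c scM.
split => //.
- move=> t; have [e [c [cA eA ct ed _]]] := pullback_atlas_cover t.
  by exists e => //; rewrite ed.
move=> e e' eA e'A i.
have [c [cA cc ed em ei]] := eI _ eA; have [c' [c'A cc' e'd e'm e'i]] := eI _ e'A.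
apply: smooth_locally => z [t [et e't] <-].
have ct := (ed t).1 et; have ec := chP _ eA.
have [V [oV Vz VP]] := nbhs_open_sub (filterI (chart_cod_nbhs ec et)
  (chart_inv_near ec et (chart_dom_nbhs (chP _ e'A) e't))).
exists V, (fun z => chart_map c' (chart_inv c z) 0 i); split => //.
  apply: smooth_sub (At _ _ cA c'A i) => z0 /VP[ez0 e'z0].
  have [dz mz] := chart_invP ec ez0.
  exists (iota (chart_inv e z0)); first by split; [exact/ed|exact/e'd].
  by rewrite -em.
by move=> z0 /VP[ez0 e'z0]; rewrite e'm ei.
Qed.

Lemma pullback_smooth_fun F : smooth_fun A F -> smooth_fun pullback_atlas (F \o iota).
Proof.
move=> Fs e eA; have [c [cA ed em ei]] := eA.
have [_ _ [/(_ _ eA)[_ oe _ _ _] _ _]] := pullback_is_manifold.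
apply: (eq_smooth oe (g := F \o chart_inv c)); first by move=> z ez /=; rewrite ei.
apply: smooth_sub (Fs _ cA) => z [t et <-]; rewrite em; apply: chart_codP.
by move: et; rewrite ed.
Qed.

Lemma pullback_smooth_extend F (t : N) : smooth_fun pullback_atlas F ->
  exists2 G, smooth_fun A G & \forall s \near t, G (iota s) = F s.
Proof.
move=> Fs; have mA' := pullback_is_manifold.
have [e [c [cA eA ct ed em]]] := pullback_atlas_cover t.
have et : chart_dom e t by rewrite ed.
have [_ _ [/(_ _ eA) ce _ _]] := mA'; have [_ oe _ _ _] := ce.
have [||G Gs GF] := @chart_extend _ _ _ A c (iota t) (chart_cod e) (F \o chart_inv e) mA cA ct oe.
- by exists t => //; rewrite em.
- exact: Fs.
exists G => //; apply: filterS2 (continuous_near (@iota_c t) GF) (chart_dom_nbhs ce et) => s /= -> es.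
have -> : chart_map c (iota s) = chart_map e s by rewrite em.
by rewrite chart_mapK.
Qed.

End pullback_atlas.

Lemma second_countable_rV (R : realType) n : @second_countable 'rV[R]_n.
Proof.
pose q2r (q : 'rV[rat]_n) : 'rV[R]_n := \row_i ratr (q 0 i).
exists [set ball (q2r qr.1) (ratr qr.2 : R) | qr in [set qr : 'rV[rat]_n * rat | 0 < qr.2]].
  by apply: sub_countable (card_image_le _ _) _; exact: countableP.
split; first by move=> _ [[q r] /= r0 <-]; apply: ball_open; rewrite ltr0q.
move=> x V /nbhs_ballP[e /= e0 eV].
have [r /andP[r0 re]] : exists r : rat, (0 < r) && (ratr r < e / 2).
  have [|r] := @rat_in_itvoo R 0 (e / 2); first by rewrite divr_gt0.
  by rewrite in_itv /= => /andP[r0 re]; exists r; rewrite -(ltr0q R) r0 re.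
have qx i : exists q : rat, `|ratr q - x 0 i| < ratr r :> R.
  have [|q] := @rat_in_itvoo R (x 0 i - ratr r) (x 0 i + ratr r).
    by rewrite ltrD2l (@lt_trans _ _ 0) // ?oppr_lt0 ltr0q.
  by rewrite in_itv /= => h; exists q; rewrite ltr_distl.
have [q qP] := choice qx.
have xq : `|q2r (\row_i q i) - x| < ratr r.
  rewrite {1}/Num.norm /= mx_normrE; apply/bigmax_ltP; split=> [|[i j] _ /=].
    by rewrite ltr0q.
  by rewrite ord1 !mxE.
exists (ball (q2r (\row_i q i)) (ratr r)).
  split; first by exists (\row_i q i, r).
  by rewrite -ball_normE.
move=> z; rewrite -ball_normE /= => zq; apply: eV; rewrite -ball_normE /=.
have := ler_distD (q2r (\row_i q i)) x z; move: zq xq; rewrite [`|_ - x|]distrC.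
move=> h1 h2 /le_lt_trans; apply; rewrite [ltRHS]splitr ltrD //; exact: lt_trans re.
Qed.

Section open_subspace_atlas.
Variables (R : realType) (X : fspace R) (U : set X) (k : nat).
Hypotheses (dX : is_differential_space X) (oU : open U).
Local Notation N := (stratum (subfspace U) k).
Local Notation M := (stratum X k).

Let iota_in (t : N) : val (val t) \in M.
Proof.
apply/mem_set; have : stratum (subfspace U) k (val t) by exact: set_mem (valP t).
by move: (val t) => y; rewrite stratum_open_subfspace.
Qed.

Let iota (t : N) : M := exist _ (val (val t)) (iota_in t).

Let iota_c : continuous iota.
Proof.
move=> t; apply: continuous_set_type.
apply: (@continuous_comp _ _ _ (fun t : N => val t) (fun u : U => val u)); exact: val_continuous.
Qed.

Let iota_inj : injective iota.
Proof. by move=> s t /(congr1 val)/= st; do 2!apply: val_inj. Qed.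

Let iota_emb t (B : set N) : nbhs t B -> exists2 C, nbhs (iota t) C & forall s, C (iota s) -> B s.
Proof.
move=> /nbhs_set_typeP[C /nbhs_set_typeP[D nD DC] CB].
exists (fun m : M => D (val m)); first exact: val_continuous.
by move=> s Ds; apply: CB; apply: DC.
Qed.

Let iota_open t (B : set N) : nbhs t B -> nbhs (iota t) (iota @` B).
Proof.
move=> /nbhs_set_typeP[C /nbhs_set_typeP[D nD DC] CB].
have nU : nbhs (val (val t)) U by apply: open_nbhs_nbhs; split => //; exact: set_mem (valP (val t)).
have nDU : nbhs (val (iota t)) (D `&` U) by exact: filterI.
apply: filterS (near_set_type (a := iota t) nDU) => m [Dm Um].
have mN : (exist _ (val m) (mem_set Um) : U) \in N.
  by apply/mem_set; rewrite stratum_open_subfspace //; exact: set_mem (valP m).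
exists (exist _ (exist _ (val m) (mem_set Um) : U) mN); last exact: val_inj.
by apply: CB; apply: DC.
Qed.

(** The stratum of [U] embeds as an open subset in the stratum of [X], so the atlas pulls back; the
    conditions on germs transfer because functions on [U] are locally restrictions of functions on
    [X]. *)
Lemma open_subspace_atlas : (exists A, @is_stratum_atlas R X k A) ->
  exists A, @is_stratum_atlas R (subfspace U) k A.
Proof.
move=> [A /stratum_atlasP[mA G1 G2 G3]]; exists (pullback_atlas iota A).
apply/stratum_atlasP; split.
- exact: pullback_is_manifold.
- move=> t phi /subfspace_funP/(_ (val t))[h Ch ph].
  have [F Fs hF] := G1 (iota t) _ Ch.
  exists (F \o iota); first exact: pullback_smooth_fun.
  apply: filterS2 (near_set_type ph) (continuous_near (@iota_c t) hF) => s -> hs.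
  exact: hs.
- move=> t phi psi /subfspace_funP/(_ (val t))[h Ch ph] /subfspace_funP/(_ (val t))[g Cg pg] pp.
  have hg : \forall s \near t, h (val (iota s)) = g (val (iota s)).
    by apply: filterS3 (near_set_type ph) (near_set_type pg) pp => s <- <-.
  have hg' : \forall m \near iota t, h (val m) = g (val m).
    by apply: filterS (iota_open hg) => _ [s sP <-].
  have := G2 _ _ _ Ch Cg hg' => hg''.
  have hgU : \forall y \near val t, h (val y) = g (val y) := near_set_type (hg'' : \forall x \near val (val t), h x = g x).
  by apply: filterS3 ph pg hgU => s -> ->.
- move=> t F Fs; have [G Gs GF] := pullback_smooth_extend iota_c iota_inj iota_emb iota_open mA t Fs.
  have [phi Cphi pG] := G3 (iota t) _ Gs.
  exists (fun y => phi (val y)); first by apply: (@subfspace_val_morphism R X U).2.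
  by apply: filterS2 GF (continuous_near (@iota_c t) pG) => s <- <-.
Qed.

End open_subspace_atlas.

Section euclidean_atlas.
Variables (R : realType) (n : nat).

Lemma euclidean_atlas_empty k : k != n -> @is_stratum_atlas R (euclidean R n) k set0.
Proof.
move=> kn; have e0 (t : stratum (euclidean R n) k) : False.
  have : stratum (euclidean R n) k (val t) by exact: set_mem (valP t).
  by move: (val t) => y; rewrite euclidean_stratum (negbTE kn).
apply/stratum_atlasP; split; try by move=> t; case: (e0 t).
split; first by move=> t; case: (e0 t).
  by exists set0; [exact: countable0|split => // t; case: (e0 t)].
by split => // t; case: (e0 t).
Qed.

Local Notation E := (stratum (euclidean R n) n).

Let inE (z : 'rV[R]_n) : z \in E.
Proof. by apply/mem_set; rewrite euclidean_stratum eqxx. Qed.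

Let to_E (z : 'rV[R]_n) : E := exist _ z (inE z).

Definition euclidean_chart : chart R E n := Chart setT (fun t : E => val t) to_E.

Lemma euclidean_chart_cod : chart_cod euclidean_chart = setT.
Proof. by apply/seteqP; split => // z _; exists (to_E z). Qed.

Lemma to_E_continuous : continuous to_E.
Proof. by move=> z; apply: continuous_set_type. Qed.

Lemma euclidean_near (t : E) (P : 'rV[R]_n -> Prop) :
  (\forall s \near t, P (val s)) -> \forall z \near (val t : 'rV[R]_n), P z.
Proof.
move=> tP; have /(continuous_near (@to_E_continuous (val t))) : \forall s \near to_E (val t), P (val s).
  by rewrite (_ : to_E (val t) = t) //; exact: val_inj.
by [].
Qed.

Lemma euclidean_smooth_fun F : smooth_fun [set euclidean_chart] F <-> smooth setT (fun z => F (to_E z)).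
Proof.
split=> [/(_ _ erefl)|Fs c ->]; last by rewrite euclidean_chart_cod.
by rewrite euclidean_chart_cod.
Qed.

Lemma euclidean_atlas_full : @is_stratum_atlas R (euclidean R n) n [set euclidean_chart].
Proof.
have to_EK (t : E) : to_E (val t) = t by exact: val_inj.
apply/stratum_atlasP; split.
- split.
  + by apply: hausdorff_set_type; exact: norm_hausdorff.
  + apply: (second_countable_embedding (f := fun t : E => val t)) (@second_countable_rV R n).
      by move=> s B /nbhs_set_typeP.
    exact: val_continuous.
  + split.
    * move=> _ ->; split => //; rewrite ?euclidean_chart_cod; try exact: openT.
      - by move=> t _; exact: val_continuous.
      - by move=> z _; exact: to_E_continuous.
      - by move=> t _; exact: to_EK.
    * by move=> t; exists euclidean_chart.
    * move=> _ _ -> -> i; exact: smooth_coord.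
- move=> t phi phis; exists (fun s => phi (val s)); last exact: near_all.
  exact/euclidean_smooth_fun.
- by move=> t phi psi _ _; exact: euclidean_near.
- move=> t F /euclidean_smooth_fun Fs; exists (fun z => F (to_E z)) => //.
  by apply: near_all => s; rewrite to_EK.
Qed.

End euclidean_atlas.

(** Chart coordinates are smooth germs on the stratum, hence restrictions of structure functions of
    [X]. These extensions off the stratum are what local retractions are built from. *)
Lemma stratum_coordinates (R : realType) (X : fspace R) k A c (t : stratum X k) :
  @is_stratum_atlas R X k A -> A c -> chart_dom c t ->
  exists phi : 'I_k -> X -> R, (forall i, fs_fun (phi i)) /\
    exists N, [/\ open N, N (val t) & forall s : stratum X k, N (val s) ->
      chart_dom c s /\ forall i, phi i (val s) = chart_map c s 0 i].
Proof.
move=> /stratum_atlasP[mA G1 G2 G3] cA ct.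
have [hM _ [Ac _ _]] := mA; have cc := Ac _ cA.
have Ph i : exists2 phi, @fs_fun R X phi & \forall s \near t, phi (val s) = chart_map c s 0 i.
  have [F Fs Fc] := @chart_extend _ _ _ A c t setT (fun z => z 0 i) mA cA ct openT I (@smooth_coord _ _ _ i).
  have [phi Cphi pF] := G3 t _ Fs; exists phi => //.
  by apply: filterS2 Fc pF => s <- <-.
have [phi phiP] := choice (fun i => (exists2P _ _).1 (Ph i)).
exists phi; split; first by move=> i; case: (phiP i).
have nt : \forall s \near t, forall i, phi i (val s) = chart_map c s 0 i.
  by apply: (@filter_forall _ _ (fun i s => phi i (val s) = chart_map c s 0 i) (nbhs t)) => i; case: (phiP i).
have /nbhs_set_typeP[N0 nN0 N0P] : nbhs t (fun s => chart_dom c s /\ forall i, phi i (val s) = chart_map c s 0 i).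
  by apply: filterI => //; exact: chart_dom_nbhs.
have [N [oN Nx NP]] := nbhs_open_sub nN0.
by exists N; split => // s /NP; exact: N0P.
Qed.

(** * Local retractions *)

Section retractions.
Variables (R : realType) (X : fspace R) (k : nat).
Hypothesis dX : is_differential_space X.

(* Unlike in [local_retraction], the retraction is a total function, of which
   only the restriction to [D] matters. *)
Definition retraction_on (D : set X) (r : X -> X) : Prop :=
  [/\ open D, forall u, D u -> D (r u) /\ stratum X k (r u),
      forall u, D u -> stratum X k u -> r u = u,
      forall u, D u -> {for u, continuous r} &
      forall u phi, D u -> fs_fun phi -> fs_near u (phi \o r)].

Lemma retraction_on_shrink D r (P : set X) x : retraction_on D r -> D x -> stratum X k x ->
  nbhs x P -> exists D', [/\ retraction_on D' r, D' x & D' `<=` P].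
Proof.
move=> [oD rD rid rc rs] Dx xk /nbhs_open_sub[V [oV Vx VP]].
(* Asking for [r u] in [V] as well keeps the smaller domain stable under [r]. *)
pose D' := [set u | D u /\ V u /\ V (r u)].
exists D'; split; last by move=> u [_ [/VP]].
  split.
  - apply: nbhs_is_open => u [Du [Vu Vru]].
    have h1 : nbhs u D by exact: open_nbhs_nbhs.
    have h2 : nbhs u V by exact: open_nbhs_nbhs.
    have h3 : nbhs (r u) V by exact: open_nbhs_nbhs.
    by apply: filterS3 h1 h2 (continuous_near (rc _ Du) h3).
  - move=> u [Du [Vu Vru]]; have [Dr kr] := rD _ Du.
    by split => //; split => //; rewrite (rid _ Dr kr).
  - by move=> u [Du _]; exact: rid.
  - by move=> u [Du _]; exact: rc.
  - by move=> u phi [Du _]; exact: rs.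
by split => //; rewrite rid.
Qed.

(** Let [Phi] extend the chart coordinates to [X], and follow it by the inverse chart. On the
    stratum near [x] this is the identity, and [psi \o r] is a smooth function of the components of
    [Phi]. *)
Lemma retraction_on_exists x : (exists A, @is_stratum_atlas R X k A) -> stratum X k x ->
  exists D r, retraction_on D r /\ D x.
Proof.
move=> [A sA] xk; have [mA G1 G2 G3] := (stratum_atlasP A).1 sA.
have [hM _ aA] := mA; have [Ac Acov _] := aA.
pose t : stratum X k := exist _ x (mem_set xk).
have [c cA ct] := Acov t; have cc := Ac _ cA.
have [phi [Cphi [N [oN Nx NP]]]] := stratum_coordinates sA cA ct.
pose Phi (u : X) : 'rV[R]_k := \row_i phi i u.
have Phic u : {for u, continuous Phi}.
  by apply: continuous_row_fun => i; apply: (fs_near_continuous dX); exact: fs_fun_near.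
have NS (s : stratum X k) : N (val s) -> Phi (val s) = chart_map c s /\ chart_dom c s.
  by move=> /NP[cs phis]; split => //; apply/rowP => i; rewrite mxE.
pose r (u : X) : X := val (chart_inv c (Phi u)).
have rid u : N u -> stratum X k u -> r u = u.
  move=> Nu uk; have [] := NS (exist _ u (mem_set uk)) Nu; rewrite /r /= => -> cu.
  by rewrite chart_mapK.
have [_ oc _ ic _] := cc.
have rc u : chart_cod c (Phi u) -> {for u, continuous r}.
  move=> cu; apply: (@continuous_comp _ _ _ (chart_inv c \o Phi) (fun s : stratum X k => val s)).
    by apply: continuous_comp => //; exact: ic.
  exact: val_continuous.
(* The last condition gives [r (r u) = r u], whence [r] maps [D] into itself. *)
pose D := [set u | N u /\ chart_cod c (Phi u) /\ N (r u)].
have Phx : Phi x = chart_map c t by have [] := NS t Nx.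
exists D, r; split; last first.
  split => //; rewrite rid // Phx; split => //; exact: chart_codP.
split.
- apply: nbhs_is_open => u [Nu [cu Nru]].
  have h1 : nbhs u N by exact: open_nbhs_nbhs.
  have h2 : nbhs (Phi u) (chart_cod c) by exact: open_nbhs_nbhs.
  have h3 : nbhs (r u) N by exact: open_nbhs_nbhs.
  by apply: filterS3 h1 (continuous_near (Phic u) h2) (continuous_near (rc _ cu) h3).
- move=> u [Nu [cu Nru]]; have rk : stratum X k (r u) by exact: set_mem (valP _).
  have [rP rcd] := NS _ Nru.
  have rru : r (r u) = r u by exact: rid.
  split => //; split => //; split; last by rewrite rru.
  by rewrite /r rP; exact: chart_codP.
- by move=> u [Nu _]; exact: rid.
- by move=> u [_ [cu _]]; exact: rc.
- move=> u psi [_ [cu _]] Cpsi; have [cs csE] := chart_invP cc cu.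
  have [F Fs pF] := G1 (chart_inv c (Phi u)) _ Cpsi.
  have [W [oW Wu Wc FW]] := smooth_at_near cc cs pF (smooth_fun_at aA cA cs Fs).
  rewrite csE in Wu.
  apply: (fs_near_smooth dX oW FW (f := phi)) => // i; exact: fs_fun_near.
Qed.

Lemma retraction_on_local D r x (rD : retraction_on D r) (Dx : D x) :
  exists l : local_retraction k x, lr_dom l = D /\
    forall u, val (@lr_map _ _ _ _ l u) = r (val u).
Proof.
have [oD rDk rid rc rs] := rD.
have im (u : subfspace D) : r (val u) \in D `&` stratum X k.
  by apply/mem_set; apply: rDk; exact: set_mem (valP u).
pose f (u : subfspace D) : subfspace (D `&` stratum X k) := exist _ (r (val u)) (im u).
have fm : is_morphism f.
  apply: morphism_subfspace => //; first exact: subfspace_ds.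
  apply: is_morphism_near; first exact: subfspace_ds.
    move=> u; apply: (@continuous_comp _ _ _ (fun u : D => val u) r); first exact: val_continuous.
    by apply: rc; exact: set_mem (valP u).
  move=> u phi Cphi; have Du : D (val u) by exact: set_mem (valP u).
  exact: (morphism_near (x := u) (@subfspace_val_morphism R X D) (rs _ _ Du Cphi)).
have fid (u : subfspace D) : stratum X k (val u) -> val (f u) = val u.
  by move=> uk; apply: rid => //; exact: set_mem (valP u).
by exists (LocalRetraction (conj oD Dx) fm fid).
Qed.

Lemma local_retraction_on x (l : local_retraction k x) :
  exists r, retraction_on (lr_dom l) r /\ forall u, r (val u) = val (@lr_map _ _ _ _ l u).
Proof.
case: l => D f [oD Dx] fm fid /=.
pose r (u : X) : X := if pselect (D u) is left Du then val (f (exist _ u (mem_set Du))) else u.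
have rE (u : subfspace D) : r (val u) = val (f u).
  rewrite /r; case: pselect => [Du|]; last by case; exact: set_mem (valP u).
  by congr (val (f _)); exact: val_inj.
have DE u (Du : D u) : exists v : subfspace D, val v = u by exists (exist _ u (mem_set Du)).
exists r; split => //; split => //.
- move=> u /DE[v <-]; rewrite rE; exact: set_mem (valP (f v)).
- by move=> u /DE[v <-] uk; rewrite rE fid.
- move=> u /DE[v <-] B nB.
  have : nbhs v (fun v => B (r (val v))).
    have fc : {for v, continuous (fun v => val (f v))}.
      apply: (@continuous_comp _ _ _ f (fun w : D `&` stratum X k => val w)); last exact: val_continuous.
      exact: fm.1.
    have nB' : nbhs (val (f v)) B by rewrite -rE.
    apply: (@filterS _ (nbhs v) _ (fun w => B (val (f w)))); first by move=> w; rewrite rE.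
    exact: (continuous_near fc nB').
  by move/(near_open_subfspace (P := fun x => B (r x)) oD).
- move=> u phi /DE[v <-] Cphi; apply: (fs_near_open_subfspace oD v (phi \o r)).1.
  apply: (eq_fs_near (g := (phi \o (fun w : subfspace (D `&` stratum X k) => val w)) \o f)).
    by apply: near_all => w /=; rewrite rE.
  by apply: fs_fun_near; apply: fm.2; apply: (@subfspace_val_morphism R X _).2.
Qed.

End retractions.

(** * The product of a stratifold with Euclidean space *)

Section product.
Variables (R : realType) (X : fspace R) (n : nat).
Hypotheses (dX : is_differential_space X)
  (aX : forall k, exists A, @is_stratum_atlas R X k A)
  (sX : forall x, exists k, stratum X k x).

Local Notation P := (X * 'rV[R]_n)%type.

Definition prod_gens : set (P -> R) := [set f |
  (exists2 phi, @fs_fun R X phi & f = fun p : P => phi p.1) \/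
  exists i, f = fun p : P => p.2 0 i].

Lemma prod_gens_continuous f : prod_gens f -> continuous f.
Proof.
move=> [[phi Cphi ->]|[i ->]] p.
  apply: (@continuous_comp _ _ _ (fun p : P => p.1) phi); first exact: cvg_fst.
  by apply: (fs_near_continuous dX); exact: fs_fun_near.
apply: (@continuous_comp _ _ _ (fun p : P => p.2) (fun v : 'rV[R]_n => v 0 i)); first exact: cvg_snd.
exact: coord_continuous.
Qed.

Lemma prod_gen_ds : is_differential_space (gen_fspace prod_gens).
Proof. exact: gen_ds prod_gens_continuous. Qed.

Lemma fst_morphism : @is_morphism R (gen_fspace prod_gens) X fst.
Proof.
split; first by move=> p; exact: cvg_fst.
by move=> phi Cphi; apply: smgen_sub; left; exists phi.
Qed.

Lemma snd_morphism : @is_morphism R (gen_fspace prod_gens) (euclidean R n) snd.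
Proof.
split; first by move=> p; exact: cvg_snd.
move=> phi Cphi p; exists n, (fun i (p : P) => p.2 0 i), phi; split => //; first by move=> i; right; exists i.
by apply: near_all => q /=; congr phi; apply/rowP => i; rewrite mxE.
Qed.

Let lsub_continuous k l : continuous (fun z : 'rV[R]_(k + l) => lsubmx z : 'rV[R]_k).
Proof.
move=> z; apply: continuous_row => i; apply: (near_eq_continuous (g := fun z : 'rV[R]_(k + l) => z 0 (lshift l i))).
  by apply: near_all => y; rewrite mxE.
exact: coord_continuous.
Qed.

Let rsub_continuous k l : continuous (fun z : 'rV[R]_(k + l) => rsubmx z : 'rV[R]_l).
Proof.
move=> z; apply: continuous_row => i; apply: (near_eq_continuous (g := fun z : 'rV[R]_(k + l) => z 0 (rshift k i))).
  by apply: near_all => y; rewrite mxE.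
exact: coord_continuous.
Qed.

(** On a product of strata every generator is smooth in charts. For the retraction condition, [F] is
    near the point a smooth function of finitely many generators, and each of these is invariant
    under [r] after shrinking its domain. *)
Lemma smgen_prod : smgen prod_gens `<=` @fs_fun R (prod_fspace X (euclidean R n)).
Proof.
move=> F FG; split=> [k l|k l x y xk yl].
  have [A sA] := aX k; have [mA G1 G2 G3] := (stratum_atlasP A).1 sA.
  have [ln|ln] := eqVneq l n; last first.
    exists A, set0; split => //; first exact: euclidean_atlas_empty.
    by move=> _ [c [d [_ []]]].
  subst l; exists A, [set @euclidean_chart R n]; split => //; first exact: euclidean_atlas_full.
  move=> _ [c [_ [cA -> ->]]]; have [_ _ aA] := mA; have [Ac _ _] := aA.
  have cc := Ac _ cA; apply: smooth_locally => z [[s t] [/= cs _] <-] {z}.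
  set z := row_mx _ _.
  pose inv (z' : 'rV[R]_(k + n)) : P := (val (chart_inv c (lsubmx z')), rsubmx z').
  have zl : lsubmx z = chart_map c s by rewrite row_mxKl.
  have iz : inv z = (val s, val t) by rewrite /inv zl chart_mapK // row_mxKr.
  have ic : {for z, continuous inv}.
    have i1 : {for z, continuous (fun z' : 'rV[R]_(k + n) => val (chart_inv c (lsubmx z')))}.
      apply: (@continuous_comp _ _ _ (fun z' : 'rV[R]_(k + n) => chart_inv c (lsubmx z')) (fun s : stratum X k => val s));
        last exact: val_continuous.
      apply: (@continuous_comp _ _ _ (fun z' : 'rV[R]_(k + n) => lsubmx z') (chart_inv c));
        first exact: lsub_continuous.
      by rewrite zl; have [_ _ _ ci _] := cc; apply: ci; exact: chart_codP.
    exact: cvg_pair i1 (@rsub_continuous k n z).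
  have [m [phi [g [phiG gs Fg]]]] := FG (val s, val t).
  have sm i : exists V, [/\ open V, V z & smooth V (phi i \o inv)].
    have [[psi Cpsi ->]|[j ->]] := phiG i; last first.
      exists setT; split => //; first exact: openT.
      by apply: (eq_smooth openT _ (smooth_coord _ (rshift k j))) => z' _; rewrite /= mxE.
    have [F0 F0s pF0] := G1 s _ Cpsi.
    have [W [oW Wc Wd Ws]] := smooth_at_near cc cs pF0 (smooth_fun_at aA cA cs F0s).
    have oV : open [set z' : 'rV[R]_(k + n) | W (lsubmx z')].
      by apply: open_comp oW => z' _; exact: lsub_continuous.
    exists [set z' | W (lsubmx z')]; split => //=; first by rewrite zl.
    have lE (z' : 'rV[R]_(k + n)) : lsubmx z' = \row_i z' 0 (lshift n i) by apply/rowP => i'; rewrite !mxE.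
    apply: (eq_smooth oV (g := fun z' => (fun w => psi (val (chart_inv c w))) (\row_i z' 0 (lshift n i)))).
      by move=> z' _; rewrite /= lE.
    apply: (smooth_comp (f := fun i z' => z' 0 (lshift n i)) (g := fun w => psi (val (chart_inv c w))) oV oW) => //.
      by move=> i'; exact: smooth_coord.
    by move=> z' /=; rewrite lE.
  have [V VP] := choice sm.
  have nV : \forall z' \near z, forall i, V i z'.
    apply: (@filter_forall _ _ V (nbhs z)) => i; have [oV Vz _] := VP i.
    exact: open_nbhs_nbhs.
  have Fi : \forall z' \near z, F (inv z') = g (\row_i phi i (inv z')).
    by apply: (continuous_near (P := fun p => F p = g (\row_i phi i p)) ic); rewrite iz.
  have [V0 [oV0 V0z V0P]] := nbhs_open_sub (filterI nV Fi).
  exists V0, (fun z' => g (\row_i phi i (inv z'))); split => //; last by move=> z' /V0P[].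
  apply: (smooth_comp (f := fun i => phi i \o inv) (g := g) oV0 openT) => // i.
  by have [_ _] := VP i; apply: smooth_sub => z' /V0P[].
have ln : l = n.
  by apply/eqP; apply: contraPT yl => ln; rewrite euclidean_stratum (negbTE ln).
subst l; have [m [phi [g [phiG gs Fg]]]] := FG (x, y).
have [[N Q] /= [nN nQ] NQ] := Fg.
have [A sA] := aX k; have [mA G1 G2 G3] := (stratum_atlasP A).1 sA.
have [D0 [r [rD0 D0x]]] := retraction_on_exists dX (aX k) xk.
(* A structure function and its composite with [r] agree on the stratum, and a germ at [x] is
   determined by its restriction to the stratum. *)
have nr : \forall u \near x, forall i v, phi i (r u, v) = phi i (u, v).
  apply: (@filter_forall _ _ (fun i u => forall v, phi i (r u, v) = phi i (u, v)) (nbhs x)) => i.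
  have [[psi Cpsi ->]|[j ->]] := phiG i; last by apply: near_all.
  have [_ _ rid _ /(_ _ _ D0x Cpsi)[h Ch rh]] := rD0.
  pose t : stratum X k := exist _ x (mem_set xk).
  suff : \forall u \near x, h u = psi u.
    by apply: filterS2 rh => u /= -> -> v.
  apply: (G2 t) => //; have [oD0 _ _ _ _] := rD0.
  have D0t : \forall s \near t, D0 (val s).
    by apply: (near_set_type (a := t)); exact: open_nbhs_nbhs.
  apply: filterS2 D0t (near_set_type (a := t) rh) => s D0s <- /=.
  by rewrite rid //; exact: set_mem (valP s).
have [D [rD Dx DN]] := retraction_on_shrink rD0 D0x xk (filterI nN nr).
have [V [oV Vy VQ]] := nbhs_open_sub nQ.
(* The stratum of dimension [n] is all of [R^n], so the identity of any open set is a retraction. *)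
have idV : @retraction_on R (euclidean R n) n V id.
  split => //; first by move=> u Vu; split => //; rewrite euclidean_stratum eqxx.
    by move=> u _ B.
  by move=> u phi' _ Cphi'; exact: fs_fun_near.
have [l [lD lr]] := retraction_on_local dX rD Dx.
have [l' [lV lr']] := retraction_on_local (@euclidean_ds R n) idV Vy.
exists l, l'; rewrite -lD in DN; have [_ rDk _ _ _] := rD; rewrite -lD in rDk.
move=> u v; rewrite lr lr' /=.
have Du : lr_dom l (val u) by exact: set_mem (valP u).
have Vv : V (val v) by rewrite -lV; exact: set_mem (valP v).
have [Nu ru] := DN _ Du; have [Nru _] := DN _ (rDk _ Du).1.
have E1 := NQ (val u, val v) (conj Nu (VQ _ Vv)); have E2 := NQ (r (val u), val v) (conj Nru (VQ _ Vv)).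
rewrite /= in E1 E2; rewrite E1 E2; congr g; apply/rowP => i; rewrite !mxE.
by rewrite ru.
Qed.

(** Near the given point [F (u, v)] equals [F (r u, v)], and on the product of strata [F] is smooth
    in chart coordinates. The coordinates of [r u] and of [v] are local structure functions of the
    generated product, so [F] is one too. *)
Lemma prod_smgen : @fs_fun R (prod_fspace X (euclidean R n)) `<=` smgen prod_gens.
Proof.
move=> F [F1 F2]; apply: (fs_nearP prod_gen_ds) => -[x y].
have [k xk] := sX x.
have yn : stratum (euclidean R n) n y by rewrite euclidean_stratum eqxx.
have [A [B [sA sB Fs]]] := F1 k n; have [l [l' Fll]] := F2 k n x y xk yn.
have [mA G1 G2 G3] := (stratum_atlasP A).1 sA; have [mB H1 H2 H3] := (stratum_atlasP B).1 sB.
have [r [rD rE]] := local_retraction_on l; have [s [sD sE]] := local_retraction_on l'.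
(* On the Euclidean side the retraction is the identity, since every point is in the stratum. *)
have {rE sE}FE u v : lr_dom l u -> lr_dom l' v -> F (u, v) = F (r u, v).
  move=> lu lv; have [u' uE] : exists w : subfspace (lr_dom l), val w = u by exists (exist _ u (mem_set lu)).
  have [v' vE] : exists w : subfspace (lr_dom l'), val w = v by exists (exist _ v (mem_set lv)).
  have := Fll u' v'; rewrite -rE -sE uE vE => ->; congr (F (_, _)); have [_ _ sid _ _] := sD.
  by apply: sid => //; rewrite euclidean_stratum eqxx.
pose t : stratum X k := exist _ x (mem_set xk).
pose t' : stratum (euclidean R n) n := exist _ y (mem_set yn).
have [_ _ aA] := mA; have [Ac Acov _] := aA; have [c cA ct] := Acov t; have cc := Ac _ cA.
have [_ _ aB] := mB; have [Bc Bcov _] := aB; have [d dB dt] := Bcov t'; have dd := Bc _ dB.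
have [phi [Cphi [N [oN Nx NP]]]] := stratum_coordinates sA cA ct.
have [eta [Ceta [Q [oQ Qy QP]]]] := stratum_coordinates sB dB dt.
pose e := prod_chart c d.
have es : smooth (chart_cod e) ((fun p => F (val p.1, val p.2)) \o chart_inv e).
  by apply: Fs; exists c, d.
have oe : open (chart_cod e).
  have -> : chart_cod e = (fun z => lsubmx z) @^-1` chart_cod c `&` (fun z => rsubmx z) @^-1` chart_cod d.
    apply/seteqP; split => [_ [[s1 s2] [/= cs ds] <-]|z [/= cz dz]].
      by split; rewrite /= ?row_mxKl ?row_mxKr; exact: chart_codP.
    have [ci cz'] := chart_invP cc cz; have [di dz'] := chart_invP dd dz.
    by exists (chart_inv c (lsubmx z), chart_inv d (rsubmx z)) => //=; rewrite cz' dz' hsubmxK.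
  have [_ oc _ _ _] := cc; have [_ od _ _ _] := dd.
  apply: openI; apply: open_comp => // z _; [exact: lsub_continuous|exact: rsub_continuous].
(* The chart coordinates of [(r u, v)], written as functions of [(u, v)] on the whole product. *)
pose theta (i : 'I_(k + n)) (p : P) : R :=
  match fintype.split i with inl a => phi a (r p.1) | inr b => eta b p.2 end.
have [oD rDk rid rc rs] := rD; have Dx : lr_dom l x by have [] := lr_nbhs l.
have thE u v (ru : stratum X k (r u)) (vn : stratum (euclidean R n) n v) : N (r u) -> Q v ->
    [/\ \row_i theta i (u, v) = row_mx (chart_map c (exist _ (r u) (mem_set ru))) (chart_map d (exist _ v (mem_set vn))),
      chart_dom c (exist _ (r u) (mem_set ru)) & chart_dom d (exist _ v (mem_set vn))].
  move=> Nu Qv; have [cu pu] := NP (exist _ (r u) (mem_set ru)) Nu.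
  have [dv ev] := QP (exist _ v (mem_set vn)) Qv; split => //.
  apply/rowP => i; rewrite !mxE /theta; case: (fintype.split i) => j; first exact: pu.
  exact: ev.
have st v : stratum (euclidean R n) n v by rewrite euclidean_stratum eqxx.
have rx : r x = x by exact: rid.
apply: (@eq_fs_near _ (gen_fspace prod_gens) _ _ (fun p =>
    ((fun p => F (val p.1, val p.2)) \o chart_inv e) (\row_i theta i p))).
  have nx : \forall u \near x, lr_dom l u /\ N (r u).
    apply: filterI; first by apply: open_nbhs_nbhs.
    by apply: (continuous_near (rc _ Dx)); rewrite rx; apply: open_nbhs_nbhs.
  have ny : \forall v \near y, lr_dom l' v /\ Q v.
    by apply: filterI; [exact: open_nbhs_nbhs (lr_nbhs l')|exact: open_nbhs_nbhs].
  exists (fun u => lr_dom l u /\ N (r u), fun v => lr_dom l' v /\ Q v) => // -[u v] /= [[lu Nu] [lv Qv]].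
  have [_ ru] := rDk _ lu; have [-> cu dv] := thE u v ru (st v) Nu Qv.
  by rewrite row_mxKl row_mxKr !chart_mapK //= FE.
apply: (fs_near_smooth prod_gen_ds oe es).
  move=> i; rewrite /theta; case: (fintype.split i) => j.
    have h := rs x (phi j) Dx (Cphi j).
    have h2 := @morphism_near R (gen_fspace prod_gens) X fst (x, y) (phi j \o r) fst_morphism h.
    exact: h2.
  have h := snd_morphism.2 (eta j) (Ceta j).
  exact: (@fs_fun_near R (gen_fspace prod_gens) (x, y) _ h).
have rxk : stratum X k (r x) by rewrite rx.
have Nrx : N (r x) by rewrite rx.
have [E cu dv] := thE x y rxk (st y) Nrx Qy; rewrite E.
by exists (exist _ (r x) (mem_set rxk), exist _ y (mem_set (st y))).
Qed.

Lemma prod_fspaceE : @fs_fun R (prod_fspace X (euclidean R n)) = smgen prod_gens.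
Proof. by apply/seteqP; split; [exact: prod_smgen|exact: smgen_prod]. Qed.

End product.

(** * Dimension through generic level sets *)

Section null_sets.
Variable R : realType.
Local Notation mu := (@lebesgue_measure R).

Lemma negligible_le (A : set R) :
  (forall e : R, 0 < e -> exists E, [/\ measurable E, A `<=` E & (mu E <= e%:E)%E]) ->
  mu.-negligible A.
Proof.
move=> AE; have [E EP] := choice (fun n : nat => AE n.+1%:R^-1 (ltac:(by rewrite invr_gt0))).
have mE : measurable (\bigcap_n E n) by apply: bigcapT_measurable => n; case: (EP n).
exists (\bigcap_n E n); split => //; last by move=> x Ax n _; have [_ AEn _] := EP n; exact: AEn.
apply/eqP; rewrite eq_le measure_ge0 andbT; apply/lee_addgt0Pr => e e0; rewrite add0e.
have [n ne] : exists n, n.+1%:R^-1 <= e.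
  exists (Num.truncn e^-1); rewrite -[leRHS]invrK lef_pV2 ?posrE ?invr_gt0 //.
  by rewrite ltW // truncnS_gt // invr_ge0 ltW.
have [mEn _ /le_trans] := EP n; move/(_ e%:E); rewrite lee_fin => /(_ ne); apply: le_trans.
by apply: le_measure; rewrite ?inE //; exact: bigcap_inf.
Qed.

(** Markov's inequality for a step function whose integral is the weighted sum of the interval
    lengths. *)
Lemma weighted_cover_measure (I : finType) (P : pred I) (w a b : I -> R) (delta : R) :
  (forall i, 0 <= w i) -> (forall i, a i <= b i) -> 0 < delta ->
  let E := [set c : R | delta <= \sum_(i | P i) w i * \1_(`[a i, b i]%classic) c] in
  measurable E /\ (mu E <= ((\sum_(i | P i) w i * (b i - a i)) / delta)%:E)%E.
Proof.
move=> w0 ab d0 E.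
pose f (c : R) := \sum_(i | P i) w i * \1_(`[a i, b i]%classic) c.
have f0 c : 0 <= f c by apply: sumr_ge0 => i _; rewrite mulr_ge0.
have mfi i : measurable_fun setT (fun c : R => w i * \1_(`[a i, b i]%classic) c).
  apply: measurable_funM => //; exact: measurable_indic.
have mf : measurable_fun setT f.
  rewrite (_ : f = fun c => \sum_(i <- enum P) w i * \1_(`[a i, b i]%classic) c).
    by apply: measurable_sum.
  by apply/funext => c; rewrite big_enum.
have mE : measurable E.
  rewrite (_ : E = f @^-1` `[delta, +oo[%classic); first by rewrite -[X in measurable X]setTI; exact: mf.
  by apply/seteqP; split => c; rewrite /= in_itv /= andbT.
split => //.
have mEf := (measurable_EFinP _ _).2 mf.
have h := @le_integral_comp_abse _ _ R mu setT measurableT (EFin \o f) delta id (@measurable_id _ _ _)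
  (fun _ => id) (fun _ _ _ _ => id) mEf d0.
have Ei : setT `&` [set x | (delta%:E <= `|(EFin \o f) x|)%E] = E.
  rewrite setTI; apply/seteqP; split => c /=; rewrite lee_fin ger0_norm //.
rewrite Ei /= in h.
have iE : (\int[mu]_x `|(f x)%:E| = (\sum_(i | P i) w i * (b i - a i))%:E)%E.
  transitivity (\int[mu]_x (\sum_(i <- enum P) (w i * \1_(`[a i, b i]%classic) x)%:E))%E.
    apply: eq_integral => x _; rewrite sumEFin /= ger0_norm ?f0 //; congr (_%:E).
    by rewrite /f big_enum.
  rewrite ge0_integral_sum //; last 2 first.
  - by move=> i; apply/measurable_EFinP; exact: mfi.
  - by move=> i x _; rewrite lee_fin mulr_ge0.
  rewrite -sumEFin big_enum /=; apply: eq_bigr => i _.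
  under eq_integral do rewrite EFinM.
  rewrite ge0_integralZl //; last 2 first.
  - by apply/measurable_EFinP; exact: measurable_indic.
  - by rewrite lee_fin.
  rewrite integral_indic // setIT EFinM; congr (_ * _)%E.
  etransitivity; first exact: (lebesgue_measure_itv `[a i, b i]).
  rewrite /= lte_fin; case: ltgtP (ab i) => // ->.
  by rewrite subrr.
rewrite iE in h; rewrite -(@lee_pmul2l _ delta%:E) //; first by rewrite -EFinM mulrC divfK ?gt_eqF.
Qed.

End null_sets.

Section thin_sets.
Variables (R : realType) (X : fspace R).
Local Notation mu := (@lebesgue_measure R).
Implicit Type F : set X.

(* Iterated generic level sets: a substitute for "dimension less than [k]". *)
Fixpoint thin (k : nat) F : Prop :=
  if k is k'.+1 then forall rho, @fs_fun R X rho ->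
    mu.-negligible [set c | ~ thin k' (F `&` [set x | rho x = c])]
  else F `<=` set0.

Lemma thin_sub k F G : F `<=` G -> thin k G -> thin k F.
Proof.
elim: k F G => [|k IH] F G FG /= tG; first exact: subset_trans tG.
move=> rho Crho; apply: negligibleS (tG _ Crho) => c /= nF; apply: contra_not nF.
by apply: IH => x [/FG].
Qed.

(** A countable union of null sets of exceptional levels is null. *)
Lemma thin_bigcup k (F : nat -> set X) : (forall j, thin k (F j)) -> thin k (\bigcup_j F j).
Proof.
elim: k F => [|k IH] F tF /=; first by move=> x [j _ /tF].
move=> rho Crho; apply: negligibleS (negligible_bigcup (fun j => tF j rho Crho)).
move=> c /= nF; apply: contrapT => nc; apply: nF.
rewrite setI_bigcupl; apply: IH => j; apply: contrapT => ncj; apply: nc.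
by exists j.
Qed.

Lemma thinS k F : thin k F -> thin k.+1 F.
Proof.
elim: k F => [|k IH] F tF rho Crho.
  by apply: negligibleS (negligible_set0 _) => c /= nF; apply: nF => x [/tF].
by apply: negligibleS (tF _ Crho) => c /= nF; apply: contra_not nF; exact: IH.
Qed.

Lemma thinW k l F : (k <= l)%N -> thin k F -> thin l F.
Proof. by move=> /subnK <-; elim: (l - k)%N => // m IH /IH /thinS. Qed.

(** The exceptional levels form a null set, which cannot contain the interval []1, 2[]. *)
Lemma thin_pick k F rho : thin k.+1 F -> @fs_fun R X rho ->
  exists c : R, [/\ 1 < c, c < 2 & thin k (F `&` [set x | rho x = c])].
Proof.
move=> /= tF Crho; apply: contrapT => nc.
have neg : mu.-negligible (`]1, 2[%classic : set (measurableTypeR R)).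
  apply: negligibleS (tF _ Crho) => c /=; rewrite in_itv /= => /andP[c1 c2] tc; apply: nc.
  by exists c.
have [B [mB B0 AB]] := neg.
have : (lebesgue_measure (`]1%R, 2%R[%classic : set R) <= mu B)%E.
  by apply: le_measure => //; rewrite inE //; exact: measurable_itv.
by rewrite lebesgue_measure_itv /= lte_fin ltr1n B0 -EFinB lee_fin subr_le0 leNgt ltr1n.
Qed.

(** Choose a generic level for each [rho j]. The points of [F] lying on one of these level sets form
    a countable union of sets thinner by one, for which the next row of levels is chosen. After [k]
    rows nothing is left, so every point avoids all levels of some row. *)
Lemma thin_levels k F (rho : nat -> X -> R) : thin k F -> (forall j, @fs_fun R X (rho j)) ->
  exists c : nat -> nat -> R, (forall i j, 1 < c i j < 2) /\
    forall x, F x -> exists2 i, (i < k)%N & forall j, rho j x != c i j.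
Proof.
move=> + Crho; elim: k F => [|k IH] F tF.
  (* In this case [F] is empty and any levels in []1, 2[] will do. *)
  exists (fun _ _ => 3 / 2); split => [_ _|x /tF//].
  by rewrite ltr_pdivlMr // ltr_pdivrMr // mul1r -natrM !ltr_nat.
have [c cP] := choice (fun j => thin_pick tF (Crho j)).
have /IH[c' [c'12 c'P]] : thin k (\bigcup_j (F `&` [set x | rho j x = c j])).
  by apply: thin_bigcup => j; case: (cP j).
exists (fun i => if i is i'.+1 then c' i' else c); split => [[|i] j|x Fx].
- by have [-> ->] := cP j.
- exact: c'12.
have [[j xj]|nx] := pselect (exists j, rho j x = c j).
  by have [|i ik xc'] := c'P x; [exists j|exists i.+1].
by exists 0%N => // j; apply/eqP => xj; apply: nx; exists j.
Qed.

Section content.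
Variables (m : nat) (p : X -> 'rV[R]_m) (Q : set X).
Hypothesis lipQ : forall rho, @fs_fun R X rho -> exists2 L : R, 0 <= L &
  forall x y, Q x -> Q y -> `|rho y - rho x| <= L * `|p y - p x|.

(* Vanishing [k]-dimensional Hausdorff content, with finite covers. *)
Definition null_content k (A : set X) : Prop := forall e : R, 0 < e ->
  exists (I : finType) (P : pred I) (B : I -> set X) (r : I -> R),
    [/\ forall i, 0 < r i, forall i x y, B i x -> B i y -> `|p y - p x| <= r i,
      A `<=` [set x | exists2 i, P i & B i x] & \sum_(i | P i) r i ^+ k < e].

(* Eilenberg's inequality: slicing by the level sets of a Lipschitz function
   lowers the dimension of the content by one for almost every level. *)
Lemma null_content_slice k A rho : A `<=` Q -> null_content k.+1 A -> @fs_fun R X rho ->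
  mu.-negligible [set c | ~ null_content k (A `&` [set x | rho x = c])].
Proof.
move=> AQ nA Crho; have [L0 L00 rhoL0] := lipQ Crho.
pose L := L0 + 1; have L1 : 0 < L by rewrite ltr_wpDl.
pose bad (j : nat) := [set c : R | ~ exists (I : finType) (P : pred I) (B : I -> set X) (r : I -> R),
    [/\ forall i, 0 < r i, forall i x y, B i x -> B i y -> `|p y - p x| <= r i,
      A `&` [set x | rho x = c] `<=` [set x | exists2 i, P i & B i x] & \sum_(i | P i) r i ^+ k < j.+1%:R^-1]].
suff nb j : mu.-negligible (bad j).
  apply: negligibleS (negligible_bigcup nb) => c /= nc.
  apply: contrapT => nbad; apply: nc => e e0.
  have je : (Num.truncn e^-1).+1%:R^-1 <= e.
    rewrite -[leRHS]invrK lef_pV2 ?posrE ?invr_gt0 //.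
    by rewrite ltW // truncnS_gt.
  have nb' : ~ bad (Num.truncn e^-1) c by move=> b; apply: nbad; exists (Num.truncn e^-1).
  have [I [P [B [r [r0 rB cov sr]]]]] := contrapT nb'.
  by exists I, P, B, r; split => //; exact: lt_le_trans je.
set delta : R := j.+1%:R^-1; have d0 : 0 < delta by rewrite invr_gt0.
apply: negligible_le => e e0.
(* An interval of half-length [L * r i] will be attached to piece [i]; with this bound on the
   content, Markov's inequality at threshold [delta] leaves measure at most [e]. *)
have [|I [P [B [r [r0 rB cov sr]]]]] := nA (e * delta / (2 * L)).
  by rewrite divr_gt0 // mulr_gt0.
(* Pieces that miss [Q] are dropped. On the others [v i] is a value of [rho] at a point of [Q], and
   by the Lipschitz bound [rho] stays within [L * r i] of it on the part of the piece in [Q]. *)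
pose P' i := P i && `[< exists2 x, Q x & B i x >].
have /choice[v vP] i : exists v, P' i -> exists x, [/\ Q x, B i x & rho x = v].
  have [/andP[_ /asboolP[x Qx Bx]]|_] := boolP (P' i); last by exists 0.
  by exists (rho x) => _; exists x.
have ab i : v i - L * r i <= v i + L * r i by have Lr : 0 <= L * r i; [rewrite mulr_ge0 // ltW|lra].
have w0 i : 0 <= r i ^+ k by rewrite exprn_ge0 // ltW.
have [mE muE] := weighted_cover_measure P' w0 ab d0.
eexists; split; [exact: mE| |apply: le_trans muE _]; last first.
  rewrite lee_fin ler_pdivrMr //.
  have -> : \sum_(i | P' i) r i ^+ k * (v i + L * r i - (v i - L * r i)) =
      2 * L * \sum_(i | P' i) r i ^+ k.+1.
    by rewrite mulr_sumr; apply: eq_bigr => i _; rewrite exprS; ring.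
  rewrite ltr_pdivlMr ?mulr_gt0 // in sr; apply: le_trans (ltW sr).
  rewrite mulrC ler_wpM2r ?mulr_ge0 ?(ltW L1) // [leLHS]big_mkcondr /=.
  by apply: ler_sum => i _; case: ifP => // _; rewrite exprn_ge0 // ltW.
move=> c /= bc; rewrite leNgt; apply/negP => lt; apply: bc.
(* The level set of [c] is covered by the pieces whose interval contains [c], and the content of
   that subcover is the step function at [c]. *)
pose J i := c \in `[v i - L * r i, v i + L * r i].
exists I, (fun i => P' i && J i), B, r; split => //.
  move=> x [Ax xc]; have [i Pi Bx] := cov _ Ax; exists i => //.
  have P'i : P' i by rewrite /P' Pi; apply/asboolP; exists x => //; exact: AQ.
  have [y [Qy By yv]] := vP _ P'i.
  rewrite P'i /J in_itv /= -yv -ler_distlC -xc.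
  rewrite (le_trans (rhoL0 x y (AQ _ Ax) Qy)) // ler_pM // ?rB // /L lerDl //.
apply: le_lt_trans lt; rewrite big_mkcondr /=; apply: ler_sum => i P'i.
rewrite /J indicE mem_setE; case: ifP => _; last by rewrite mulr0.
by rewrite mulr1.
Qed.

(** In dimension 0 the content counts the pieces of a cover, so content below 1 means no piece and
    hence an empty set. Slicing does the induction step. *)
Lemma thin_null_content k A : A `<=` Q -> null_content k A -> thin k A.
Proof.
elim: k A => [|k IH] A AQ nA /=.
  have [I [P [B [r [_ _ cov]]]]] := nA 1 ltr01.
  under eq_bigr do rewrite expr0; rewrite sumr_const => lt1 x /cov[i Pi _].
  move: lt1; rewrite ltrn1 ltnS leqn0 => /eqP P0.
  by have := card0_eq P0 i; rewrite unfold_in Pi.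
move=> rho Crho; apply: negligibleS (null_content_slice AQ nA Crho) => c /= nt.
by apply: contra_not nt => nc; apply: IH => // x [/AQ].
Qed.

End content.
End thin_sets.

Lemma grid_cell (R : realType) (w t : R) q : 0 <= t -> t <= w *+ q.+1 ->
  exists j : 'I_q.+1, w *+ j <= t <= w *+ j.+1.
Proof.
move=> t0; elim: q => [|q IH] tq; first by exists ord0; rewrite t0.
have [tq'|qt] := leP t (w *+ q.+1); last by exists ord_max; rewrite (ltW qt).
by have [j jt] := IH tq'; exists (widen_ord (leqnSn _) j).
Qed.

(** Cutting a cube of side [2 r] into [(q+1)^m] cells of side [2 r / (q+1)] gives
    [m + 1]-dimensional content [(2 r)^(m+1) / (q+1)], which is as small as desired. *)
Lemma null_content_cube (R : realType) (X : fspace R) m (p : X -> 'rV[R]_m) (Q : set X)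
  (z : 'rV[R]_m) (r : R) : 0 < r -> (forall x, Q x -> `|p x - z| <= r) ->
  null_content p m.+1 Q.
Proof.
move=> r0 Qr e e0.
pose q := Num.truncn ((2 * r) ^+ m.+1 / e).
pose w : R := 2 * r / q.+1%:R; have w0 : 0 < w by rewrite divr_gt0 // mulr_gt0.
pose B (f : {ffun 'I_m -> 'I_q.+1}) := [set x | forall i,
  w *+ f i <= p x 0 i - z 0 i + r <= w *+ (f i).+1].
exists {ffun 'I_m -> 'I_q.+1}, xpredT, B, (fun=> w); split => //.
- move=> f x y fx fy; apply: norm_row_le => [|i]; first exact: ltW.
  have := fx i; have := fy i; rewrite !mxE !mulrSr ler_norml => /andP[? ?] /andP[? ?].
  by apply/andP; split; lra.
- move=> x Qx; have xi i : exists j : 'I_q.+1, w *+ j <= p x 0 i - z 0 i + r <= w *+ j.+1.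
    have := le_trans (le_coord_norm (p x - z) i) (Qr _ Qx); rewrite !mxE ler_norml => /andP[? ?].
    apply: grid_cell; first lra.
    by rewrite -mulr_natr /w divfK ?pnatr_eq0 //; lra.
  have [f fP] := choice xi; exists [ffun i => f i] => // i; rewrite ffunE; exact: fP.
rewrite sumr_const card_ffun !card_ord -mulr_natr natrX /w expr_div_n.
have q0 : q.+1%:R != 0 :> R by rewrite pnatr_eq0.
have qm0 : q.+1%:R ^+ m != 0 :> R by rewrite expf_neq0.
rewrite [q.+1%:R ^+ m.+1]exprS invfM mulrA mulfVK // ltr_pdivrMr ?ltr0n //.
by rewrite -ltr_pdivrMl // mulrC; exact: truncnS_gt.
Qed.

Lemma lindelof (T : topologicalType) (V : T -> set T) : @second_countable T ->
  (forall t, nbhs t (V t)) -> exists D : set T, countable D /\ forall t, exists2 d, D d & V d t.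
Proof.
move=> [B cB [oB bB]] nV.
have /choice[d dP] (U : set T) : exists d : option T, (exists t, U `<=` V t) -> exists2 t, d = Some t & U `<=` V t.
  have [[t Ut]|nt] := pselect (exists t, U `<=` V t); last by exists None.
  by exists (Some t) => _; exists t.
exists [set t | exists2 U, B U & d U = Some t]; split.
  have [[t0 _]|nt] := pselect (exists t : T, True); last first.
    rewrite (_ : [set _ | _] = set0); first exact: countable0.
    by apply/seteqP; split => t //; case: nt; exists t.
  apply: (@sub_countable _ _ _ [set odflt t0 (d U) | U in B]).
    by apply: subset_card_le => t [U BU dU]; exists U => //; rewrite dU.
  exact: sub_countable (card_image_le _ _) cB.
move=> t; have [U [BU Ut] UV] := bB t _ (nV t).
have [s ds Us] := dP U (ex_intro _ t UV).
by exists s; [exists U|exact: Us].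
Qed.

Section stratifold_dimension.
Variables (R : realType) (X : fspace R) (n : nat).
Hypotheses (dX : is_differential_space X)
  (aX : forall k, exists A, @is_stratum_atlas R X k A) (nX : skeleton X n = setT).

Lemma thin_countable k (T : Type) (D : set T) (F : T -> set X) : countable D ->
  (forall t, D t -> thin k (F t)) -> thin k (\bigcup_(t in D) F t).
Proof.
move=> /countable_injP[f finj] tF.
pose G j := [set x | exists t, [/\ D t, f t = j & F t x]].
apply: (@thin_sub _ _ _ _ (\bigcup_j G j)); first by move=> x [t Dt Ftx]; exists (f t) => //; exists t.
apply: thin_bigcup => j.
have [[t [Dt ft]]|nt] := pselect (exists t, D t /\ f t = j).
  apply: thin_sub (tF t Dt) => x [s [Ds fs Fs]].
  by have <- : s = t by apply: finj; rewrite ?inE // fs ft.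
by apply: (@thinW _ _ 0) => // x [s [Ds fs Fs]]; case: nt; exists s.
Qed.

(** By second countability the stratum is covered by countably many balls in charts. On such a ball
    structure functions are Lipschitz in the chart coordinates, so [thin_null_content] applies to
    it. *)
Lemma thin_stratum m : thin m.+1 (stratum X m).
Proof.
have [A sA] := aX m; have [mA G1 G2 G3] := (stratum_atlasP A).1 sA.
have [hM scM aA] := mA; have [Ac Acov _] := aA.
have /choice[c cP] (t : stratum X m) : exists c, A c /\ chart_dom c t by have [c cA ct] := Acov t; exists c.
have rP t : exists r : R, 0 < r /\ [set z | `|z - chart_map (c t) t| <= r] `<=` chart_cod (c t).
  have [cA ct] := cP t; have /nbhs_ballP[e /= e0 eP] := chart_cod_nbhs (Ac _ cA) ct.
  exists (e / 2); split; first by rewrite divr_gt0.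
  move=> z /= zr; apply: eP; rewrite -ball_normE /= distrC (le_lt_trans zr) //.
  by rewrite ltr_pdivrMr // ltr_pMr // ltr1n.
have /choice[r {}rP] := rP.
pose V t := [set s : stratum X m | chart_dom (c t) s /\ `|chart_map (c t) s - chart_map (c t) t| <= r t].
have nV t : nbhs t (V t).
  have [cA ct] := cP t; have cc := Ac _ cA; apply: filterI; first exact: chart_dom_nbhs.
  have [_ _ cn _ _] := cc; have [r0 _] := rP t.
  have cb : \forall z \near chart_map (c t) t, `|z - chart_map (c t) t| <= r t.
    apply/nbhs_ballP; exists (r t) => // z; rewrite -ball_normE /= distrC; exact: ltW.
  exact: (continuous_near (cn _ ct) cb).
have [D [cD DV]] := lindelof scM nV.
apply: (@thin_sub _ _ _ _ (\bigcup_(t in D) [set val s | s in V t])).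
  move=> x xm; have [t Dt tx] := DV (exist _ x (mem_set xm)).
  by exists t => //; exists (exist _ x (mem_set xm)).
apply: thin_countable => // t _; have [cA ct] := cP t; have cc := Ac _ cA; have [r0 rc] := rP t.
(* The chart as a total function on [X], with value 0 off the stratum. *)
pose p (x : X) : 'rV[R]_m := if pselect (stratum X m x) is left xm
  then chart_map (c t) (exist _ x (mem_set xm)) else 0.
have pE (s : stratum X m) : p (val s) = chart_map (c t) s.
  rewrite /p; case: pselect => [xm|]; last by case; exact: set_mem (valP s).
  by congr chart_map; exact: val_inj.
apply: (@thin_null_content _ _ _ p [set val s | s in V t]) => //; last first.
  by apply: (@null_content_cube _ _ _ _ _ (chart_map (c t) t) (r t)) => // _ [s [_ sr] <-]; rewrite pE.
move=> rho Crho.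
have rs : smooth (chart_cod (c t)) ((fun s : stratum X m => rho (val s)) \o chart_inv (c t)).
  suff : smooth_fun A (fun s : stratum X m => rho (val s)) by apply.
  apply: smooth_fun_locally => // s; have [d dA ds] := Acov s; exists d; split => //.
  have [F Fs rF] := G1 s _ Crho.
  exact: smooth_at_near (Ac _ dA) ds rF (smooth_fun_at aA dA ds Fs).
have [_ oc _ _ _] := cc.
have [L L0 LP] := smooth_lipschitz oc rs rc.
exists L => // _ _ [s [cs sr] <-] [s' [cs' sr'] <-]; rewrite !pE.
by have := LP _ _ sr sr'; rewrite /= !chart_mapK.
Qed.

Lemma thin_setT : thin n.+1 [set: X].
Proof.
pose F m := if (m <= n)%N then stratum X m else set0.
apply: (@thin_sub _ _ _ _ (\bigcup_m F m)).
  move=> x _; have : skeleton X n x by rewrite nX.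
  by move=> /in_stratum[m mn xm]; exists m => //; rewrite /F mn.
apply: thin_bigcup => m; rewrite /F; case: ifP => mn.
  by apply: thinW (thin_stratum m); rewrite ltnS.
by apply: (@thinW _ _ 0).
Qed.

End stratifold_dimension.

(** * Covers in finitely many colours *)

Section cover.
Variables (R : realType) (X : fspace R) (n : nat).
Hypotheses (dX : is_differential_space X) (scX : @second_countable X)
  (bumpX : forall (x : X) (U : set X), open_nbhs x U ->
     exists rho : X -> R, [/\ fs_fun rho, forall y, 0 <= rho y, rho x != 0 &
       closure [set y | rho y != 0] `<=` U])
  (thinX : thin n [set: X]).
Variables (J : Type) (U : J -> set X).
Hypotheses (oU : forall a, open (U a)) (covU : \bigcup_a U a = setT).

Lemma countable_bump_cover (x0 : X) : exists (rho : nat -> X -> R) (a : nat -> J),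
  [/\ forall j, fs_fun (rho j), forall j, closure [set y | rho j y != 0] `<=` U (a j) &
      forall x, exists j, 3 < rho j x].
Proof.
have bx x : exists ra : (X -> R) * J, [/\ fs_fun ra.1, closure [set y | ra.1 y != 0] `<=` U ra.2 & 3 < ra.1 x].
  have : (\bigcup_a U a) x by rewrite covU.
  move=> [a _ Ux]; have [rho [Crho rho0 rhox supp]] := bumpX (conj (oU a) Ux).
  (* Rescaled to the value 4 at [x]: the bound 3 stays above all levels, which are taken in []1,
     2[]. *)
  exists (fun y => 4 / rho x * rho y, a); split => /=.
  - by apply: (fs_nearP dX) => y; apply: fs_nearM => //; [exact: fs_near_cst|exact: fs_fun_near].
  - apply: subset_trans supp; apply: closure_subset => y /=; apply: contraNneq => ->.
    by rewrite mulr0.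
  - by rewrite divfK // ltr_nat.
have [ra raP] := choice bx.
have nV x : nbhs x [set y | 3 < (ra x).1 y].
  have [Cra _ rax] := raP x.
  have rc := fs_near_continuous dX (fs_fun_near x Cra).
  exact: (continuous_near rc (lt_nbhsr rax)).
have [D [/countable_injP[f finj] DV]] := lindelof scX nV.
(* The point numbered [j] in the countable subcover, or the default [x0] if there is none. *)
have /choice[e eP] (j : nat) : exists x, forall y, D y -> f y = j -> x = y.
  have [[y [Dy fy]]|ny] := pselect (exists y, D y /\ f y = j); last first.
    by exists x0 => y Dy fy; case: ny; exists y.
  by exists y => z Dz fz; apply: finj; rewrite ?inE // fy fz.
exists (fun j => (ra (e j)).1), (fun j => (ra (e j)).2); split.
- by move=> j; case: (raP (e j)).
- by move=> j; case: (raP (e j)).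
- by move=> x; have [y Dy yx] := DV x; exists (f y); rewrite (eP _ _ Dy erefl).
Qed.

(** The function [lam i j] is positive where [rho j] exceeds [c i j] and every earlier [rho l] is
    below [c i l], and zero elsewhere. So for [j < j'] the functions [lam i j] and [lam i j'] are
    never both nonzero. Where some [rho j] exceeds 3, which is above its level, all later functions
    vanish; this gives local finiteness. Finally [thin_levels] provides for each point a colour in
    which it lies on no level set. *)
Lemma level_cover (x0 : X) : exists (a : nat -> J) (lam : nat -> nat -> X -> R),
  [/\ forall i j, fs_fun (lam i j),
      forall i j, closure [set y | lam i j y != 0] `<=` U (a j),
      forall i j j' x, j != j' -> lam i j x * lam i j' x = 0,
      forall x : X, exists K, \forall y \near x, forall i j, (K <= j)%N -> lam i j y = 0 &
      forall x, exists i j, (i < n)%N /\ lam i j x != 0].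
Proof.
have [rho [a [Crho suppr rho3]]] := countable_bump_cover x0.
have [c [c12 cP]] := thin_levels thinX Crho.
have c1 i j : 1 < c i j by case/andP: (c12 i j).
have c2 i j : c i j < 2 by case/andP: (c12 i j).
pose lam i j (x : X) := flat (rho j x - c i j) * \prod_(l < j) flat (c i l - rho l x).
have lam_gt i j x : lam i j x != 0 -> c i j < rho j x.
  apply: contraNlt => h; apply/eqP; rewrite /lam flat_eq0 ?mul0r //.
  by rewrite subr_le0.
have lam_lt i j l x : (l < j)%N -> lam i j x != 0 -> rho l x < c i l.
  move=> lj; apply: contraNlt => h; apply/eqP.
  by rewrite /lam (bigD1 (Ordinal lj)) //= (@flat_eq0 _ (c i l - rho l x)) ?subr_le0 // mul0r mulr0.
exists a, lam; split.
- move=> i j; apply: (fs_nearP dX) => x; apply: fs_nearM => //.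
    apply: fs_near_flat => //; apply: fs_nearB => //; [exact: fs_fun_near|exact: fs_near_cst].
  apply: fs_near_prod => // l _; apply: fs_near_flat => //; apply: fs_nearB => //.
    exact: fs_near_cst.
  exact: fs_fun_near.
- move=> i j; apply: subset_trans (suppr j); apply: closure_subset => y /lam_gt /=.
  by apply: contraTneq => ->; rewrite -leNgt ltW // (lt_trans ltr01).
- move=> i j j' x; wlog jj' : j j' / (j < j')%N => [hw|_].
    by rewrite neq_ltn => /orP[] jj'; [|rewrite mulrC]; apply: hw => //; rewrite ?ltn_eqF ?gtn_eqF.
  have [->|/lam_gt h] := eqVneq (lam i j x) 0; first by rewrite mul0r.
  have [->|/(lam_lt i _ j _ jj') h'] := eqVneq (lam i j' x) 0; first by rewrite mulr0.
  by have := lt_trans h h'; rewrite ltxx.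
- move=> x; have [j rj] := rho3 x; exists j.+1.
  have rc := fs_near_continuous dX (fs_fun_near x (Crho j)).
  apply: filterS (continuous_near rc (lt_nbhsr rj)) => y ry i j' jj'.
  apply/eqP; apply: contraTT ry => /(lam_lt _ _ _ _ jj') h.
  by rewrite -leNgt ltW // (lt_trans h) // (lt_trans (c2 _ _)) // ltr_nat.
- move=> x; have [i ik xi] := cP x I; have [j rj] := rho3 x.
  have ex : exists j, c i j < rho j x.
    by exists j; rewrite (lt_trans (c2 _ _)) // (lt_trans _ rj) // ltr_nat.
  (* For the first [j0] whose level is exceeded, the earlier functions are at most their levels,
     hence strictly below since equality is excluded. *)
  case: (ex_minnP ex) => j0 cj0 min; exists i, j0; split => //.
  rewrite gt_eqF // mulr_gt0 ?flat_gt0 ?subr_gt0 //.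
  apply: prodr_gt0 => l _; rewrite flat_gt0 subr_gt0 lt_neqAle xi /=.
  rewrite leNgt; apply/negP => /min; by rewrite leqNgt ltn_ord.
Qed.

End cover.

(** * Local trivializations *)

Lemma fs_near_comp (R : realType) (X Y : fspace R) (f : X -> Y) (x : X) F :
  is_differential_space X -> {for x, continuous f} ->
  (forall phi, @fs_fun R Y phi -> fs_near x (phi \o f)) -> fs_near (f x) F -> fs_near x (F \o f).
Proof.
move=> dX fc fm [h Ch Fh]; apply: (eq_fs_near (g := h \o f)); last exact: fm.
exact: (continuous_near fc Fh).
Qed.

Section prod_open_top.
Variables (R : realType) (S : topologicalType) (n : nat) (U : set S).
Hypothesis oU : open U.

Lemma near_prod_open (x : U) (v : 'rV[R]_n) (P : S * 'rV[R]_n -> Prop) :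
  (\forall p \near (x, v), P (val p.1, p.2)) -> \forall p \near (val x, v), P p.
Proof.
move=> [[A B] /= [nA nB] AB].
exists ([set val u | u in A], B) => /=; first by split=> //; exact: nbhs_set_type_open.
by move=> [_ w] /= [[u Pu <-] Qw]; exact: (AB (u, w)).
Qed.

Lemma continuous_val_prod (p : U * 'rV[R]_n) :
  {for p, continuous (fun p : U * 'rV[R]_n => (val p.1, p.2))}.
Proof.
have h1 : {for p, continuous (fun p : U * 'rV[R]_n => val p.1)}.
  by apply: (@continuous_comp _ _ _ fst (fun y : U => val y)); [exact: cvg_fst|exact: val_continuous].
have h2 : {for p, continuous (fun p : U * 'rV[R]_n => p.2)} by exact: cvg_snd.
exact: cvg_pair h1 h2.
Qed.

End prod_open_top.

Section prod_open.
Variables (R : realType) (S : fspace R) (n : nat) (U : set S).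
Hypotheses (dS : is_differential_space S) (oU : open U).
Local Notation G Z := (gen_fspace (@prod_gens R Z n)).

Lemma gen_prod_morphism (Z : fspace R) (f : Z -> S * 'rV[R]_n) z :
  is_differential_space Z -> {for z, continuous f} ->
  (forall phi, @fs_fun R S phi -> fs_near z (fun y => phi (f y).1)) ->
  (forall i, fs_near z (fun y => (f y).2 0 i)) ->
  forall F : S * 'rV[R]_n -> R, @fs_near R (G S) (f z) F -> fs_near z (F \o f).
Proof.
move=> dZ fc f1 f2 F; apply: (@fs_near_comp R Z (G S)) => // phi.
apply: gen_fs_near => // _ [[psi Cpsi ->]|[i ->]]; first exact: f1.
exact: f2.
Qed.

Lemma fs_near_prod_open (x : subfspace U) (v : 'rV[R]_n) (F : S * 'rV[R]_n -> R) :
  @fs_near R (G (subfspace U)) (x, v) (fun p => F (val p.1, p.2)) <->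
  @fs_near R (G S) (val x, v) F.
Proof.
have dU := subfspace_ds U dS.
have dG := prod_gen_ds n dU; have dGS := prod_gen_ds n dS.
split; last first.
  apply: (@gen_prod_morphism (G (subfspace U)) (fun p => (val p.1, p.2)) (x, v)) => //.
  - exact: continuous_val_prod.
  - move=> phi Cphi; apply: fs_fun_near.
    exact: ((@fst_morphism R (subfspace U) n).2 _ ((@subfspace_val_morphism R S U).2 _ Cphi)).
  - by move=> i; apply: fs_fun_near; apply: smgen_sub; right; exists i.
move=> [h Ch Fh]; have [m [phi [g [phiG gs hg]]]] := Ch (x, v).
have th i : exists theta : S * 'rV[R]_n -> R, prod_gens theta /\
    \forall p \near ((x, v) : U * 'rV[R]_n), phi i p = theta (val p.1, p.2).
  have [[psi /subfspace_funP/(_ x)[k Ck pk] ->]|[j ->]] := phiG i; last first.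
    by exists (fun p : S * 'rV[R]_n => p.2 0 j); split; [right; exists j|exact: near_all].
  exists (fun p : S * 'rV[R]_n => k p.1); split; first by left; exists k.
  exact: (@continuous_near _ _ (fun p : U * 'rV[R]_n => p.1) (x, v) (fun z => psi z = k (val z)) cvg_fst pk).
have [theta thetaP] := choice th.
apply: (@eq_fs_near _ (G S) _ _ (fun p => g (\row_i theta i p))); last first.
  apply: (@fs_near_smooth _ _ dGS _ setT) => //; first exact: openT.
  move=> i; apply: fs_fun_near; apply: smgen_sub; by case: (thetaP i).
have nt : \forall p \near ((x, v) : U * 'rV[R]_n), forall i, phi i p = theta i (val p.1, p.2).
  apply: (@filter_forall _ _ (fun i (p : U * 'rV[R]_n) => phi i p = theta i (val p.1, p.2)) (nbhs _)) => i.
  by case: (thetaP i).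
apply: (@near_prod_open R S n U oU x v (fun p => F p = g (\row_i theta i p))).
apply: filterS3 Fh hg nt => p -> -> pt; congr g; apply/rowP => i; rewrite !mxE; exact: pt.
Qed.

End prod_open.

Section local_trivialization.
Variables (R : realType) (S E : fspace R) (pi : E -> S).
Variable fm : forall x, GRing.Lmodule R (fibre pi x).

(** A trivialization over [U] and its inverse as total maps on [E] and on [S * R^n], meaningful only
    over [U]. This avoids subspace types; the last three fields say pointwise that both directions
    are morphisms. *)
Record ltriv (U : set S) (n : nat) (t : E -> 'rV[R]_n) (ti : S -> 'rV[R]_n -> E) : Prop := LTriv {
  lt_K : forall e, U (pi e) -> ti (pi e) (t e) = e;
  lt_pi : forall x v, U x -> pi (ti x v) = x;
  lt_inv : forall x v, U x -> t (ti x v) = v;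
  lt_lin : forall x, U x -> linear ((fun e => t (sval e)) : fibre_lmod fm x -> 'rV[R]_n);
  lt_coord : forall e, U (pi e) -> forall i, fs_near e (fun e => t e 0 i);
  lt_cont : forall x v, U x -> {for (x, v), continuous (fun p : S * 'rV[R]_n => ti p.1 p.2)};
  lt_mor : forall x v, U x -> forall F, fs_fun F ->
    @fs_near R (gen_fspace (@prod_gens R S n)) (x, v) (fun p => F (ti p.1 p.2)) }.

Hypotheses (dS : is_differential_space S) (dE : is_differential_space E)
  (mpi : is_morphism pi)
  (aS : forall k, exists A, @is_stratum_atlas R S k A)
  (sS : forall x, exists k, stratum S k x).
Variables (U : set S) (n : nat).
Hypothesis oU : open U.
Local Notation piU := (pi @^-1` U).
Local Notation UR := (prod_fspace (subfspace U) (euclidean R n)).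

Let opiU : open piU.
Proof. by apply: open_comp => // e _; exact: mpi.1. Qed.

Let URE : @fs_fun R UR = smgen (@prod_gens R (subfspace U) n).
Proof.
apply: prod_fspaceE => [|k|x]; first exact: subfspace_ds.
  exact: open_subspace_atlas.
have [k xk] := sS (val x); exists k.
by rewrite stratum_open_subfspace.
Qed.

Lemma trivialization_ltriv phi : @is_trivialization R S E pi fm U n phi ->
  exists t ti, @ltriv U n t ti.
Proof.
move=> [[phim [psi [psim phiK psiK]]] phi1 phil].
pose t e := if pselect (U (pi e)) is left Ue
  then (phi (exist _ e (mem_set Ue))).2 : 'rV[R]_n else 0.
pose ti x v := if pselect (U x) is left Ux then val (psi (exist _ x (mem_set Ux), v))
  else sval (0 : fibre_lmod fm x).
have tE (e : subfspace piU) : t (val e) = (phi e).2.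
  rewrite /t; case: pselect => [Ue|nU]; last by case: nU; exact: set_mem (valP e).
  by congr (phi _).2; exact: val_inj.
have tiE (x : subfspace U) v : ti (val x) v = val (psi (x, v)).
  rewrite /ti; case: pselect => [Ux|nU]; last by case: nU; exact: set_mem (valP x).
  by congr (val (psi (_, _))); exact: val_inj.
have inU x : U x -> exists u : subfspace U, val u = x.
  by move=> Ux; exists (exist _ x (mem_set Ux)).
have inpi e : U (pi e) -> exists u : subfspace piU, val u = e.
  by move=> Ux; exists (exist _ e (mem_set (Ux : piU e))).
exists t, ti; split.
- by move=> _ /inpi[e <-]; rewrite tE -phi1 tiE -surjective_pairing phiK.
- by move=> _ v /inU[x <-]; rewrite tiE -phi1 psiK.
- by move=> _ v /inU[x <-]; rewrite tiE tE psiK.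
- move=> x Ux a u v; have [lin _] := phil x Ux.
  have te (w : fibre_lmod fm x) : t (sval w) = (phi (fibre_sub Ux w)).2 by rewrite -tE.
  by rewrite !te lin.
- move=> _ /inpi[e <-] i; have [+ _] := @fs_near_open_subfspace R E piU opiU e (fun e => t e 0 i); apply.
  apply: (eq_fs_near (g := (fun p : UR => p.2 0 i) \o phi)).
    by apply: near_all => u /=; rewrite tE.
  apply: fs_fun_near; apply: phim.2; rewrite URE.
  by apply: smgen_sub; right; exists i.
- move=> _ v /inU[x <-] B; rewrite /= => nB.
  apply: (@near_prod_open R S n U oU x v (fun p => B (ti p.1 p.2))).
  have pc : {for (x, v), continuous (fun p : UR => val (psi p))}.
    by apply: (@continuous_comp _ _ _ psi (fun y : piU => val y)); [exact: psim.1|exact: val_continuous].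
  rewrite tiE in nB; apply: (@filterS _ _ _ (fun p : UR => B (val (psi p)))) (pc _ nB) => p.
  by rewrite tiE -surjective_pairing.
- move=> _ v /inU[x <-] F CF.
  apply/(@fs_near_prod_open R S n U dS oU x v).
  apply: (@eq_fs_near R (gen_fspace (@prod_gens R (subfspace U) n)) _ _ (fun p => F (val (psi p)))).
    by apply: near_all => p /=; rewrite tiE -surjective_pairing.
  apply: fs_fun_near; rewrite /= -URE.
  by apply: (psim.2 (fun e => F (val e))); exact: (@subfspace_val_morphism R E piU).2.
Qed.

Lemma ltriv_trivialization t ti : @ltriv U n t ti ->
  exists phi, @is_trivialization R S E pi fm U n phi.
Proof.
move=> [tK tpi tinv tlin tco tic tim].
have Ue (e : subfspace piU) : U (pi (val e)) by exact: set_mem (valP e).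
have Ux (x : subfspace U) : U (val x) by exact: set_mem (valP x).
have dU := subfspace_ds U dS.
have dUR : is_differential_space UR by have := prod_gen_ds n dU; rewrite /gen_fspace -URE.
pose phi (e : subfspace piU) : UR := (exist _ (pi (val e)) (mem_set (Ue e)), t (val e)).
have piti (p : UR) : piU (ti (val p.1) p.2) by rewrite /preimage /= tpi; exact: Ux.
pose psi (p : UR) : subfspace piU := exist _ (ti (val p.1) p.2) (mem_set (piti p)).
have dpi := subfspace_ds piU dE.
have mval := @subfspace_val_morphism R E piU.
have tn (e : subfspace piU) i : fs_near e (fun e' => t (val e') 0 i).
  by apply: (morphism_near (f := fun e : subfspace piU => val e) (phi := fun e => t e 0 i)) => //; exact: tco.
have m1 : @is_morphism R (subfspace piU) (subfspace U) (fun e => (phi e).1).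
  by apply: morphism_subfspace => //; exact: (is_morphism_comp mpi mval).
have c2 (e : subfspace piU) : {for e, continuous (fun e' : subfspace piU => t (val e'))}.
  by apply: continuous_row => i; apply: (fs_near_continuous dpi); exact: tn.
have cphi e : {for e, continuous phi} by exact: (cvg_pair (m1.1 e) (c2 e)).
have mphi : is_morphism phi.
  apply: is_morphism_near => // e F; rewrite URE => CF.
  apply: (@gen_prod_morphism R (subfspace U) n _ phi) => //.
  - by move=> f Cf; apply: fs_fun_near; exact: m1.2.
  - exact: (fs_fun_near (X := gen_fspace _)).
have mpsi : is_morphism psi.
  apply: morphism_subfspace => //; apply: is_morphism_near => //.
    move=> p; apply: (@continuous_comp _ _ _ (fun p : UR => (val p.1, p.2)) (fun q : S * 'rV[R]_n => ti q.1 q.2)).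
      exact: continuous_val_prod.
    exact: tic.
  move=> [x v] F CF.
  have : @fs_near R (gen_fspace (@prod_gens R (subfspace U) n)) (x, v) (fun p => F (ti (val p.1) p.2)).
    by apply/(@fs_near_prod_open R S n U dS oU x v (fun p => F (ti p.1 p.2))); exact: tim.
  by rewrite /fs_near /= -URE.
exists phi; split => //.
  split=> //; exists psi; split => //.
    by move=> e; apply: val_inj; apply: tK.
  move=> [x v]; congr (_, _); last by apply: tinv; exact: Ux.
  by apply: val_inj; apply: tpi; exact: Ux.
move=> x Uxx /=; split.
  by move=> a u v; exact: (tlin x Uxx a u v).
exists (fun v => exist _ (ti x v) (tpi x v Uxx)).
  by move=> e; apply: fibre_eq; rewrite /= -{1}(svalP e) tK // (svalP e).
by move=> v; rewrite /= tinv.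
Qed.

End local_trivialization.

Lemma linear_sumE (K : pzRingType) (V W : lmodType K) (f : V -> W) : linear f ->
  forall (I : Type) (r : seq I) (P : pred I) (c : I -> K) (v : I -> V),
  f (\sum_(i <- r | P i) c i *: v i) = \sum_(i <- r | P i) c i *: f (v i).
Proof.
move=> lf I r P c v.
pose g : {linear V -> W} := HB.pack f (GRing.isLinear.Build _ _ _ _ f lf).
rewrite -[f]/(g : V -> W) linear_sum; apply: eq_bigr => i _; exact: linearZ.
Qed.

Lemma linear0E (K : pzRingType) (V W : lmodType K) (f : V -> W) : linear f -> f 0 = 0.
Proof.
move=> lf; pose g : {linear V -> W} := HB.pack f (GRing.isLinear.Build _ _ _ _ f lf).
exact: (linear0 g).
Qed.

Section stratifold_facts.
Variables (R : realType) (S : stratifold R).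

Lemma stratifold_atlas k : exists A, @is_stratum_atlas R S k A.
Proof. by case: (st_axioms S). Qed.

Lemma stratifold_stratum x : exists k, stratum S k x.
Proof.
have [_ _ _ _ [n Sn]] := st_axioms S.
have [k _ xk] := @in_stratum R S x n (eq_ind_r (fun A : set S => A x) I Sn).
by exists k.
Qed.

End stratifold_facts.

(** * Sections of a vector bundle *)

Section bundle.
Variables (R : realType) (S : stratifold R) (E : vbundle S).
Local Notation pi := (@vb_proj R S E).
Local Notation dS := (ds_axioms S).
Local Notation dE := (ds_axioms E).

Definition vb_ltriv U n t ti := @ltriv R S E pi (vb_fibre E) U n t ti.

Lemma trivial_cover_ltriv (J : Type) U (n : J -> nat) : trivial_cover (vb_fibre E) U n ->
  [/\ forall a, open (U a), \bigcup_a U a = setT &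
      forall a, exists t ti, @vb_ltriv (U a) (n a) t ti].
Proof.
move=> [oU cU tU]; split => // a; have [phi phiP] := tU a.
exact: (trivialization_ltriv dS (vb_proj_morphism E) (@stratifold_atlas R S) (@stratifold_stratum R S) (oU a) phiP).
Qed.

Lemma vb_ltriv_at x : exists U n t ti, [/\ open U, U x & @vb_ltriv U n t ti].
Proof.
have [J [U [n /trivial_cover_ltriv[oU cU tU]]]] := vb_trivial E.
have : (\bigcup_a U a) x by rewrite cU.
move=> [a _ Ux]; have [t [ti tP]] := tU a.
by exists (U a), (n a), t, ti.
Qed.

Section ltriv.
Variables (U : set S) (n : nat) (t : E -> 'rV[R]_n) (ti : S -> 'rV[R]_n -> E).
Hypotheses (oU : open U) (T : vb_ltriv U t ti).

Lemma ltriv_inj x (u v : vfibre E x) : U x -> t (sval u) = t (sval v) -> u = v.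
Proof.
move=> Ux tuv; apply: fibre_eq.
have h (w : vfibre E x) : sval w = ti x (t (sval w)).
  by rewrite -{2}(svalP w) (lt_K T) // (svalP w).
by rewrite h tuv -h.
Qed.

(** Near [z] the map is recovered from its projection and its fibre coordinates by [ti], so these
    are all that has to be tested. *)
Lemma ltriv_morphism_near (Z : fspace R) (f : Z -> E) z : is_differential_space Z ->
  U (pi (f z)) -> {for z, continuous (pi \o f)} ->
  (forall phi, fs_fun phi -> fs_near z (phi \o (pi \o f))) ->
  (forall i, fs_near z (fun y => t (f y) 0 i)) ->
  {for z, continuous f} /\ forall F, fs_fun F -> fs_near z (F \o f).
Proof.
move=> dZ Uz pc pf tf.
have nz : \forall y \near z, f y = ti (pi (f y)) (t (f y)).
  have : \forall y \near z, U (pi (f y)).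
    by apply: (continuous_near pc); apply: open_nbhs_nbhs.
  by apply: filterS => y Uy; rewrite (lt_K T).
have tc : {for z, continuous (t \o f)}.
  by apply: continuous_row => i; apply: (fs_near_continuous dZ); exact: tf.
have gc : {for z, continuous (fun y => (pi (f y), t (f y)))} by exact: (cvg_pair pc tc).
split.
  move=> B /= nB.
  have cc : {for z, continuous (fun y => ti (pi (f y)) (t (f y)))}.
    by apply: (@continuous_comp _ _ _ (fun y => (pi (f y), t (f y))) (fun q => ti q.1 q.2)) => //; exact: (lt_cont T).
  have := nbhs_singleton nz; rewrite /= => fz; rewrite fz in nB.
  by apply: filterS2 nz (cc _ nB) => y /= fy By; rewrite fy.
move=> F CF; apply: (eq_fs_near (g := fun y => F (ti (pi (f y)) (t (f y))))).
  by apply: filterS nz => y /= <-.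
apply: (@gen_prod_morphism R S n Z (fun y => (pi (f y), t (f y))) z dZ gc pf tf (fun q => F (ti q.1 q.2))).
exact: (@lt_mor _ _ _ _ _ _ _ _ _ T (pi (f z)) (t (f z)) Uz F CF).
Qed.

Lemma section_coord s x i : is_section s -> U x -> fs_near x (fun y => t (s y) 0 i).
Proof.
move=> [ms ps] Ux; apply: (morphism_near (phi := fun e => t e 0 i) ms).
by apply: (lt_coord T); rewrite ps.
Qed.

End ltriv.

Lemma is_section_coord (s : S -> E) : (forall x, pi (s x) = x) ->
  (forall x, exists U n t ti, [/\ open U, U x, @vb_ltriv U n t ti &
     forall i, fs_near x (fun y => t (s y) 0 i)]) -> is_section s.
Proof.
move=> ps sP; split => //.
have pis : pi \o s = id by apply/funext => x /=; rewrite ps.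
have h x : {for x, continuous s} /\ forall F, fs_fun F -> fs_near x (F \o s).
  have [U [n [t [ti [oU Ux T tx]]]]] := sP x.
  apply: (ltriv_morphism_near oU T dS) => //; rewrite ?ps ?pis //.
  by move=> phi Cphi; exact: fs_fun_near.
by apply: (is_morphism_near dS) => x; case: (h x).
Qed.

Lemma is_section_near (s : S -> E) :
  (forall x : S, exists2 r : S -> E, is_section r & \forall y \near x, s y = r y) -> is_section s.
Proof.
move=> sP; split.
  apply: (is_morphism_near dS) => x; have [r [[rc rm] _] sr] := sP x.
    by move=> B; rewrite /= (nbhs_singleton sr) => nB; apply: filterS2 sr (rc x _ nB) => y /= ->.
  move=> F CF; apply: (eq_fs_near (g := F \o r)); last by apply: fs_fun_near; exact: rm.
  by apply: filterS sr => y /= ->.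
by move=> x; have [r [_ pr] /nbhs_singleton ->] := sP x.
Qed.

(** In a local trivialization the pointwise operations become sums and products of coordinate
    functions. *)
Lemma sections_closedP : sections_closed E.
Proof.
have near0 (s : S -> E) (ps : forall x, pi (s x) = x) :
    (forall U n t ti, open U -> @vb_ltriv U n t ti ->
      forall x, U x -> forall i, fs_near x (fun y => t (s y) 0 i)) -> is_section s.
  move=> h; apply: is_section_coord => // x.
  have [U [n [t [ti [oU Ux T]]]]] := vb_ltriv_at x.
  by exists U, n, t, ti; split => //; exact: (h U n t ti).
have nU (U : set S) x : open U -> U x -> \forall y \near x, U y.
  by move=> oU Ux; exact: open_nbhs_nbhs.
have tD U n (t : E -> 'rV[R]_n) ti : vb_ltriv U t ti -> forall x a (u v : vfibre E x), U x ->
    t (sval (a *: u + v)) = a *: t (sval u) + t (sval v).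
  by move=> T x a u v Ux; exact: (lt_lin T Ux).
split.
- apply: near0 => [x|U n t ti oU T x Ux i]; first exact: (svalP (0 : vfibre E x)).
  apply: (eq_fs_near (g := fun=> 0)); last exact: fs_near_cst dS x 0.
  apply: filterS (nU U x oU Ux) => y Uy.
  by rewrite (linear0E (lt_lin T Uy)) mxE.
- move=> s r; apply: near0 => [x|U n t ti oU T x Ux i]; first exact: (svalP (sec_at s x + sec_at r x)).
  apply: (eq_fs_near (g := fun y => t (sval s y) 0 i + t (sval r y) 0 i)); last first.
    apply: (fs_nearD dS); apply: (section_coord T) Ux; exact: svalP.
  apply: filterS (nU U x oU Ux) => y Uy.
  by have := tD _ _ _ _ T y 1 (sec_at s y) (sec_at r y) Uy; rewrite !scale1r => ->; rewrite mxE.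
- move=> a s; apply: near0 => [x|U n t ti oU T x Ux i]; first exact: (svalP (val a x *: sec_at s x)).
  apply: (eq_fs_near (g := fun y => val a y * t (sval s y) 0 i)); last first.
    apply: (fs_nearM dS); last by apply: (section_coord T) Ux; exact: svalP.
    by apply: fs_fun_near; exact: set_mem (valP a).
  apply: filterS (nU U x oU Ux) => y Uy.
  have := tD _ _ _ _ T y (val a y) (sec_at s y) 0 Uy.
  by rewrite addr0 => ->; rewrite (linear0E (lt_lin T Uy)) addr0 mxE.
Qed.

End bundle.

Section cutoff.
Variables (R : realType) (S : stratifold R) (E : vbundle S).
Local Notation pi := (@vb_proj R S E).
Local Notation dS := (ds_axioms S).
Local Notation dE := (ds_axioms E).
Variables (U : set S) (n : nat) (t : E -> 'rV[R]_n) (ti : S -> 'rV[R]_n -> E).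
Hypotheses (oU : open U) (T : vb_ltriv U t ti).
Variables (lam : S -> R).
Hypotheses (Clam : fs_fun lam) (supp : closure [set y | lam y != 0] `<=` U).

Lemma cutoff_near0 x : ~ U x -> \forall y \near x, lam y = 0.
Proof.
move=> nU; have : ~ closure [set y | lam y != 0] x by move=> /supp.
move=> /existsNP[B /not_implyP[nB AB]]; apply: filterS nB => y By.
by apply/eqP; apply: contra_notT AB => ly; exists y.
Qed.

(** The section with constant coordinates [v] in the trivialization, damped by [lam] and extended by
    zero off [U]. *)
Definition cutoff_section (v : 'rV[R]_n) (x : S) : E :=
  if pselect (U x) then ti x (lam x *: v) else sval (0 : vfibre E x).

Lemma cutoff_section_proj v x : pi (cutoff_section v x) = x.
Proof.
rewrite /cutoff_section; case: (pselect (U x)) => [Ux|_] /=; first exact: (lt_pi T).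
exact: (svalP (0 : vfibre E x)).
Qed.

Lemma cutoff_section_coord v x : U x -> t (cutoff_section v x) = lam x *: v.
Proof.
by move=> Ux; rewrite /cutoff_section; case: (pselect (U x)) => [_|//] /=; exact: (lt_inv T).
Qed.

Lemma cutoff_section_eq0 v x : lam x = 0 -> cutoff_section v x = sval (0 : vfibre E x).
Proof.
move=> l0; have [Ux|nU] := pselect (U x); last by rewrite /cutoff_section; case: (pselect (U x)) => [//|_] /=.
pose c : vfibre E x := exist _ (cutoff_section v x) (cutoff_section_proj v x).
suff -> : 0 = c by [].
apply: (ltriv_inj T Ux); rewrite /= cutoff_section_coord // l0 scale0r.
exact: (linear0E (lt_lin T Ux)).
Qed.

Lemma cutoff_section_is_section v : is_section (cutoff_section v).
Proof.
have [c0 _ _] := sections_closedP E.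
apply: is_section_coord => [x|x]; first exact: cutoff_section_proj.
have [Ux|nU] := pselect (U x).
  exists U, n, t, ti; split => // i.
  apply: (eq_fs_near (g := fun y => lam y * v 0 i)).
    have : \forall y \near x, U y by exact: open_nbhs_nbhs.
    by apply: filterS => y Uy; rewrite cutoff_section_coord // mxE.
  by apply: (fs_nearM dS); [exact: fs_fun_near|exact: (fs_near_cst dS)].
have [V [m [u [ui [oV Vx T']]]]] := vb_ltriv_at E x.
exists V, m, u, ui; split => // i.
apply: (eq_fs_near (g := fun y => u (sval (0 : vfibre E y)) 0 i)).
  by apply: filterS (cutoff_near0 nU) => y y0; rewrite cutoff_section_eq0.
exact: (section_coord T' i c0 Vx).
Qed.

(** The dual counterpart of [cutoff_section]: fibre coordinates become global functions on [E] once
    multiplied by [lam]. *)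
Lemma cutoff_coord (i : 'I_n) : fs_fun (fun e : E => lam (pi e) * t e 0 i).
Proof.
apply: (fs_nearP dE) => e; have [Ux|nU] := pselect (U (pi e)).
  apply: (fs_nearM dE); last exact: (lt_coord T).
  by apply: (morphism_near (vb_proj_morphism E)); exact: fs_fun_near.
apply: (eq_fs_near (g := fun=> 0)); last exact: (fs_near_cst dE).
have := continuous_near ((vb_proj_morphism E).1 e) (cutoff_near0 nU).
by apply: filterS => y ->; rewrite mul0r.
Qed.

End cutoff.

(** * Finite frames *)

(** A finite dual basis: the [q i] play the role of sections of the dual bundle, kept as fibrewise
    linear functions on the total space. *)
Definition frame (R : realType) (S : stratifold R) (E : vbundle S) (I : finType)
    (b : I -> gsection E) (q : I -> E -> R) : Prop :=
  [/\ forall i, fs_fun (q i),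
      forall i x, linear ((fun e => q i (sval e)) : vfibre E x -> R^o) &
      forall x (e : vfibre E x), e = \sum_i q i (sval e) *: sec_at (b i) x].

Section locally_finite.
Variables (V : zmodType) (F : nat -> V).

Lemma sum_stable (A B : nat) : (forall j, (A <= j)%N -> F j = 0) ->
  (forall j, (B <= j)%N -> F j = 0) -> \sum_(j < A) F j = \sum_(j < B) F j.
Proof.
have aux A' B' : (A' <= B')%N -> (forall j, (A' <= j)%N -> F j = 0) ->
    \sum_(j < A') F j = \sum_(j < B') F j.
  move=> AB h; rewrite -(subnKC AB) big_split_ord /= [X in _ + X]big1 ?addr0 //.
  by move=> j _; apply: h; rewrite leq_addr.
move=> hA hB; case/orP: (leq_total A B) => AB; first exact: aux.
by apply/esym; exact: aux.
Qed.

End locally_finite.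

Section module_of_sections.
Variables (R : realType) (S : dspace R) (E : vbundle S) (cE : sections_closed E).

Lemma sec_at_sum (I : Type) (r : seq I) (P : pred I) (s : I -> Gamma cE) x :
  sec_at (\sum_(i <- r | P i) s i) x = \sum_(i <- r | P i) sec_at (s i) x.
Proof.
have [+ +] : (forall s r : Gamma cE, sec_at (s + r) x = sec_at s x + sec_at r x) /\
    sec_at (0 : Gamma cE) x = 0 by split; [move=> *; exact: sec_addE|exact: sec0E].
move=> hD h0; elim: r => [|i r IH]; first by rewrite !big_nil h0.
by rewrite !big_cons; case: (P i); rewrite ?hD IH.
Qed.

End module_of_sections.

Section frame.
Variables (R : realType) (S : stratifold R) (E : vbundle S).
Local Notation pi := (@vb_proj R S E).
Local Notation dS := (ds_axioms S).
Local Notation dE := (ds_axioms E).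
Local Notation cE := (sections_closedP E).

(** For colour [i] and [k < N] let [b] be the locally finite sum over [j] of the [k]-th basis
    section over the [j]-th set, damped by [lam i j], and let [q] be the corresponding sum of damped
    [k]-th coordinates, divided by the sum [Lam] of all squares of the [lam i j]. In one colour at
    most one [j] contributes at a point, so there are no cross terms and colour [i] reproduces [e]
    with the weight [lam i j ^+ 2 / Lam]; these weights add up to 1. *)
Lemma bounded_rank_frame : bounded_rank E -> exists (I : finType) b q, @frame R S E I b q.
Proof.
move=> [J [U [n [/trivial_cover_ltriv[oU covU triv] [N nN]]]]].
have [[x0]|nS] := pselect (inhabited S); last first.
  (* Over an empty base the empty family is a frame. *)
  exists 'I_0, (fun i : 'I_0 => False_rect _ (notF (ltn_ord i))), (fun=> fun=> 0).
  by split=> [[]|[]|x] //; case: nS.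
have [[lcS hS scS] _ bumpS aS [d Sd]] := st_axioms S.
have [a [lam [Clam suppl disj lfin lpos]]] := level_cover dS scS bumpS (thin_setT aS Sd) oU covU x0.
have /choice[K KP] := lfin.
have [t tT] : {t : forall a, E -> 'rV[R]_(n a) | forall a, exists ti, vb_ltriv (U a) (t a) ti}.
  by exists (fun a => sval (cid (triv a))) => c; exact: svalP (cid (triv c)).
have [ti T] : {ti : forall a, S -> 'rV[R]_(n a) -> E | forall a, vb_ltriv (U a) (t a) (ti a)}.
  by exists (fun a => sval (cid (tT a))) => c; exact: svalP (cid (tT c)).
have K0 x i j : (K x <= j)%N -> lam i j x = 0.
  by move=> Kj; exact: (nbhs_singleton (KP x)).
(* The [e]-th basis vector of [R^N] truncated to the rank of the [j]-th trivialization, hence 0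
   beyond that rank; [tau] pads coordinates with zeros to length [N] accordingly. *)
pose del j (e : 'I_N) : 'rV[R]_(n (a j)) := delta_mx 0 e *m pid_mx (n (a j)).
pose sg i j e : gsection E := exist _ _ (cutoff_section_is_section (oU (a j)) (T (a j)) (Clam i j) (suppl i j) (del j e)).
pose tau j (w : E) (e : 'I_N) : R := (t (a j) w *m (pid_mx (n (a j)) : 'M[R]_(n (a j), N))) 0 e.
pose Lam x := \sum_(i < d.+1) \sum_(j < K x) lam i j x ^+ 2.
pose bs (i : 'I_d.+1 * 'I_N) x : vfibre E x := \sum_(j < K x) sec_at (sg i.1 j i.2) x.
pose q (i : 'I_d.+1 * 'I_N) w := (\sum_(j < K (pi w)) lam i.1 j (pi w) * tau j w i.2) / Lam (pi w).
have sg0 i j e x : lam i j x = 0 -> sec_at (sg i j e) x = 0.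
  by move=> l0; apply: fibre_eq; exact: (cutoff_section_eq0 (T (a j))).
have bsP i : is_section (fun x => sval (bs i x)).
  apply: is_section_near => x; exists (sval (\sum_(j < K x) (sg i.1 j i.2 : Gamma cE))); first exact: svalP.
  apply: filterS (KP x) => y ly.
  rewrite -[RHS]/(sval (sec_at (\sum_(j < K x) (sg i.1 j i.2 : Gamma cE)) y)) sec_at_sum; congr sval.
  by apply: (sum_stable (F := fun j => sec_at (sg i.1 j i.2) y)) => j lj; apply: sg0; [exact: K0|exact: ly].
have near_pi e (P : S -> Prop) : (\forall y \near pi e, P y) -> \forall w \near e, P (pi w).
  by move=> h; apply: (continuous_near ((vb_proj_morphism E).1 e) h).
have LamE x : \forall y \near x, Lam y = \sum_(i < d.+1) \sum_(j < K x) lam i j y ^+ 2.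
  apply: filterS (KP x) => y ly; apply: eq_bigr => i _.
  by apply: (sum_stable (F := fun j => lam i j y ^+ 2)) => j lj; (suff -> : lam i j y = 0 by rewrite expr2 mul0r); first [exact: K0|exact: ly].
have Lam_gt0 x : 0 < Lam x.
  have [i [j [id lij]]] := lpos x.
  have jK : (j < K x)%N by rewrite ltnNge; apply/negP => /K0 h; rewrite h eqxx in lij.
  have h2 k l : 0 <= lam k l x ^+ 2 by exact: sqr_ge0.
  rewrite /Lam (bigD1 (Ordinal id)) //= ltr_wpDr //.
    by apply: sumr_ge0 => k _; exact: sumr_ge0.
  rewrite (bigD1 (Ordinal jK)) //= ltr_wpDr //; first by apply: sumr_ge0.
  by rewrite lt_neqAle h2 andbT eq_sym sqrf_eq0.
have CLam x : fs_near x Lam.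
  apply: (eq_fs_near (LamE x)); apply: (fs_near_sum dS) => i _; apply: (fs_near_sum dS) => j _.
  by apply: (fs_nearM dS); exact: fs_fun_near.
have tau_lin x i j : lam i j x != 0 -> linear ((fun e => t (a j) (sval e)) : vfibre E x -> 'rV[R]_(n (a j))).
  move=> l0; apply: (lt_lin (T (a j))).
  by apply: (suppl i j); apply: subset_closure.
exists ('I_d.+1 * 'I_N)%type, (fun i => exist _ _ (bsP i)), q; split.
- move=> i; apply: (fs_nearP dE) => w.
  apply: (fs_nearM dE); last first.
    apply: (fs_nearV dE); last by rewrite gt_eqF.
    by apply: (morphism_near (vb_proj_morphism E)).
  apply: (eq_fs_near (g := fun w' => \sum_(j < K (pi w)) lam i.1 j (pi w') * tau j w' i.2)).
    apply: filterS (near_pi _ _ (KP (pi w))) => y ly.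
    by apply: (sum_stable (F := fun j => lam i.1 j (pi y) * tau j y i.2)) => j lj; (suff -> : lam i.1 j (pi y) = 0 by rewrite mul0r); first [exact: K0|exact: ly].
  apply: (fs_near_sum dE) => j _.
  apply: (eq_fs_near (g := fun w' => \sum_k (lam i.1 j (pi w') * t (a j) w' 0 k) * (pid_mx (n (a j)) : 'M[R]_(n (a j), N)) k i.2)).
    by apply: near_all => y; rewrite /tau mxE mulr_sumr; apply: eq_bigr => k _; rewrite mulrA.
  apply: (fs_near_sum dE) => k _; apply: (fs_nearM dE); last exact: (fs_near_cst dE).
  apply: fs_fun_near; exact: (cutoff_coord (T (a j)) (Clam _ _) (suppl _ _)).
- move=> i x c u v /=; rewrite /q !(svalP u) !(svalP v) (svalP (c *: u + v)).
  rewrite -[RHS]/(c * _ + _) mulrA -mulrDl mulr_sumr -big_split /=; congr (_ / _).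
  apply: eq_bigr => j _; have [->|l0] := eqVneq (lam i.1 j x) 0; first by rewrite !mul0r mulr0 addr0.
  rewrite /tau (tau_lin x i.1 j l0) mulmxDl -scalemxAl !mxE; ring.
- move=> x e.
  (* If some [lam i j0 x] is nonzero, all other terms of colour [i] vanish at [x], and the identity
     is checked in the trivialization of [j0]. *)
  have key (i : 'I_d.+1) : \sum_(k < N) (\sum_(j < K x) lam i j x * tau j (sval e) k) *: bs (i, k) x =
      (\sum_(j < K x) lam i j x ^+ 2) *: e.
    have [[j0 l0]|nl] := pselect (exists j : 'I_(K x), lam i j x != 0); last first.
      have z (j : 'I_(K x)) : lam i j x = 0 by apply/eqP; apply: contra_notT nl; exists j.
      rewrite [X in _ = X *: _]big1 ?scale0r; last by move=> j _; rewrite z expr2 mul0r.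
      by apply: big1 => k _; rewrite big1 ?scale0r // => j _; rewrite z mul0r.
    have z (j : 'I_(K x)) : j != j0 -> lam i j x = 0.
      move=> jj; have := disj i j0 j x; rewrite eq_sym => /(_ jj) /eqP.
      by rewrite mulf_eq0 (negPf l0) => /eqP.
    rewrite [X in _ = X *: _](bigD1 j0) //= big1 ?addr0; last by move=> j /z ->; rewrite expr2 mul0r.
    have Ux : U (a j0) x by apply: (suppl i j0); apply: subset_closure.
    apply: (ltriv_inj (T (a j0)) Ux).
    have lin := tau_lin x i j0 l0.
    have linZ c (u : vfibre E x) : t (a j0) (sval (c *: u)) = c *: t (a j0) (sval u).
      by rewrite -[c *: u]addr0 lin (linear0E lin) addr0.
    rewrite (linear_sumE lin) linZ.
    under eq_bigr => k _.
      rewrite (bigD1 j0) //= [X in _ + X]big1 ?addr0; last by move=> j /z ->; rewrite mul0r.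
      have -> : bs (i, k) x = sec_at (sg i j0 k) x.
        rewrite /bs (bigD1 j0) // big1; first exact: addr0.
        by move=> j /z; exact: sg0.
      rewrite /= (cutoff_section_coord (T (a j0))) // scalerA.
      over.
    set w := t (a j0) (sval e).
    transitivity (\sum_(k < N) lam i j0 x ^+ 2 *: ((w *m pid_mx (n (a j0))) 0 k *: del j0 k)).
      by apply: eq_bigr => k _; rewrite scalerA; congr (_ *: _); rewrite /tau -/w; ring.
    rewrite -scaler_sumr; congr (_ *: _).
    under eq_bigr => k _ do rewrite /del scalemxAl.
    (* Padding to length [N] and truncating again is the identity because the rank is at most
       [N]. *)
    by rewrite -mulmx_suml -row_sum_delta -mulmxA pid_mx_id ?nN // pid_mx_1 mulmx1.
  transitivity (\sum_(i < d.+1) (Lam x)^-1 *: ((\sum_(j < K x) lam i j x ^+ 2) *: e)).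
    rewrite -scaler_sumr -scaler_suml scalerA mulVf ?scale1r //.
    by rewrite gt_eqF // Lam_gt0.
  transitivity (\sum_(i < d.+1) \sum_(k < N) q (i, k) (sval e) *: sec_at (exist _ _ (bsP (i, k))) x).
    apply: eq_bigr => i _; rewrite -key scaler_sumr; apply: eq_bigr => k _.
    rewrite /q (svalP e) scalerA [X in X *: _]mulrC; congr (_ *: _).
    exact: fibre_eq.
  by rewrite pair_bigA; apply: eq_bigr => -[i k] _.
Qed.

End frame.

(** * Projectivity and full faithfulness from a frame *)

Section frame_module.
Variables (R : realType) (S : stratifold R) (E : vbundle S) (cE : sections_closed E).
Variables (I : finType) (b : I -> gsection E) (q : I -> E -> R).
Hypothesis fr : frame b q.
Local Notation dE := (ds_axioms E).

Lemma frame_coef_fun i (s : gsection E) : (q i \o sval s) \in @structure_fun R S.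
Proof. by apply/mem_set; have [Cq _ _] := fr; exact: (svalP s).1.2. Qed.

Definition frame_coef i (s : Gamma cE) : algebra S :=
  exist (fun f => f \in @structure_fun R S) _ (frame_coef_fun i s).

Lemma frame_coef_linear i : linear (frame_coef i : Gamma cE -> (algebra S)^o).
Proof.
move=> a s t; apply: val_inj; apply/funext => x; have [_ qlin _] := fr.
transitivity (q i (sval (val a x *: sec_at s x + sec_at t x))).
  by rewrite -sec_scaleE -sec_addE.
exact: qlin.
Qed.

Lemma frame_decomp (s : Gamma cE) : s = \sum_i frame_coef i s *: (b i : Gamma cE).
Proof.
apply: gsection_ext => x; rewrite sec_at_sum; have [_ _ h] := fr; rewrite [LHS]h.
by apply: eq_bigr => i _; rewrite sec_scaleE.
Qed.

(** The dual basis lemma: lift the images of the [b i] and extend by the coefficient functions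
    [frame_coef]. *)
Lemma frame_fgp : is_fgp (Gamma cE).
Proof.
split.
  exists #|I|, (fun i => b (enum_val i)) => s.
  exists (fun i => frame_coef (enum_val i) s); rewrite [LHS]frame_decomp.
  by rewrite (reindex_onto enum_val enum_rank) => [|i _]; rewrite ?enum_rankK //=; apply: eq_bigl => i; rewrite enum_valK eqxx.
move=> M N g f gsurj.
have [y yP] := choice (fun i => gsurj (f (b i))).
pose h (s : Gamma cE) : M := \sum_i frame_coef i s *: y i.
have hl : linear h.
  move=> a s t; rewrite /h scaler_sumr -big_split /=; apply: eq_bigr => i _.
  by rewrite frame_coef_linear scalerDl scalerA.
pose H : {linear Gamma cE -> M} := HB.pack h (GRing.isLinear.Build _ _ _ _ h hl).
exists H => s; rewrite -[H s]/(h s).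
rewrite [in RHS](frame_decomp s) /h !linear_sum; apply: eq_bigr => i _.
by rewrite !linearZ /= yP.
Qed.

Variables (F : vbundle S) (cF : sections_closed F).

(** Every vector is a combination of values of the global sections [b i], on which [f] and [g]
    agree. *)
Lemma push_inj (f g : vb_hom E F) :
  (forall s : Gamma cE, push cF f s = push cF g s) -> f = g.
Proof.
move=> fg; apply: vb_hom_ext => w.
pose x := vb_proj w; pose e : vfibre E x := exist _ w erefl.
have fb i : fibre_map (vbh_proj f) (sec_at (b i) x) = fibre_map (vbh_proj g) (sec_at (b i) x).
  by apply: fibre_eq; exact: (congr1 (fun s : gsection F => sval s x) (fg (b i))).
have [_ _ /(_ x e) eE] := fr.
suff : fibre_map (vbh_proj f) e = fibre_map (vbh_proj g) e by move=> /(congr1 sval).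
rewrite eE (linear_sumE (@vbh_linear _ _ _ _ f x)) (linear_sumE (@vbh_linear _ _ _ _ g x)).
by apply: eq_bigr => i _; rewrite fb.
Qed.

(** The bundle map sends [w] over [x] to the sum of the [q i w] times the value of [Phi (b i)] at
    [x]. On a section [s] this is [Phi s], because [Phi] is linear over the structure algebra and
    [s] is the combination of the [b i] with coefficients [q i \o s]. *)
Lemma push_surj (Phi : {linear Gamma cE -> Gamma cF}) :
  exists f : vb_hom E F, forall s, push cF f s = Phi s.
Proof.
have [Cq qlin qE] := fr.
pose c w : vfibre F (vb_proj w) := \sum_i q i w *: sec_at (Phi (b i)) (vb_proj w).
pose f w : F := sval (c w).
have fp w : vb_proj (f w) = vb_proj w by exact: (svalP (c w)).
have fE x (e : vfibre E x) : fibre_map fp e = \sum_i q i (sval e) *: sec_at (Phi (b i)) x.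
  by case: e => w wx; case: x / wx; apply: fibre_eq.
have fl x : linear (@fibre_map R S E F f fp x).
  move=> a u v; rewrite !fE scaler_sumr -big_split /=; apply: eq_bigr => i _.
  by rewrite qlin scalerDl scalerA.
have fpE : @vb_proj R S F \o f = @vb_proj R S E by apply/funext => w; exact: fp.
have fn w : {for w, continuous f} /\ forall G, fs_fun G -> fs_near w (G \o f).
  have [U [n [t [ti [oU Ux T]]]]] := vb_ltriv_at F (vb_proj w).
  apply: (ltriv_morphism_near oU T dE); rewrite ?fp ?fpE //.
  - exact: (vb_proj_morphism E).1.
  - by move=> phi Cphi; apply: fs_fun_near; exact: (vb_proj_morphism E).2.
  move=> k; apply: (eq_fs_near (g := fun w => \sum_i q i w * t (sval (Phi (b i)) (vb_proj w)) 0 k)).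
    have nU : \forall x \near vb_proj w, U x by exact: open_nbhs_nbhs.
    have := continuous_near ((vb_proj_morphism E).1 w) nU; apply: filterS => w' Uw.
    rewrite /f /c (linear_sumE (lt_lin T Uw)) summxE; apply: eq_bigr => i _.
    by rewrite mxE.
  apply: (fs_near_sum dE) => i _; apply: (fs_nearM dE); first exact: fs_fun_near.
  apply: (morphism_near (f := @vb_proj R S E) (phi := fun x => t (sval (Phi (b i)) x) 0 k)).
    exact: vb_proj_morphism.
  apply: (section_coord T) Ux; exact: svalP.
have fm : is_morphism f by apply: (is_morphism_near dE) => w; case: (fn w).
exists (VBHom fm fl) => s; apply: gsection_ext => x.
have -> : sec_at (push cF (VBHom fm fl) s) x = fibre_map fp (sec_at s x) by exact: fibre_eq.
rewrite fE {2}[s]frame_decomp linear_sum sec_at_sum; apply: eq_bigr => i _.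
by rewrite linearZ /= sec_scaleE.
Qed.

End frame_module.

(** * Matrices of functions *)

Section evaluation.
Variables (R : realType) (S : dspace R).
Local Notation dS := (ds_axioms S).

Definition eval_at (x : S) (a : algebra S) : R := val a x.

Lemma eval_at_is_additive x : zmod_morphism (eval_at x).
Proof. by move=> a b. Qed.

Lemma eval_at_is_multiplicative x : monoid_morphism (eval_at x).
Proof. by split. Qed.

HB.instance Definition _ x := GRing.isZmodMorphism.Build _ _ (eval_at x) (eval_at_is_additive x).
HB.instance Definition _ x := GRing.isMonoidMorphism.Build _ _ (eval_at x) (eval_at_is_multiplicative x).

Lemma algebra_ext (a b : algebra S) : (forall x, eval_at x a = eval_at x b) -> a = b.
Proof. by move=> ab; apply: val_inj; apply/funext. Qed.

Lemma eval_at_fun (a : algebra S) : fs_fun (fun x => eval_at x a).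
Proof. exact: set_mem (valP a). Qed.

End evaluation.

Section matrix_functions.
Variables (R : realType) (X : fspace R).
Hypothesis dX : is_differential_space X.

Definition mx_near (x : X) m n (M : X -> 'M[R]_(m, n)) : Prop :=
  forall i j, fs_near x (fun y => M y i j).

Lemma mx_near_cst x m n (M : 'M[R]_(m, n)) : mx_near x (fun=> M).
Proof. by move=> i j; exact: fs_near_cst. Qed.

Lemma mx_nearD x m n (M N : X -> 'M[R]_(m, n)) : mx_near x M -> mx_near x N ->
  mx_near x (fun y => M y + N y).
Proof.
move=> Mx Nx i j; apply: (eq_fs_near (g := fun y => M y i j + N y i j)).
  by apply: near_all => y; rewrite mxE.
exact: fs_nearD.
Qed.

Lemma mx_nearN x m n (M : X -> 'M[R]_(m, n)) : mx_near x M -> mx_near x (fun y => - M y).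
Proof.
move=> Mx i j; apply: (eq_fs_near (g := fun y => - M y i j)).
  by apply: near_all => y; rewrite mxE.
exact: fs_nearN.
Qed.

Lemma mx_nearM x m n p (M : X -> 'M[R]_(m, n)) (N : X -> 'M[R]_(n, p)) :
  mx_near x M -> mx_near x N -> mx_near x (fun y => M y *m N y).
Proof.
move=> Mx Nx i j; apply: (eq_fs_near (g := fun y => \sum_k M y i k * N y k j)).
  by apply: near_all => y; rewrite mxE.
by apply: (fs_near_sum dX) => k _; apply: (fs_nearM dX).
Qed.

Lemma fs_near_det x n (M : X -> 'M[R]_n) : mx_near x M -> fs_near x (fun y => \det (M y)).
Proof.
move=> Mx; apply: (fs_near_sum dX) => s _; apply: (fs_nearM dX); first exact: fs_near_cst.
by apply: (@fs_near_prod _ _ dX x _ _ _ (fun i y => M y i (perm.fun_of_perm.body s i))) => i _; exact: Mx.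
Qed.

Lemma unitmx_near x n (M : X -> 'M[R]_n) : mx_near x M -> M x \in unitmx ->
  \forall y \near x, M y \in unitmx.
Proof.
move=> Mx; rewrite unitmxE unitfE => ux.
have : \forall y \near x, \det (M y) != 0.
  apply: (continuous_near (P := fun d => d != 0) (fs_near_continuous dX (fs_near_det Mx))).
  by apply: open_nbhs_nbhs; split => //; exact: open_neq.
by apply: filterS => y; rewrite unitmxE unitfE.
Qed.

(** Cramer's rule, the determinant being nonzero near [x]. *)
Lemma mx_nearV x n (M : X -> 'M[R]_n) : mx_near x M -> M x \in unitmx ->
  mx_near x (fun y => invmx (M y)).
Proof.
move=> Mx ux i j.
apply: (eq_fs_near (g := fun y => (\det (M y))^-1 * ((-1) ^+ (j + i) * \det (row' j (col' i (M y)))))).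
  by apply: filterS (unitmx_near Mx ux) => y uy; rewrite /invmx uy !mxE.
apply: (fs_nearM dX).
  by apply: (fs_nearV dX); [exact: fs_near_det|rewrite -unitfE -unitmxE].
apply: (fs_nearM dX); first exact: fs_near_cst.
apply: (@fs_near_det x _ (fun y => row' j (col' i (M y)))) => k l.
by apply: (eq_fs_near (g := fun y => M y (lift j k) (lift i l))) => //; apply: near_all => y; rewrite !mxE.
Qed.

Lemma mx_near_continuous x n (M : X -> 'rV[R]_n) : mx_near x M -> {for x, continuous M}.
Proof.
by move=> Mx; apply: continuous_row => i; apply: (fs_near_continuous dX).
Qed.

End matrix_functions.

Lemma mx_near_comp (R : realType) (X Y : fspace R) (f : X -> Y) x m n (M : Y -> 'M[R]_(m, n)) :
  is_morphism f -> mx_near (f x) M -> mx_near x (M \o f).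
Proof. by move=> fm Mx i j; exact: (morphism_near fm (Mx i j)). Qed.

(** In a full-rank factorization [C D] of an idempotent, [C] can be cancelled on the left and [D] on
    the right of [C D C D = C D]. *)
Lemma idempotent_base (F : fieldType) n (e : 'M[F]_n) : e *m e = e ->
  row_base e *m col_base e = 1%:M.
Proof.
have aux r (C : 'M[F]_(n, r)) (D : 'M[F]_(r, n)) C' D' : C' *m C = 1%:M -> D *m D' = 1%:M ->
    (C *m D) *m (C *m D) = C *m D -> D *m C = 1%:M.
  move=> C1 D1 /(congr1 (fun M => C' *m M *m D')).
  by rewrite !mulmxA C1 !mul1mx -!mulmxA D1 !mulmx1.
move=> ee; have /row_fullP[B BC] := col_base_full e; have /row_freeP[C RC] := row_base_free e.
by apply: aux BC RC _; rewrite mulmx_base.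
Qed.

(** * The bundle of an idempotent matrix *)

Section idempotent_bundle.
Variables (R : realType) (S : stratifold R) (n : nat) (e : 'M[algebra S]_n).
Hypothesis ee : e *m e = e.
Local Notation dS := (ds_axioms S).
Local Notation G := (gen_fspace (@prod_gens R S n)).
Let dG : is_differential_space G := prod_gen_ds n dS.

Definition idem_at (x : S) : 'M[R]_n := map_mx (@eval_at R S x) e.

Lemma idem_atM x : idem_at x *m idem_at x = idem_at x.
Proof. by rewrite -map_mxM ee. Qed.

Lemma idem_at_near x : @mx_near R S x n n idem_at.
Proof.
move=> i j; apply: (eq_fs_near (g := fun y => eval_at y (e i j))).
  by apply: near_all => y; rewrite mxE.
by apply: fs_fun_near; exact: eval_at_fun.
Qed.

(** The fibre over [x] is the image of the idempotent at [x], acting on row vectors from the right;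
    an image vector is one that is fixed. *)
Definition idem_set : set G := [set p | p.2 *m idem_at p.1 = p.2].

Definition idem_total : dspace R := DSpace (subfspace_ds idem_set dG).

Definition idem_proj (w : idem_total) : S := (val w).1.

Definition idem_vec (w : idem_total) : 'rV[R]_n := (val w).2.

Lemma idem_vecK w : idem_vec w *m idem_at (idem_proj w) = idem_vec w.
Proof. exact: set_mem (valP w). Qed.

Lemma idem_mk_subproof x (v : 'rV[R]_n) : idem_set (x, v *m idem_at x).
Proof. by rewrite /idem_set /= -mulmxA idem_atM. Qed.

Definition idem_mk x (v : 'rV[R]_n) : idem_total := exist _ (x, v *m idem_at x) (mem_set (idem_mk_subproof x v)).

Lemma idem_ext (w w' : idem_total) : idem_proj w = idem_proj w' -> idem_vec w = idem_vec w' -> w = w'.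
Proof. by move=> h1 h2; apply: val_inj; rewrite [LHS]surjective_pairing [RHS]surjective_pairing; congr (_, _). Qed.

Lemma idem_proj_morphism : is_morphism idem_proj.
Proof.
exact: (is_morphism_comp (@fst_morphism R S n) (@subfspace_val_morphism R G idem_set)).
Qed.

Lemma idem_vec_near w : @mx_near R idem_total w 1 n idem_vec.
Proof.
move=> i j; rewrite ord1; apply: fs_fun_near.
apply: ((@subfspace_val_morphism R G idem_set).2 (fun p => p.2 0 j)).
by apply: smgen_sub; right; exists j.
Qed.

Lemma idem_mk_morphism (X : fspace R) (f : X -> S) (v : X -> 'rV[R]_n) :
  is_differential_space X -> is_morphism f -> (forall x, mx_near x v) ->
  is_morphism (fun x => idem_mk (f x) (v x) : idem_total).
Proof.
move=> dX fm vn; apply: (@morphism_subfspace R G idem_set) => //.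
have wn x : @mx_near R X x 1 n (fun y => v y *m idem_at (f y)).
  by apply: (mx_nearM dX) => //; apply: (mx_near_comp fm); exact: idem_at_near.
have pc x : {for x, continuous (fun y => (f y, v y *m idem_at (f y)))}.
  exact: (cvg_pair (fm.1 x) (mx_near_continuous dX (wn x))).
apply: (is_morphism_near dX) => // x F CF.
apply: (@gen_prod_morphism R S n X (fun y => (f y, v y *m idem_at (f y)))) => //.
- by move=> phi Cphi; apply: fs_fun_near; exact: fm.2.
- by move=> i; exact: wn.
- exact: fs_fun_near.
Qed.

Definition idem_fibre x : Type := fibre idem_proj x.

Section fibre_module.
Variable x : S.
Local Notation T := (idem_fibre x).

Definition fib_vec (w : T) : 'rV[R]_n := idem_vec (sval w).

Definition fib_mk (v : 'rV[R]_n) : T := exist _ (idem_mk x v) erefl.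

Lemma fib_mkE v : fib_vec (fib_mk v) = v *m idem_at x. Proof. by []. Qed.

Lemma fib_vecK w : fib_vec w *m idem_at x = fib_vec w.
Proof. by case: w => w wx; rewrite /fib_vec /= -wx; exact: idem_vecK. Qed.

Lemma fib_ext w w' : fib_vec w = fib_vec w' -> w = w'.
Proof.
by move=> h; apply: fibre_eq; apply: idem_ext => //; rewrite (svalP w) (svalP w').
Qed.

(** The operations project again through [fib_mk]; this changes nothing on fixed vectors and makes
    membership in the fibre automatic. *)
Definition fib_add w w' := fib_mk (fib_vec w + fib_vec w').
Definition fib_opp w := fib_mk (- fib_vec w).
Definition fib_scale a w := fib_mk (a *: fib_vec w).

Let addE w w' : fib_vec (fib_add w w') = fib_vec w + fib_vec w'.
Proof. by rewrite fib_mkE mulmxDl !fib_vecK. Qed.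
Let oppE w : fib_vec (fib_opp w) = - fib_vec w.
Proof. by rewrite fib_mkE mulNmx fib_vecK. Qed.
Let scaleE a w : fib_vec (fib_scale a w) = a *: fib_vec w.
Proof. by rewrite fib_mkE -scalemxAl fib_vecK. Qed.
Let zeroE : fib_vec (fib_mk 0) = 0.
Proof. by rewrite fib_mkE mul0mx. Qed.

HB.instance Definition _ := gen_eqMixin T.
HB.instance Definition _ := gen_choiceMixin T.

Let addA : associative fib_add.
Proof. by move=> *; apply: fib_ext; rewrite !addE addrA. Qed.
Let addC : commutative fib_add.
Proof. by move=> *; apply: fib_ext; rewrite !addE addrC. Qed.
Let add0 : left_id (fib_mk 0) fib_add.
Proof. by move=> *; apply: fib_ext; rewrite !addE zeroE add0r. Qed.
Let addN : left_inverse (fib_mk 0) fib_opp fib_add.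
Proof. by move=> *; apply: fib_ext; rewrite !addE oppE zeroE addNr. Qed.

HB.instance Definition _ := GRing.isZmodule.Build T addA addC add0 addN.

Let scaleA a b w : fib_scale a (fib_scale b w) = fib_scale (a * b) w.
Proof. by apply: fib_ext; rewrite !scaleE scalerA. Qed.
Let scale1 : left_id 1 fib_scale.
Proof. by move=> *; apply: fib_ext; rewrite !scaleE scale1r. Qed.
Let scaleDr : right_distributive fib_scale +%R.
Proof. by move=> *; apply: fib_ext; rewrite scaleE !addE !scaleE scalerDr. Qed.
Let scaleDl w : {morph fib_scale^~ w : a b / a + b}.
Proof. by move=> *; apply: fib_ext; rewrite scaleE !addE !scaleE scalerDl. Qed.

HB.instance Definition _ := GRing.Zmodule_isLmodule.Build R T scaleA scale1 scaleDr scaleDl.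

Lemma fib_vec_linear : linear fib_vec.
Proof. by move=> a u v; rewrite -scaleE -addE. Qed.

End fibre_module.

Definition idem_fibre_module x : GRing.Lmodule R (fibre idem_proj x) :=
  GRing.Lmodule.class (idem_fibre x : lmodType R).

Section local.
Variable x0 : S.

(* [g0] is the identity at [x0] and intertwines the two idempotents:
   [idem_at x0 *m g0 x = g0 x *m idem_at x]. *)
Definition g0 x := idem_at x0 *m idem_at x + (1%:M - idem_at x0) *m (1%:M - idem_at x).

Lemma g0_mul x : g0 x *m idem_at x = idem_at x0 *m idem_at x.
Proof.
by rewrite /g0 mulmxDl -!mulmxA [(1%:M - idem_at x) *m _]mulmxBl mul1mx idem_atM subrr mulmx0 addr0.
Qed.

Lemma mul_g0 x : idem_at x0 *m g0 x = idem_at x0 *m idem_at x.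
Proof.
by rewrite /g0 mulmxDr !mulmxA idem_atM [idem_at x0 *m (_ - _)]mulmxBr mulmx1 idem_atM subrr mul0mx addr0.
Qed.

Lemma g0_id : g0 x0 = 1%:M.
Proof.
rewrite /g0 mulmxBr mulmx1 [(1%:M - _) *m idem_at x0]mulmxBl mul1mx idem_atM subrr subr0.
by rewrite addrC subrK.
Qed.

Lemma g0_near x : @mx_near R S x n n g0.
Proof.
apply: (mx_nearD dS); apply: (mx_nearM dS); try exact: (mx_near_cst dS); first exact: idem_at_near.
by apply: (mx_nearD dS); [exact: (mx_near_cst dS)|apply: (mx_nearN dS); exact: idem_at_near].
Qed.

Definition idem_nbhs : set S := [set x | g0 x \in unitmx].

Lemma idem_nbhs_open : open idem_nbhs.
Proof.
apply: nbhs_is_open => x; exact: (unitmx_near dS (@g0_near x)).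
Qed.

Lemma idem_nbhs_self : idem_nbhs x0.
Proof. by rewrite /idem_nbhs /= g0_id unitmx1. Qed.

(** The factorization identifies [R^r] with the fibre over [x0] by [v *m B], with inverse given by
    [C]. By the intertwining property [g0 x] carries the fibre over [x0] into the fibre over [x],
    bijectively where it is invertible. *)
Lemma idem_ltriv r (C : 'M[R]_(n, r)) (B : 'M[R]_(r, n)) :
  B *m C = 1%:M -> C *m B = idem_at x0 ->
  ltriv idem_fibre_module idem_nbhs
    (fun w => idem_vec w *m invmx (g0 (idem_proj w)) *m C)
    (fun x (v : 'rV[R]_r) => idem_mk x (v *m B *m g0 x)).
Proof.
move=> BC CB.
have mkvec x v : idem_vec (idem_mk x (v *m B *m g0 x)) = v *m B *m g0 x.
  by rewrite -[LHS]/(v *m B *m g0 x *m idem_at x) -[LHS]mulmxA g0_mul -mul_g0 -CB !mulmxA -[v *m B *m C]mulmxA BC mulmx1.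
have mm : @is_morphism R (gen_fspace (@prod_gens R S r)) idem_total
    (fun p => idem_mk p.1 (p.2 *m B *m g0 p.1)).
  have dGr := prod_gen_ds r dS; have fm := @fst_morphism R S r.
  apply: (@idem_mk_morphism (gen_fspace (@prod_gens R S r)) (fun p => p.1) (fun p => p.2 *m B *m g0 p.1)) => //.
  move=> p; apply: (mx_nearM dGr); last exact: (mx_near_comp fm (@g0_near _)).
  apply: (mx_nearM dGr); last exact: (mx_near_cst dGr).
  by move=> i j; rewrite ord1; apply: fs_fun_near; apply: smgen_sub; right; exists j.
split.
- move=> w Uw; apply: idem_ext => //; rewrite mkvec -!mulmxA [C *m _]mulmxA CB mul_g0 -g0_mul.
  by rewrite !mulmxA mulmxKV // idem_vecK.
- by [].
- by move=> x v Ux; rewrite mkvec mulmxK // -mulmxA BC mulmx1.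
- move=> x Ux a u v; rewrite (svalP u) (svalP v) (svalP (a *: u + v)).
  have -> : idem_vec (sval (a *: u + v)) = a *: idem_vec (sval u) + idem_vec (sval v).
    exact: (@fib_vec_linear x a u v).
  by rewrite !mulmxDl -!scalemxAl.
- move=> w Uw i; have dE := ds_axioms idem_total.
  apply: (mx_nearM dE (M := fun w => idem_vec w *m invmx (g0 (idem_proj w))) (N := fun=> C)); last exact: (mx_near_cst dE).
  apply: (mx_nearM dE); first exact: idem_vec_near.
  apply: (mx_near_comp (M := fun y => invmx (g0 y)) idem_proj_morphism).
  by apply: (mx_nearV dS) => //; exact: g0_near.
- by move=> x v Ux; exact: mm.1.
- by move=> x v Ux F CF; apply: fs_fun_near; exact: (mm.2 F CF).
Qed.

End local.

Lemma idem_trivial : trivial_cover idem_fibre_module idem_nbhs (fun x => \rank (idem_at x)).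
Proof.
split => [x||x]; first exact: idem_nbhs_open.
  by apply/seteqP; split => // x _; exists x => //; exact: idem_nbhs_self.
apply: (ltriv_trivialization dS _ idem_proj_morphism) (idem_ltriv (idempotent_base (idem_atM x)) (mulmx_base _)).
all: try exact: (ds_axioms idem_total); try exact: stratifold_atlas; try exact: stratifold_stratum.
exact: idem_nbhs_open.
Qed.

Lemma idem_trivial_exists : exists (J : Type) U (m : J -> nat), trivial_cover idem_fibre_module U m.
Proof. by exists S, idem_nbhs, (fun x => \rank (idem_at x)); exact: idem_trivial. Qed.

Definition idem_bundle : vbundle S :=
  @VBundle R S idem_total idem_proj idem_fibre_module idem_proj_morphism idem_trivial_exists.

Lemma idem_bundle_bounded : bounded_rank idem_bundle.
Proof.
exists S, idem_nbhs, (fun x => \rank (idem_at x)); split; first exact: idem_trivial.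
by exists n => x; exact: rank_leq_row.
Qed.

End idempotent_bundle.

(** * From projective modules to bundles *)

(** Projectivity splits the surjection [g] from a free module by some [h]; [e] is the matrix of
    [h \o g]. *)
Lemma fgp_idempotent (A : pzRingType) (P : lmodType A) : is_fgp P ->
  exists (n : nat) (e : 'M[A]_n) (g : {linear 'rV[A]_n -> P}) (h : {linear P -> 'rV[A]_n}),
    [/\ e *m e = e, cancel h g & forall c, h (g c) = c *m e].
Proof.
move=> [[n [v vP]] projP].
pose g0 (c : 'rV[A]_n) : P := \sum_i c 0 i *: v i.
have g0l : linear g0.
  move=> a c d; rewrite /g0 scaler_sumr -big_split /=; apply: eq_bigr => i _.
  by rewrite !mxE scalerDl scalerA.
pose g : {linear 'rV[A]_n -> P} := HB.pack g0 (GRing.isLinear.Build _ _ _ _ g0 g0l).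
have [|h hg] := projP _ _ g [the {linear P -> P} of idfun].
  move=> p; have [c ->] := vP p; exists (\row_i c i).
  by apply: eq_bigr => i _; rewrite mxE.
pose e : 'M[A]_n := \matrix_i h (v i).
have hgE c : h (g c) = c *m e.
  rewrite mulmx_sum_row linear_sum; apply: eq_bigr => i _.
  by rewrite linearZ rowK.
exists n, e, g, h; split => //.
apply/row_matrixP => i; rewrite row_mul rowK -hgE.
by rewrite [g _]hg.
Qed.

Section idempotent_sections.
Variables (R : realType) (S : stratifold R) (n : nat) (e : 'M[algebra S]_n).
Hypothesis ee : e *m e = e.
Local Notation E := (idem_bundle ee).
Local Notation dS := (ds_axioms S).
Variable cE : sections_closed E.
Local Notation ev x := (map_mx (@eval_at R S x)).

Lemma idem_section_subproof (c : 'rV[algebra S]_n) :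
  is_section (fun x => idem_mk ee x (ev x c) : E).
Proof.
split => //; apply: (idem_mk_morphism ee dS (is_morphism_id S)) => x i j.
apply: (eq_fs_near (g := fun y => eval_at y (c i j))).
  by apply: near_all => y; rewrite mxE.
by apply: fs_fun_near; exact: eval_at_fun.
Qed.

Definition idem_section (c : 'rV[algebra S]_n) : Gamma cE := exist _ _ (idem_section_subproof c).

Definition sec_vec (s : Gamma cE) x : 'rV[R]_n := fib_vec (sec_at s x : idem_fibre e x).

Lemma sec_vec_ext (s t : Gamma cE) : (forall x, sec_vec s x = sec_vec t x) -> s = t.
Proof. by move=> st; apply: gsection_ext => x; exact: (@fib_ext _ _ _ e x _ _ (st x)). Qed.

Lemma sec_vec_linear a (s t : Gamma cE) x :
  sec_vec (a *: s + t) x = eval_at x a *: sec_vec s x + sec_vec t x.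
Proof.
rewrite -(@fib_vec_linear _ _ _ _ ee x (eval_at x a) (sec_at s x) (sec_at t x)).
rewrite /sec_vec; congr fib_vec.
rewrite -[LHS]/(sec_at (sec_add (sec_scale a s) t) x) sec_addE sec_scaleE //.
Qed.

Lemma sec_vecK (s : Gamma cE) x : sec_vec s x *m idem_at e x = sec_vec s x.
Proof. exact: fib_vecK. Qed.

Lemma sec_vec_section c x : sec_vec (idem_section c) x = ev x (c *m e).
Proof. by rewrite map_mxM. Qed.

Lemma sec_coord_fun (s : Gamma cE) j : (fun x => sec_vec s x 0 j) \in @structure_fun R S.
Proof.
apply/mem_set; apply: (fs_nearP dS) => x.
exact: (mx_near_comp (X := S) (Y := idem_total e) (f := sval s) (M := @idem_vec R S n e)
  (svalP s).1 (@idem_vec_near R S n e (sval s x)) 0 j).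
Qed.

Definition sec_row (s : Gamma cE) : 'rV[algebra S]_n :=
  \row_j exist (fun f => f \in @structure_fun R S) _ (sec_coord_fun s j).

Lemma sec_rowE s x : ev x (sec_row s) = sec_vec s x.
Proof. by apply/rowP => j; rewrite !mxE. Qed.

Lemma ev_ext (c d : 'rV[algebra S]_n) : (forall x, ev x c = ev x d) -> c = d.
Proof.
move=> cd; apply/rowP => j; apply: algebra_ext => x.
by have /rowP/(_ j) := cd x; rewrite !mxE.
Qed.

Lemma sec_row_linear : linear sec_row.
Proof.
move=> a s t; apply: ev_ext => x.
rewrite map_mxD map_mxZ !sec_rowE; exact: sec_vec_linear.
Qed.

Lemma idem_section_linear : linear idem_section.
Proof.
move=> a c d; apply: sec_vec_ext => x; rewrite sec_vec_linear !sec_vec_section.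
by rewrite mulmxDl -scalemxAl map_mxD map_mxZ.
Qed.

End idempotent_sections.

(** Both modules are the rows over the structure algebra fixed by [e]: [P] through [h], and the
    sections through their coordinate rows, since a section has values in the images of the
    evaluated matrices. *)
Lemma fgp_sections_bundle (R : realType) (S : stratifold R) (P : lmodType (algebra S)) : is_fgp P ->
  exists E : vbundle S, bounded_rank E /\ forall cE : sections_closed E,
    exists (f : {linear Gamma cE -> P}) (g : {linear P -> Gamma cE}), cancel f g /\ cancel g f.
Proof.
move=> /fgp_idempotent[n [e [g [h [ee hK gK]]]]].
exists (idem_bundle ee); split; first exact: idem_bundle_bounded.
move=> cE.
pose sr : {linear Gamma cE -> _} := HB.pack (@sec_row _ _ _ _ ee cE)
  (GRing.isLinear.Build _ _ _ _ (@sec_row _ _ _ _ ee cE) (@sec_row_linear _ _ _ _ ee cE)).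
pose si : {linear _ -> Gamma cE} := HB.pack (@idem_section _ _ _ _ ee cE)
  (GRing.isLinear.Build _ _ _ _ (@idem_section _ _ _ _ ee cE) (@idem_section_linear _ _ _ _ ee cE)).
exists [the {linear _ -> _} of g \o sr], [the {linear _ -> _} of si \o h]; split => [s|p].
  apply: sec_vec_ext => x; rewrite [LHS](@sec_vec_section _ _ _ _ ee cE) /= gK -mulmxA ee map_mxM.
  by rewrite sec_rowE sec_vecK.
rewrite /=; rewrite -[RHS]hK; congr (g _); apply: ev_ext => x.
by rewrite [LHS](@sec_rowE _ _ _ _ ee cE) sec_vec_section -gK !hK.
Qed.

(** * The equivalence of categories *)

(** Choose preimages of objects with isomorphisms [u] and [v], and lift conjugated morphisms;
    faithfulness turns the choice into a functor, with [u] as natural isomorphism on one side and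
    lifts of [u] on the other. *)
Lemma fully_faithful_essentially_surjective (C D : category) (F : functor C D) :
  (forall a b (f g : Defs.hom a b), Defs.fmap F f = Defs.fmap F g -> f = g) ->
  (forall a b (h : Defs.hom (F a) (F b)), exists f, Defs.fmap F f = h) ->
  (forall d, exists c (u : Defs.hom (F c) d) (v : Defs.hom d (F c)),
     Defs.comp u v = idm d /\ Defs.comp v u = idm (F c)) ->
  is_equivalence F.
Proof.
move=> faithful full esurj.
pose lift a b (h : Defs.hom (F a) (F b)) := sval (cid (full a b h)).
have liftK a b (h : Defs.hom (F a) (F b)) : Defs.fmap F (lift a b h) = h by exact: svalP (cid (full a b h)).
pose ob d := sval (cid (esurj d)).
pose u d : Defs.hom (F (ob d)) d := sval (cid (svalP (cid (esurj d)))).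
pose v d : Defs.hom d (F (ob d)) := sval (cid (svalP (cid (svalP (cid (esurj d)))))).
have uv d : Defs.comp (u d) (v d) = idm d by exact: (svalP (cid (svalP (cid (svalP (cid (esurj d))))))).1.
have vu d : Defs.comp (v d) (u d) = idm (F (ob d)) by exact: (svalP (cid (svalP (cid (svalP (cid (esurj d))))))).2.
pose mor d d' (h : Defs.hom d d') := lift _ _ (Defs.comp (v d') (Defs.comp h (u d))).
have mor1 d : mor d d (idm d) = idm (ob d).
  by apply: faithful; rewrite /mor liftK comp1m vu fmap1.
have morM d d' d'' (k : Defs.hom d' d'') (h : Defs.hom d d') :
    mor d d'' (Defs.comp k h) = Defs.comp (mor d' d'' k) (mor d d' h).
  apply: faithful; rewrite /mor fmapM !liftK -!compmA; congr (Defs.comp _ (Defs.comp _ _)).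
  by rewrite !compmA uv comp1m.
exists (@Functor D C ob mor mor1 morM); split.
  exists (fun a => lift _ _ (u (F a))), (fun a => lift _ _ (v (F a))); split=> [a b f|a|a].
  - by apply: faithful; rewrite /= !fmapM !liftK compmA uv comp1m.
  - by apply: faithful; rewrite fmapM !liftK vu fmap1.
  - by apply: faithful; rewrite fmapM !liftK uv fmap1.
exists u, v; split=> // d d' h.
by rewrite /= liftK compmA uv comp1m.
Qed.

Theorem theorem1p2 (R : realType) (S : stratifold R) :
  exists (closed_sections : forall E : VBb S, sections_closed (sval E))
         (fgp_sections : forall E : VBb S, is_fgp (Gamma (closed_sections E))),
    is_equivalence (global_sections fgp_sections).
Proof.
pose cs (E : VBb S) := sections_closedP (sval E).
have fgp (E : VBb S) : is_fgp (Gamma (cs E)).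
  have [I [b [q fr]]] := bounded_rank_frame (svalP E).
  exact: frame_fgp fr.
exists cs, fgp; apply: fully_faithful_essentially_surjective.
- move=> E F f g fg; have [I [b [q fr]]] := bounded_rank_frame (svalP E).
  apply: (@push_inj R S _ (cs E) _ _ _ fr _ (cs F)) => s.
  exact: (congr1 (fun k : {linear Gamma (cs E) -> Gamma (cs F)} => k s) fg).
- move=> E F Phi; have [I [b [q fr]]] := bounded_rank_frame (svalP E).
  have [f fE] := @push_surj R S _ (cs E) _ _ _ fr _ (cs F) Phi.
  by exists f; exact: linear_ext.
- move=> [P fgpP]; have [E [bE h]] := fgp_sections_bundle fgpP.
  pose c : VBb S := exist _ E bE.
  have [f [g [fK gK]]] := h (cs c).
  exists c, f, g; split; apply: linear_ext; [exact: gK|exact: fK].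
Qed.
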